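(* Suppose $p:\mathbb R\times\mathbb R\times\mathcal P_2(\mathbb R)\to\mathbb R$ has first and second linear functional derivatives in its measure argument satisfying $$\sup_{x,z\in\mathbb R,\mu\in\mathcal P_2(\mathbb R)}\Big|\frac{\delta}{\delta m}p(x,y,\mu)[z]\Big|+\sup_{x,z,\bar z\in\mathbb R,\mu\in\mathcal P_2(\mathbb R)}\Big|\frac{\delta^2}{\delta m^2}p(x,y,\mu)[z,\bar z]\Big|\le C(1+|y|^k)$$ for some $C>0$, $k\in\mathbb N$ independent of $y\in\mathbb R$, and that $p(x,y,\cdot):\mathcal P_2(\mathbb R)\to\mathbb R$ is Lipschitz continuous in $\mathbb W_2$ for all $x,y\in\mathbb R$. Assume hypotheses (H1)–(H7) and (H9) listed in the context. Let $(\bar X^{i,\epsilon},\bar Y^{i,\epsilon})$, $i\in\mathbb N$, be the i.i.d. slow-fast McKean–Vlasov particles defined in the context and $\bar\mu^{\epsilon,N}_t=\frac1N\sum_{i=1}^N\delta_{\bar X^{i,\epsilon}_t}$. Then there exists $C>0$ independent of $N$ such that for all $t\in[0,T]$ (and all $N\ge2$, $1\le i\le N$), $$\mathbb E\Big[\big|p(\bar X^{i,\epsilon}_t,\bar Y^{i,\epsilon}_t,\bar\mu^{\epsilon,N}_t)-p(\bar X^{i,\epsilon}_t,\bar Y^{i,\epsilon}_t,\mathcal L(\bar X^\epsilon_t))\big|^2\Big]\le\frac C{N-1},$$ where $\bar X^\epsilon$ has the common law of the $\bar X^{i,\epsilon}$.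
   Context: **Notation.** $\mathcal P_2(\mathbb R)$: probability measures on $\mathbb R$ with finite second moment, with the 2-Wasserstein metric $\mathbb W_2$. $\partial_\mu G(\mu)[z]$: Lions derivative. The linear functional derivative $\frac{\delta}{\delta m}G(\mu)[z]$ is a function jointly continuous in $(z,\mu)$, of at most quadratic growth in $z$ uniformly for $\mu$ in bounded sets, with $G(\nu_2)-G(\nu_1)=\int_0^1\int\frac{\delta}{\delta m}G((1-r)\nu_1+r\nu_2)[z](\nu_2-\nu_1)(dz)dr$; $\frac{\delta^2}{\delta m^2}$ is its iterate (again jointly continuous). A function $G(x,y,\mu)[z_1,\dots,z_n]$ ($n\ge0$ = number of Lions derivatives; $x,y$ possibly vectors) has $y$-order $\le k$ if it exists, is jointly continuous, and $\sup_{x,\mu}\big(\int|G(x,y,\mu)[z_1,\dots,z_n]|^2\mu(dz_1)\cdots\mu(dz_n)\big)^{1/2}\le C(1+|y|)^k$. **Setting.** $T>0$; $\epsilon=\epsilon(N)\to0$ as $N\to\infty$; $b,c,\sigma,f,g,\tau_1,\tau_2:\mathbb R\times\mathbb R\times\mathcal P_2(\mathbb R)\to\mathbb R$; $(\eta^x,\eta^y)\in\mathbb R^2$; $W^i,B^i$ independent standard Brownian motions. The i.i.d. slow-fast McKean–Vlasov particles solve, with arguments $(\bar X^{i,\epsilon}_t,\bar Y^{i,\epsilon}_t,\mathcal L(\bar X^{\epsilon}_t))$ suppressed, $$d\bar X^{i,\epsilon}_t=[\tfrac1\epsilon b+c]dt+\sigma dW^i_t,\quad d\bar Y^{i,\epsilon}_t=\tfrac1\epsilon[\tfrac1\epsilon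 f+g]dt+\tfrac1\epsilon[\tau_1dW^i_t+\tau_2dB^i_t],\quad(\bar X^{i,\epsilon}_0,\bar Y^{i,\epsilon}_0)=(\eta^x,\eta^y).$$ The interacting particle system is the same system for $N$ pairs with $\mathcal L(\bar X^\epsilon_t)$ replaced by the empirical measure of the $N$ slow components. $\mathbf a=\frac12(\tau_1^2+\tau_2^2)$, $L_{x,\mu}\phi(y)=f(x,y,\mu)\phi'(y)+\mathbf a(x,y,\mu)\phi''(y)$, $\pi(\cdot;x,\mu)$ the unique probability measure with $L_{x,\mu}^*\pi=0$. $\Phi$ is the unique classical solution (polynomial growth in $y$) of $L_{x,\mu}\Phi=-b$, $\int\Phi(x,y,\mu)\pi(dy;x,\mu)=0$. $\gamma=b\Phi_x+g\Phi_y+\sigma\tau_1\Phi_{xy}+c$, $D=b\Phi+\sigma\tau_1\Phi_y+\frac12\sigma^2$, $\bar\gamma,\bar D$ their integrals against $\pi(dy;x,\mu)$; the limiting SDE is $dX_t=\bar\gamma(X_t,\mathcal L(X_t))dt+\sqrt{2\bar D(X_t,\mathcal L(X_t))}dW_t$, $X_0=\eta^x$. **Hypotheses.** (H1) $0<\lambda_-\le\tau_1^2+\tau_2^2\le\lambda_+<\infty$; $\tau_1,\tau_2$ have two uniformly bounded $y$-derivatives, jointly continuous in $(x,y,\mathbb W_2)$. (H2) There are $\beta,\kappa>0$ with $f=-\kappa y+\eta(x,y,\mu)$, $\eta$ bounded uniformly in $x,\mu$, globally Lipschitz in $(x,y,\mathbb W_2)$, with $y$-Lipschitz constant $L_\eta<\kappa$;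 and $2(f(x,y_1,\mu)-f(x,y_2,\mu))(y_1-y_2)+3\sum_{j=1,2}|\tau_j(x,y_1,\mu)-\tau_j(x,y_2,\mu)|^2\le-\beta|y_1-y_2|^2$ for all $x,y_1,y_2,\mu$. (H3) $\int b(x,y,\mu)\pi(dy;x,\mu)=0$ for all $x,\mu$; $b$ jointly continuous, of at most polynomial growth in $y$ uniformly in $x,\mu$. (H4) Strong existence and uniqueness hold for the interacting particle system (all $N$), the slow-fast McKean–Vlasov SDE, and the limiting SDE. (H5) $g,\sigma$ bounded; $b,c$ of at most linear growth in $y$ uniformly in $x,\mu$; all coefficients jointly continuous. (H6) $\Phi,\Phi_x,\Phi_y$ have $y$-order $\le0$; $\Phi_{xx},\partial_\mu\Phi,\partial_\mu\Phi_x,\partial_z\partial_\mu\Phi,\partial_\mu^2\Phi,\partial_\mu\Phi_y$ have $y$-order $\le1$. (H7) With $L^2_{x,\bar x,\mu}\psi(y,\bar y)=f(x,y,\mu)\psi_y+f(\bar x,\bar y,\mu)\psi_{\bar y}+\mathbf a(x,y,\mu)\psi_{yy}+\mathbf a(\bar x,\bar y,\mu)\psi_{\bar y\bar y}$, there is a unique classical solution $\chi(x,\bar x,y,\bar y,\mu)$ of $L^2_{x,\bar x,\mu}\chi=-b(x,y,\mu)\partial_\mu\Phi(\bar x,\bar y,\mu)[x]$, $\int\int\chi\,\pi(dy;x,\mu)\pi(d\bar y;\bar x,\mu)=0$; with $\mathbf x=(x,\bar x)$, $\mathbf y=(y,\bar y)$ in the roles of $x,y$: $\chi,\partial_{\mathbf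 x}\chi,\partial_{\mathbf y}\chi$ have $\mathbf y$-order $\le0$, and $\partial^2_{\mathbf x}\chi,\partial_\mu\chi,\partial_\mu\partial_{\mathbf x}\chi,\partial_z\partial_\mu\chi,\partial_\mu^2\chi,\partial_{\mathbf x}\partial_{\mathbf y}\chi,\partial_\mu\partial_{\mathbf y}\chi,\partial^2_{\mathbf y}\chi$ have $\mathbf y$-order $\le1$. (H9) $\gamma$, $\sigma+\tau_1\Phi_y$, $\tau_2\Phi_y$, $\tau_1$, $\tau_2$ are globally Lipschitz in $(x,y,\mathbb W_2)$. *)

(* Defs.v *)
From HB Require Import structures.
From mathcomp Require Import all_boot all_order all_algebra.
From mathcomp Require Import all_classical all_reals all_analysis measurable_realfun.

Set Implicit Arguments.
Unset Strict Implicit.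
Unset Printing Implicit Defensive.

Import Order.TTheory GRing.Theory Num.Theory.
Import numFieldNormedType.Exports.

Local Open Scope classical_set_scope.
Local Open Scope ring_scope.

Record P2 (R : realType) := MkP2 {
  p2_prob :> probability (measurableTypeR R) R;
  p2_moment : (\int[p2_prob]_x (x ^+ 2)%:E < +oo)%E }.

#[warnings="-redundant-canonical-projection"]
HB.instance Definition _ (R : realType) := gen_eqMixin (P2 R).
HB.instance Definition _ (R : realType) := gen_choiceMixin (P2 R).

Lemma dirac0_moment (R : realType) :
  (\int[@dirac _ (measurableTypeR R) 0%R R]_x (x ^+ 2)%:E < +oo)%E.
Proof.
rewrite integral_dirac//; first by rewrite diracE in_setT mul1e ltry.
by apply/measurable_EFinP; exact: measurable_funX.
Qed.

Definition delta0 (R : realType) : P2 R := MkP2 (@dirac0_moment R).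

(* The element of P2 that agrees with the set function m on Borel sets; only
   meaningful when m is a probability measure with finite second moment
   (otherwise it may be delta0).  Library measures are set functions on all
   sets, hence determined by m only up to their values on non-Borel sets; this
   is harmless because every function on P2 below is continuous for W2, or
   determined by such functions (the invariant measures), and W2
   only sees Borel sets. *)
Definition toP2 (R : realType) (m : set (measurableTypeR R) -> \bar R) : P2 R :=
  xget (delta0 R) [set mu : P2 R | forall A, measurable A -> mu A = m A].

Definition law (R : realType) (d : measure_display) (Omega : measurableType d)
    (P : probability Omega R) (X : Omega -> measurableTypeR R) : P2 R :=
  toP2 (pushforward P X).

Definition empirical (R : realType) (N : nat) (x : 'I_N -> R) : P2 R :=
  toP2 (fun A => ((N%:R^-1)%:E * \sum_(i < N) @dirac _ (measurableTypeR R) (x i) R A)%E).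

Definition mixture (R : realType) (r : R) (nu1 nu2 : P2 R) : P2 R :=
  toP2 (fun A => ((1 - r)%:E * nu1 A + r%:E * nu2 A)%E).

Definition coupling (R : realType) (mu nu : P2 R)
    (q : probability (measurableTypeR R * measurableTypeR R)%type R) : Prop :=
  forall A : set (measurableTypeR R), measurable A ->
    q (A `*` setT) = mu A /\ q (setT `*` A) = nu A.

Definition W2 (R : realType) (mu nu : P2 R) : R :=
  Num.sqrt (fine (ereal_inf
    [set (\int[q]_u ((u.1 - u.2) ^+ 2)%:E)%E | q in coupling mu nu])).

Definition jcont (R : realType) (U : pseudoMetricType R) (G : U -> P2 R -> R) : Prop :=
  forall u mu (e : R), 0 < e -> exists2 d : R, 0 < d &
    forall v nu, ball u d v -> W2 mu nu < d -> `|G v nu - G u mu| < e.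

Definition jcont2 (R : realType) (G : R -> R -> P2 R -> R) : Prop :=
  jcont (fun (u : R * R) mu => G u.1 u.2 mu).

Definition lipschitz3 (R : realType) (G : R -> R -> P2 R -> R) : Prop :=
  exists L : R, forall x x' y y' mu nu,
    `|G x y mu - G x' y' nu| <= L * (`|x - x'| + `|y - y'| + W2 mu nu).

Definition square_integrable (R : realType) (d : measure_display)
    (Omega : measurableType d) (P : probability Omega R)
    (X : Omega -> measurableTypeR R) : Prop :=
  measurable_fun setT X /\ (\int[P]_w (X w ^+ 2)%:E < +oo)%E.

Definition L2norm (R : realType) (d : measure_display)
    (Omega : measurableType d) (P : probability Omega R) (X : Omega -> R) : R :=
  Num.sqrt (fine (\int[P]_w (X w ^+ 2)%:E)%E).

(* The atomless space carrying the lift X |-> G (law X). *)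
Definition lift_prob (R : realType) : probability (measurableTypeR R) R :=
  uniform_prob (@ltr01 R).

(* The lift of G is Frechet differentiable at some X of law mu, with
   gradient D(X). *)
Definition lions_derivative_at (R : realType) (G : P2 R -> R) (mu : P2 R)
    (D : R -> R) : Prop :=
  [/\ measurable_fun setT (D : measurableTypeR R -> measurableTypeR R),
      (\int[mu]_z (D z ^+ 2)%:E < +oo)%E &
  exists X : measurableTypeR R -> measurableTypeR R,
  [/\ square_integrable (lift_prob R) X,
      forall A : set (measurableTypeR R), measurable A ->
        lift_prob R (X @^-1` A) = mu A &
  forall e : R, 0 < e -> exists2 d : R, 0 < d &
    forall H : measurableTypeR R -> measurableTypeR R,
      square_integrable (lift_prob R) H -> L2norm (lift_prob R) H < d ->
      `| G (law (lift_prob R) (fun w => X w + H w)) - G (law (lift_prob R) X)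
         - \int[lift_prob R]_w (D (X w) * H w) |
      <= e * L2norm (lift_prob R) H]].

(* Frechet differentiability determines D mu only mu-a.e.; joint continuity in
   (z, mu) makes D unique. *)
Definition is_lions_derivative (R : realType) (G : P2 R -> R)
    (D : P2 R -> R -> R) : Prop :=
  (forall mu, lions_derivative_at G mu (D mu)) /\ jcont (fun z mu => D mu z).

Definition lions_differentiable (R : realType) (G : P2 R -> R) : Prop :=
  exists D, is_lions_derivative G D.

Definition lionsD (R : realType) (G : P2 R -> R) : P2 R -> R -> R :=
  xget (fun _ _ => 0) [set D | is_lions_derivative G D].

(* W2-bounded sets are those with bounded second moment. *)
Definition is_lfd (R : realType) (G : P2 R -> R) (D : P2 R -> R -> R) : Prop :=
  [/\ jcont (fun z mu => D mu z),
      forall M : R, exists C : R, forall mu : P2 R,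
        (\int[mu]_z (z ^+ 2)%:E <= M%:E)%E ->
        forall z, `|D mu z| <= C * (1 + z ^+ 2) &
      forall nu1 nu2 : P2 R,
        G nu2 - G nu1 =
        \int[@lebesgue_measure R]_(r in `[0, 1])
          (\int[nu2]_z D (mixture r nu1 nu2) z
           - \int[nu1]_z D (mixture r nu1 nu2) z)].

Definition is_lfd2 (R : realType) (D : P2 R -> R -> R)
    (D2 : P2 R -> R -> R -> R) : Prop :=
  jcont (fun (u : R * R) mu => D2 mu u.1 u.2) /\
  forall z, is_lfd (fun mu => D mu z) (fun mu zbar => D2 mu z zbar).

Section yorder.
Context {R : realType} {X Y : normedModType R}.
Implicit Types (G : X -> Y -> P2 R -> R) (k : nat).

Definition yorder0 G k : Prop :=
  jcont (fun (u : X * Y) mu => G u.1 u.2 mu) /\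
  exists C : R, forall x y mu, `|G x y mu| <= C * (1 + `|y|) ^+ k.

Definition yorder1 (G : X -> Y -> P2 R -> R -> R) k : Prop :=
  jcont (fun (u : X * Y * R) mu => G u.1.1 u.1.2 mu u.2) /\
  exists C : R, forall x y (mu : P2 R),
    ((\int[mu]_z (`|G x y mu z| ^+ 2)%:E) `^ 2^-1 <= (C * (1 + `|y|) ^+ k)%:E)%E.

Definition yorder2 (G : X -> Y -> P2 R -> R -> R -> R) k : Prop :=
  jcont (fun (u : X * Y * (R * R)) mu => G u.1.1 u.1.2 mu u.2.1 u.2.2) /\
  exists C : R, forall x y (mu : P2 R),
    ((\int[mu]_z1 \int[mu]_z2 (`|G x y mu z1 z2| ^+ 2)%:E) `^ 2^-1
       <= (C * (1 + `|y|) ^+ k)%:E)%E.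

Definition dx (v : X) G x y mu : R := 'D_v (fun x' => G x' y mu) x.
Definition dy (v : Y) G x y mu : R := 'D_v (fun y' => G x y' mu) y.
Definition dmu G x y mu z : R := lionsD (G x y) mu z.

Definition dx_yorder (v : X) G k : Prop :=
  (forall x y mu, derivable (fun x' => G x' y mu) x v) /\ yorder0 (dx v G) k.

Definition dy_yorder (v : Y) G k : Prop :=
  (forall x y mu, derivable (fun y' => G x y' mu) y v) /\ yorder0 (dy v G) k.

Definition dmu_yorder G k : Prop :=
  (forall x y, lions_differentiable (G x y)) /\ yorder1 (dmu G) k.

Definition dz_dmu_yorder G k : Prop :=
  (forall x y mu z, derivable (dmu G x y mu) z 1) /\
  yorder1 (fun x y mu => derive1 (dmu G x y mu)) k.

Definition dmu2_yorder G k : Prop :=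
  (forall x y z1, lions_differentiable (fun mu => dmu G x y mu z1)) /\
  yorder2 (fun x y mu z1 z2 => lionsD (fun nu => dmu G x y nu z1) mu z2) k.

End yorder.

Record coeffs (R : realType) := Coeffs {
  cb : R -> R -> P2 R -> R;
  cc : R -> R -> P2 R -> R;
  csigma : R -> R -> P2 R -> R;
  cf : R -> R -> P2 R -> R;
  cg : R -> R -> P2 R -> R;
  ctau1 : R -> R -> P2 R -> R;
  ctau2 : R -> R -> P2 R -> R }.

Definition diff_a (R : realType) (q : coeffs R) x y mu : R :=
  (ctau1 q x y mu ^+ 2 + ctau2 q x y mu ^+ 2) / 2.

Definition bounded3 (R : realType) (G : R -> R -> P2 R -> R) : Prop :=
  exists C : R, forall x y mu, `|G x y mu| <= C.

Definition ygrowth (R : realType) (G : R -> R -> P2 R -> R) (k : nat) : Prop :=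
  exists C : R, forall x y mu, `|G x y mu| <= C * (1 + `|y|) ^+ k.

Definition two_bounded_y_derivatives (R : realType) (G : R -> R -> P2 R -> R) : Prop :=
  [/\ forall x y mu, derivable (G x ^~ mu) y 1,
      bounded3 (dy (1 : R) G) /\ jcont2 (dy (1 : R) G),
      forall x y mu, derivable (dy (1 : R) G x ^~ mu) y 1 &
      bounded3 (dy (1 : R) (dy (1 : R) G)) /\ jcont2 (dy (1 : R) (dy (1 : R) G))].

Definition uniformly_nondegenerate (R : realType) (q : coeffs R) : Prop :=
  [/\ exists lm lp : R, 0 < lm /\ forall x y mu,
        lm <= ctau1 q x y mu ^+ 2 + ctau2 q x y mu ^+ 2 <= lp,
      two_bounded_y_derivatives (ctau1 q) &
      two_bounded_y_derivatives (ctau2 q)].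

Definition dissipative (R : realType) (q : coeffs R) : Prop :=
  exists (beta kappa Leta : R) (eta : R -> R -> P2 R -> R),
  [/\ [/\ 0 < beta, 0 < kappa & Leta < kappa],
      forall x y mu, cf q x y mu = - kappa * y + eta x y mu,
      forall y, exists C : R, forall x mu, `|eta x y mu| <= C,
      lipschitz3 eta /\
      (forall x y y' mu, `|eta x y mu - eta x y' mu| <= Leta * `|y - y'|) &
      forall x y1 y2 mu,
        2 * (cf q x y1 mu - cf q x y2 mu) * (y1 - y2)
        + 3 * (`|ctau1 q x y1 mu - ctau1 q x y2 mu| ^+ 2
               + `|ctau2 q x y1 mu - ctau2 q x y2 mu| ^+ 2)
        <= - beta * `|y1 - y2| ^+ 2].

Definition coeffs_growth (R : realType) (q : coeffs R) : Prop :=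
  [/\ bounded3 (cg q) /\ bounded3 (csigma q),
      ygrowth (cb q) 1 /\ ygrowth (cc q) 1,
      [/\ jcont2 (cb q), jcont2 (cc q) & jcont2 (csigma q)] &
      [/\ jcont2 (cf q), jcont2 (cg q), jcont2 (ctau1 q) & jcont2 (ctau2 q)]].

Definition fast_generator (R : realType) (q : coeffs R) x mu (phi : R -> R) (y : R) : R :=
  cf q x y mu * derive1 phi y + diff_a q x y mu * derive1n 2 phi y.

Definition test_function (R : realType) (phi : R -> R) : Prop :=
  (forall n y, derivable (derive1n n phi) y 1) /\
  exists M : R, forall y, M < `|y| -> phi y = 0.

Definition stationary (R : realType) (q : coeffs R) x mu
    (m : probability (measurableTypeR R) R) : Prop :=
  forall phi, test_function phi -> (\int[m]_y (fast_generator q x mu phi y)%:E = 0)%E.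

Definition is_invariant_measure (R : realType) (q : coeffs R)
    (pi : R -> P2 R -> probability (measurableTypeR R) R) : Prop :=
  forall x mu, stationary q x mu (pi x mu) /\
    forall m : probability (measurableTypeR R) R, stationary q x mu m ->
      forall A, measurable A -> m A = pi x mu A.

(* The extended-real integral is 0 only if the integrand is integrable. *)
Definition centering (R : realType) (q : coeffs R)
    (pi : R -> P2 R -> probability (measurableTypeR R) R) : Prop :=
  [/\ forall x mu, (\int[pi x mu]_y (cb q x y mu)%:E = 0)%E,
      jcont2 (cb q) & exists k, ygrowth (cb q) k].

Definition poly_growth (R : realType) (Y : normedModType R) (phi : Y -> R) : Prop :=
  exists (C : R) (k : nat), forall y, `|phi y| <= C * (1 + `|y|) ^+ k.

Definition poisson_solution (R : realType) (q : coeffs R)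
    (pi : R -> P2 R -> probability (measurableTypeR R) R) x mu (phi : R -> R) : Prop :=
  [/\ (forall y, derivable phi y 1) /\ (forall y, derivable (derive1 phi) y 1),
      continuous (derive1n 2 phi : R -> R),
      poly_growth phi,
      forall y, fast_generator q x mu phi y = - cb q x y mu &
      (\int[pi x mu]_y (phi y)%:E = 0)%E].

Definition is_corrector (R : realType) (q : coeffs R)
    (pi : R -> P2 R -> probability (measurableTypeR R) R)
    (Phi : R -> R -> P2 R -> R) : Prop :=
  forall x mu, poisson_solution q pi x mu (Phi x ^~ mu) /\
    forall phi, poisson_solution q pi x mu phi -> phi = Phi x ^~ mu.

Definition corrector_regular (R : realType) (Phi : R -> R -> P2 R -> R) : Prop :=
  [/\ [/\ yorder0 Phi 0, dx_yorder (1 : R) Phi 0 & dy_yorder (1 : R) Phi 0],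
      [/\ dx_yorder (1 : R) (dx (1 : R) Phi) 1, dmu_yorder Phi 1 & dmu_yorder (dx (1 : R) Phi) 1] &
      [/\ dz_dmu_yorder Phi 1, dmu2_yorder Phi 1 & dmu_yorder (dy (1 : R) Phi) 1]].

Definition axis1 (R : realType) : R * R := (1, 0).
Definition axis2 (R : realType) : R * R := (0, 1).
Definition axes (R : realType) : seq (R * R) := [:: axis1 R; axis2 R].

(* x = (x, xbar) and y = (y, ybar) are encoded as pairs. *)
Definition fast_generator2 (R : realType) (q : coeffs R) (x : R * R) mu
    (psi : R * R -> R) (y : R * R) : R :=
  cf q x.1 y.1 mu * 'D_(axis1 R) psi y + cf q x.2 y.2 mu * 'D_(axis2 R) psi y
  + diff_a q x.1 y.1 mu * 'D_(axis1 R) ('D_(axis1 R) psi) y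
  + diff_a q x.2 y.2 mu * 'D_(axis2 R) ('D_(axis2 R) psi) y.

Definition poisson2_solution (R : realType) (q : coeffs R)
    (pi : R -> P2 R -> probability (measurableTypeR R) R)
    (Phi : R -> R -> P2 R -> R) (x : R * R) mu (psi : R * R -> R) : Prop :=
  [/\ forall u v, u \in axes R -> v \in axes R ->
        [/\ forall y, derivable psi y u, forall y, derivable ('D_u psi) y v &
            continuous ('D_v ('D_u psi) : R * R -> R)],
      poly_growth psi,
      forall y, fast_generator2 q x mu psi y = - cb q x.1 y.1 mu * dmu Phi x.2 y.2 mu x.1 &
      (\int[pi x.1 mu]_y1 \int[pi x.2 mu]_y2 (psi (y1, y2))%:E = 0)%E].

Definition is_double_corrector (R : realType) (q : coeffs R)
    (pi : R -> P2 R -> probability (measurableTypeR R) R)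
    (Phi : R -> R -> P2 R -> R) (chi : R * R -> R * R -> P2 R -> R) : Prop :=
  forall x mu, poisson2_solution q pi Phi x mu (chi x ^~ mu) /\
    forall psi, poisson2_solution q pi Phi x mu psi -> psi = chi x ^~ mu.

Definition double_corrector_regular (R : realType)
    (chi : R * R -> R * R -> P2 R -> R) : Prop :=
  [/\ yorder0 chi 0,
      forall u, u \in axes R -> dx_yorder u chi 0 /\ dy_yorder u chi 0,
      [/\ dmu_yorder chi 1, dz_dmu_yorder chi 1 & dmu2_yorder chi 1],
      forall u, u \in axes R -> dmu_yorder (dx u chi) 1 /\ dmu_yorder (dy u chi) 1 &
      forall u v, u \in axes R -> v \in axes R ->
        [/\ dx_yorder v (dx u chi) 1, dx_yorder v (dy u chi) 1 &
            dy_yorder v (dy u chi) 1]].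

Definition coef_gamma (R : realType) (q : coeffs R) (Phi : R -> R -> P2 R -> R) x y mu : R :=
  cb q x y mu * dx (1 : R) Phi x y mu + cg q x y mu * dy (1 : R) Phi x y mu
  + csigma q x y mu * ctau1 q x y mu * dy (1 : R) (dx (1 : R) Phi) x y mu + cc q x y mu.

Definition coef_D (R : realType) (q : coeffs R) (Phi : R -> R -> P2 R -> R) x y mu : R :=
  cb q x y mu * Phi x y mu + csigma q x y mu * ctau1 q x y mu * dy (1 : R) Phi x y mu
  + csigma q x y mu ^+ 2 / 2.

Definition averaged (R : realType)
    (pi : R -> P2 R -> probability (measurableTypeR R) R)
    (G : R -> R -> P2 R -> R) x mu : R :=
  \int[pi x mu]_y G x y mu.

(* The first clause says that the derivative Phi_xy entering gamma exists. *)
Definition effective_lipschitz (R : realType) (q : coeffs R)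
    (Phi : R -> R -> P2 R -> R) : Prop :=
  [/\ forall x y mu, derivable (fun y' => dx (1 : R) Phi x y' mu) y 1,
      lipschitz3 (coef_gamma q Phi),
      lipschitz3 (fun x y mu => csigma q x y mu + ctau1 q x y mu * dy (1 : R) Phi x y mu),
      lipschitz3 (fun x y mu => ctau2 q x y mu * dy (1 : R) Phi x y mu) &
      lipschitz3 (ctau1 q) /\ lipschitz3 (ctau2 q)].

(* Processes are functions R -> Omega -> R; only times t >= 0 matter. *)

Section stochastic.
Context {R : realType} {d : measure_display} {Omega : measurableType d}.
Variable P : probability Omega R.
Implicit Types (F : R -> set (set Omega)) (T : R).

Definition filtration F : Prop :=
  (forall t, 0 <= t -> sigma_algebra setT (F t) /\ F t `<=` measurable) /\
  (forall s t : R, 0 <= s <= t -> F s `<=` F t).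

Definition adapted F T (Z : R -> Omega -> R) : Prop :=
  forall t : R, 0 <= t <= T ->
  forall B : set (measurableTypeR R), measurable B -> F t (Z t @^-1` B).

Definition progressive F T (Z : R -> Omega -> R) : Prop :=
  forall t : R, 0 <= t <= T ->
  forall B : set (measurableTypeR R), measurable B ->
    <<s [set A `*` E | A in (@measurable _ (measurableTypeR R)) & E in F t] >>
      [set u : R * Omega | 0 <= u.1 <= t /\ B (Z u.1 u.2)].

Definition continuous_paths T (Z : R -> Omega -> R) : Prop :=
  forall w, {within `[0, T], continuous (fun t => Z t w)}.

(* (W j)_j is a family of independent standard F-Brownian motions: the last
   clause says that the increments over [s, t] are independent N(0, t - s)
   variables, jointly independent of F s. *)
Definition brownian F (J : eqType) (W : J -> R -> Omega -> R) : Prop :=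
  [/\ forall j, {ae P, forall w, W j 0 w = 0},
      forall j w, {within `[0, +oo[, continuous (fun t => W j t w)},
      forall j T, adapted F T (W j) &
      forall s t : R, 0 <= s -> s < t ->
      forall (A : set Omega) (J0 : seq J) (B : J -> set (measurableTypeR R)),
        F s A -> uniq J0 -> (forall j, measurable (B j)) ->
        P (A `&` \bigcap_(j in [set` J0]) [set w | B j (W j t w - W j s w)])
        = (P A * (\prod_(j <- J0) fine (normal_prob 0 (Num.sqrt (t - s)) (B j)))%:E)%E].

(* The filtration generated by W, augmented by the P-null sets. *)
Definition augmented_filtration (J : eqType) (W : J -> R -> Omega -> R)
    (t : R) : set (set Omega) :=
  <<s [set A | (exists j s (B : set (measurableTypeR R)),
                  [/\ 0 <= s <= t, measurable B & A = W j s @^-1` B]) \/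
               (measurable A /\ P A = 0%E)] >>.

Record simple_process := SimpleProcess {
  sp_size : nat;
  sp_time : nat -> R;
  sp_val : nat -> Omega -> R }.

Definition simple_ok F (S : simple_process) : Prop :=
  [/\ 0 <= sp_time S 0,
      forall k, sp_time S k <= sp_time S k.+1,
      forall k (B : set (measurableTypeR R)), measurable B ->
        F (sp_time S k) (sp_val S k @^-1` B) &
      exists C : R, forall k w, `|sp_val S k w| <= C].

Definition simple_eval (S : simple_process) (t : R) (w : Omega) : R :=
  \sum_(k < sp_size S) sp_val S k w * ((sp_time S k < t <= sp_time S k.+1)%R)%:R.

Definition simple_integral (S : simple_process) (W : R -> Omega -> R)
    (t : R) (w : Omega) : R :=
  \sum_(k < sp_size S) sp_val S k w *
    (W (Num.min t (sp_time S k.+1)) w - W (Num.min t (sp_time S k)) w).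

(* M is (a continuous version of) the Ito integral of H against W on [0, T]:
   the limit, uniform in time and in probability, of the elementary integrals
   of simple processes S n with \int_0^T |S n - H|^2 ds -> 0 in probability. *)
Definition ito_integral F T (H W M : R -> Omega -> R) : Prop :=
  [/\ progressive F T H,
      continuous_paths T M,
      forall t : R, 0 <= t <= T -> measurable_fun setT (M t : Omega -> measurableTypeR R) &
  exists S : nat -> simple_process,
  [/\ forall n, simple_ok F (S n),
      forall e : R, 0 < e ->
        P [set w | (e%:E < \int[@lebesgue_measure R]_(s in `[0%R, T])
                             ((simple_eval (S n) s w - H s w) ^+ 2)%:E)%E]
          @[n --> \oo] --> 0%E &
      forall e : R, 0 < e ->
        P [set w | exists2 t : R, 0 <= t <= T &
                     e < `|simple_integral (S n) W t w - M t w|]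
          @[n --> \oo] --> 0%E]].

(* Z_t = z0 + \int_0^t drift ds + \sum_j \int_0^t H j dW j on [0, T]. *)
Definition ito_equation F T (J : finType) (Z : R -> Omega -> R) (z0 : R)
    (drift : R -> Omega -> R) (H W : J -> R -> Omega -> R) : Prop :=
  [/\ adapted F T Z /\ continuous_paths T Z,
      progressive F T drift,
      {ae P, forall w, (@lebesgue_measure R).-integrable `[0, T]
                         (EFin \o drift ^~ w)} &
  exists M : J -> R -> Omega -> R,
    (forall j, ito_integral F T (H j) (W j) (M j)) /\
    {ae P, forall w, forall t : R, 0 <= t <= T ->
       Z t w = z0 + \int[@lebesgue_measure R]_(s in `[0, t]) drift s w
               + \sum_j M j t w}].

Definition slow_fast_equation (q : coeffs R) (T eps etax etay : R) F
    (m : R -> Omega -> P2 R) (W B X Y : R -> Omega -> R) : Prop :=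
  let ev (h : R -> R -> P2 R -> R) t w := h (X t w) (Y t w) (m t w) in
  ito_equation F T X etax
    (fun t w => ev (cb q) t w / eps + ev (cc q) t w)
    (fun _ : unit => ev (csigma q)) (fun _ : unit => W) /\
  ito_equation F T Y etay
    (fun t w => (ev (cf q) t w / eps + ev (cg q) t w) / eps)
    (fun j : bool => fun t w => ev (if j then ctau1 q else ctau2 q) t w / eps)
    (fun j : bool => if j then W else B).

Definition finite_second_moment T (X : R -> Omega -> R) : Prop :=
  forall t : R, 0 <= t <= T -> (\int[P]_w (X t w ^+ 2)%:E < +oo)%E.

Definition mckean_vlasov_solution (q : coeffs R) (T eps etax etay : R) F
    (W B X Y : R -> Omega -> R) : Prop :=
  finite_second_moment T X /\
  slow_fast_equation q T eps etax etay F (fun t _ => law P (X t)) W B X Y.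

Definition interacting_solution (q : coeffs R) (T eps etax etay : R) (N : nat) F
    (W B X Y : 'I_N -> R -> Omega -> R) : Prop :=
  forall i, slow_fast_equation q T eps etax etay F
    (fun t w => empirical (fun j => X j t w)) (W i) (B i) (X i) (Y i).

Definition limit_solution (gbar Dbar : R -> P2 R -> R) (T etax : R) F
    (W X : R -> Omega -> R) : Prop :=
  finite_second_moment T X /\
  ito_equation F T X etax
    (fun t w => gbar (X t w) (law P (X t)))
    (fun (_ : unit) t w => Num.sqrt (2 * Dbar (X t w) (law P (X t))))
    (fun _ : unit => W).

Definition independent_pairs T (X Y : nat -> R -> Omega -> R) : Prop :=
  let events i := <<s [set A | exists t (B : set (measurableTypeR R)),
    [/\ 0 <= t <= T, measurable B & A = X i t @^-1` B \/ A = Y i t @^-1` B]] >> in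
  forall (s : seq nat) (A : nat -> set Omega), uniq s ->
    (forall i, i \in s -> events i (A i)) ->
    P (\bigcap_(i in [set` s]) A i) = (\prod_(i <- s) fine (P (A i)))%:E.

(* Equality of all finite-dimensional distributions on [0, T]. *)
Definition identically_distributed T (X Y : nat -> R -> Omega -> R) : Prop :=
  forall (i j n : nat) (t : nat -> R) (A B : nat -> set (measurableTypeR R)),
    (forall k, 0 <= t k <= T) ->
    (forall k, measurable (A k)) -> (forall k, measurable (B k)) ->
    let ev l := \bigcap_(k in `I_n) [set w | A k (X l (t k) w) /\ B k (Y l (t k) w)] in
    P (ev i) = P (ev j).

End stochastic.

(* Strong existence (a solution adapted to the augmented Brownian filtration)
   and pathwise uniqueness, on every probability space.  J indexes the Brownian
   motions, K the components of the solution. *)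
Definition strongly_well_posed (R : realType) (T : R) (J : eqType) (K : Type)
    (sol : forall (d : measure_display) (Omega : measurableType d),
       probability Omega R -> (R -> set (set Omega)) ->
       (J -> R -> Omega -> R) -> (K -> R -> Omega -> R) -> Prop) : Prop :=
  forall (d : measure_display) (Omega : measurableType d)
    (P : probability Omega R) (F : R -> set (set Omega)) (W : J -> R -> Omega -> R),
  filtration F -> brownian P F W ->
  (exists Z, sol d Omega P (augmented_filtration P W) W Z) /\
  (forall Z Z', sol d Omega P F W Z -> sol d Omega P F W Z' ->
     {ae P, forall w, forall k t, 0 <= t <= T -> Z k t w = Z' k t w}).

(* Components indexed by true are the W's and the slow variables, those indexed
   by false are the B's and the fast variables. *)
Definition systems_well_posed (R : realType) (q : coeffs R)
    (gbar Dbar : R -> P2 R -> R) (T etax etay : R) (eps : nat -> R) : Prop :=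
  [/\ forall N, (0 < N)%N ->
        strongly_well_posed T (J := ('I_N * bool)%type) (K := ('I_N * bool)%type)
          (fun d Omega P F W Z =>
             interacting_solution P q T (eps N) etax etay F
               (fun i => W (i, true)) (fun i => W (i, false))
               (fun i => Z (i, true)) (fun i => Z (i, false))),
      forall N, (0 < N)%N ->
        strongly_well_posed T (J := bool) (K := bool)
          (fun d Omega P F W Z =>
             mckean_vlasov_solution P q T (eps N) etax etay F
               (W true) (W false) (Z true) (Z false)) &
      strongly_well_posed T (J := unit) (K := unit)
        (fun d Omega P F W Z =>
           limit_solution P gbar Dbar T etax F (W tt) (Z tt))].

Definition bounded_lfds (R : realType) (p : R -> R -> P2 R -> R) : Prop :=
  exists (D : R -> R -> P2 R -> R -> R) (D2 : R -> R -> P2 R -> R -> R -> R),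
  (forall x y, is_lfd (p x y) (D x y) /\ is_lfd2 (D x y) (D2 x y)) /\
  exists (C : R) (k : nat), 0 < C /\
    forall y x mu z x' mu' z' zbar',
      `|D x y mu z| + `|D2 x' y mu' z' zbar'| <= C * (1 + `|y| ^+ k).

Definition lipschitz_measure (R : realType) (p : R -> R -> P2 R -> R) : Prop :=
  forall x y, exists L : R, forall mu nu, `|p x y mu - p x y nu| <= L * W2 mu nu.

(* Makes p (X, Y, law) and p (X, Y, empirical) random variables: joint
   measurability in (x, y, mu) follows since p is continuous in mu. *)
Definition measurable_xy (R : realType) (p : R -> R -> P2 R -> R) : Prop :=
  forall mu, measurable_fun setT
    ((fun u : measurableTypeR R * measurableTypeR R => p u.1 u.2 mu)
       : _ -> measurableTypeR R).

(* Main.v *)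
From HB Require Import structures.
Require Import Defs.
From mathcomp Require Import all_boot all_order all_algebra.
From mathcomp Require Import all_classical all_reals all_analysis measurable_realfun.
From mathcomp Require Import ring lra.

(* Fix the N-th system and write mu for the common law of the slow particles.
   Replacing the atoms of the empirical measure one at a time by 1/N of mu turns
   p(empirical) - p(mu) into a sum of increments, each bounded by 2K/N with
   K = C(1 + |Y_i|^k).  Conditionally on the particles already revealed (and on
   Y_i) an increment has mean O(K/N^2): its first-order part is centred because
   the new particle is independent with law mu, and the rest is controlled by
   the second derivative.  Hence the second moment of the sum is at most
   C E[K^2]/N.

   It remains to bound all moments of Y_i uniformly in t and eps.  On a time
   window of length del eps^2 the drift contracts |Y_i| by a fixed factor, up to
   the increments of the stochastic integrals.  The latter have exponential
   moments bounded uniformly in eps: for simple integrands this is the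
   exponential martingale identity, and the bound passes to the limit in
   probability. *)

Set Implicit Arguments.
Unset Strict Implicit.
Unset Printing Implicit Defensive.

Import Order.TTheory GRing.Theory Num.Theory.
Import numFieldNormedType.Exports.

Local Open Scope classical_set_scope.
Local Open Scope ring_scope.

(** * Independence and joint measurability *)

(** Particle [i] is both the point at which [p] is evaluated and an atom of the empirical measure.
    Its atom is therefore replaced last, at the deterministic cost 2K/N, and the other N - 1
    increments are taken conditionally on particle [i] as well. If S is the current difference and h
    the new increment, then |S| <= 2K turns the cross term 2 S E[h | past] into O(K^2/N^2), so the
    second moments simply add up, without a Gronwall argument. The stochastic integrals are given
    only as limits in probability of elementary integrals, so their moments have to come from
    truncation. Exponentials suit this: their mean is exact for simple integrands, and they control
    every power at once. The fast equation is used path by path, the noise being just a continuous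
    function of time, which avoids an Ito formula for powers of Y. The window is dictated by
    scaling. The drift of Y has rate eps^-2 and its integrands have size 1/eps, so over a time del
    eps^2 both the contraction factor and the quadratic variation are independent of eps. *)

Lemma measurable_caratheodory d (U : measurableType d) (R : realType)
    (f : U -> R -> R) :
  (forall z, measurable_fun setT (f ^~ z)) -> (forall u, continuous (f u)) ->
  measurable_fun setT (fun v : U * measurableTypeR R => f v.1 v.2).
Proof.
move=> mf cf.
(* Rounding [z] down to the grid of mesh 1/(n+1) leaves a countable gluing of the sections [f ^~ z],
   which is measurable; continuity in [z] gives pointwise convergence. *)
pose r n (z : R) : R := (Num.floor (z * n.+1%:R))%:~R / n.+1%:R.
have rcvg z : r n z @[n --> \oo] --> z.
  apply/cvgrPdist_le => e e0; near=> n.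
  have n0 : (0 : R) < n.+1%:R by rewrite ltr0n.
  have /andP[h1 h2] := Num.Theory.real_floor_itv (num_real (z * n.+1%:R)).
  rewrite /r ger0_norm; last by rewrite subr_ge0 ler_pdivrMr.
  rewrite lerBlDr -lerBlDl ler_pdivlMr// mulrBl lerBlDr.
  apply: (le_trans (ltW h2)); rewrite intrD lerD2l.
  rewrite -ler_pdivrMl// mulr1.
  have hn : n.+1%:R^-1 < e by near: n; exact: (near_infty_natSinv_lt (PosNum e0)).
  by rewrite -[leRHS]invrK lef_pV2 ?posrE ?invr_gt0// ltW.
have mr n : measurable_fun setT (fun v : U * measurableTypeR R => f v.1 (r n v.2)).
  have mE (k : int) : measurable [set v : U * measurableTypeR R | Num.floor (v.2 * n.+1%:R) = k].
    rewrite [X in measurable X](_ : _ = setT `*`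
      ([set z : R | k%:~R / n.+1%:R <= z] `&` [set z : R | z < (k + 1)%:~R / n.+1%:R])).
      apply: measurableX => //; apply: measurableI.
      - by rewrite -set_itvE//; exact: measurable_itv.
      - by rewrite -set_itvE//; exact: measurable_itv.
    apply/seteqP; split => -[u z]/=.
      move=> <-; split => //.
      have /andP[h1 h2] := Num.Theory.real_floor_itv (num_real (z * n.+1%:R)).
      by rewrite ler_pdivrMr ?ltr0n// ltr_pdivlMr ?ltr0n.
    move=> [_ [h1 h2]]; apply: Num.Theory.floor_def.
    by rewrite -ler_pdivrMr ?ltr0n// h1 -ltr_pdivlMr ?ltr0n// h2.
  move=> _ B mB; rewrite setTI.
  rewrite [X in measurable X](_ : _ = \bigcup_(k : int)
    ([set v : U * measurableTypeR R | Num.floor (v.2 * n.+1%:R) = k] `&`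
      (((fun u => f u (k%:~R / n.+1%:R)) @^-1` B) `*` setT))).
    apply: countable_bigcupT_measurable => // k.
    apply: measurableI; first exact: mE.
    by apply: measurableX => //; rewrite -[X in measurable X]setTI; exact: mf.
  apply/seteqP; split => -[u z]/=.
    by move=> h; exists (Num.floor (z * n.+1%:R)).
  by move=> [k _ [<- [h _]]].
apply: (measurable_fun_cvg mr) => -[u z] _ /=.
exact: (cvg_comp _ _ (rcvg z) (cf u z)).
Unshelve. all: by end_near.
Qed.

Definition image_prob d d' (T : measurableType d) (T' : measurableType d')
    (R : realType) (P : probability T R) (f : T -> T')
    (mf : measurable_fun setT f) : probability T' R :=
  distribution P (mfun_Sub (mem_set mf)).

Lemma image_probE d d' (T : measurableType d) (T' : measurableType d')
    (R : realType) (P : probability T R) (f : T -> T')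
    (mf : measurable_fun setT f) A : image_prob P mf A = P (f @^-1` A).
Proof. by []. Qed.

Lemma ge0_integral_image_prob d d' (T : measurableType d) (T' : measurableType d')
    (R : realType) (P : probability T R) (f : T -> T')
    (mf : measurable_fun setT f) (h : T' -> \bar R) :
  measurable_fun setT h -> (forall u, 0 <= h u)%E ->
  (\int[image_prob P mf]_u h u = \int[P]_w h (f w))%E.
Proof. by move=> mh h0; exact: ge0_integral_distribution. Qed.

Section independence.
Context d (Omega : measurableType d) (R : realType) (P : probability Omega R).
Variables (G : set (set Omega)) (d' : measure_display) (T' : measurableType d').
Variables (V : Omega -> T') (m : probability T' R).
Hypotheses (Gm : G `<=` measurable) (GI : setI_closed G) (GT : G setT).
Hypothesis mV : measurable_fun setT V.
Hypothesis indep : forall A B, G A -> measurable B ->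
  (P (A `&` V @^-1` B) = P A * m B)%E.

(** For fixed [B] both sides are finite measures in [A]. They agree on the pi-system [G], which
    contains [setT], hence on the sigma-algebra that it generates. *)
Lemma independent_generated A B : <<s G >> A -> measurable B ->
  (P (A `&` V @^-1` B) = P A * m B)%E.
Proof.
move=> sA mB; have mVB : measurable (V @^-1` B).
  by rewrite -[X in measurable X]setTI; exact: mV.
have mB0 : 0 <= fine (m B) by rewrite fine_ge0.
suff : mrestr P mVB A = mscale (NngNum mB0) P A.
  by rewrite /mrestr /mscale/= fineK ?fin_num_measure// muleC.
apply: (g_sigma_algebra_measure_unique G Gm (fun=> setT)) => //.
- by rewrite bigcup_const.
- move=> C GC; change (P (C `&` V @^-1` B) = (fine (m B))%:E * P C)%E.
  by rewrite indep// fineK ?fin_num_measure// muleC.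
- move=> _; change (P (setT `&` V @^-1` B) < +oo)%E.
  by rewrite setTI (le_lt_trans (probability_le1 _ _))// ltry.
Qed.

(** This plays the role of conditional expectation given [G]: [V] is integrated out with [w] frozen.
    Independence says that the law of the pair (w, V w) is the product of [m] with [PG], the
    restriction of [P] to the generated sigma-algebra, so Tonelli applies. *)
Lemma independent_tonelli (h : g_sigma_algebraType G * T' -> \bar R) :
  measurable_fun setT h -> (forall u, 0 <= h u)%E ->
  (\int[P]_w h (w, V w) = \int[P]_w \int[m]_z h (w, z))%E.
Proof.
move=> mh h0.
have mi : measurable_fun setT (id : Omega -> g_sigma_algebraType G).
  move=> _ A mA; rewrite setTI preimage_id; move: mA.
  by apply: smallest_sub => //; exact: sigma_algebra_measurable.
pose PG := image_prob P mi.
have mp : measurable_fun setT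
    (fun w => (w, V w) : g_sigma_algebraType G * T').
  exact: measurable_fun_pair.
pose q := image_prob P mp.
transitivity (\int[q]_u h u)%E; first exact/esym/ge0_integral_image_prob.
transitivity (\int[PG \x m]_u h u)%E.
  apply: eq_measure_integral => A mA _; apply/esym.
  apply: product_measure_unique => // B C mB mC.
  change (P ((fun w => (w, V w)) @^-1` (B `*` C)) = P B * m C)%E.
  by rewrite -independent_generated.
rewrite fubini_tonelli1// ge0_integral_image_prob//.
- exact: measurable_fun_fubini_tonelli_F.
- by move=> u; exact: integral_ge0.
Qed.

End independence.

(** * Shifted masses *)

Import HBNNSimple.

(* Valid for arbitrary integrands, since the library defines the integral of a
   nonnegative function as a supremum over the simple functions below it. *)
Lemma ge0_le_integral_any d (T : measurableType d) (R : realType)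
    (mu : {measure set T -> \bar R}) (D : set T) (f g : T -> \bar R) :
  (forall x, D x -> 0 <= f x)%E -> (forall x, D x -> f x <= g x)%E ->
  (\int[mu]_(x in D) f x <= \int[mu]_(x in D) g x)%E.
Proof.
move=> f0 fg; have g0 x : D x -> (0 <= g x)%E.
  by move=> Dx; exact: le_trans (f0 _ Dx) (fg _ Dx).
rewrite !ge0_integralE//; apply: le_ereal_sup => _ [h hf <-].
exists h => // x; apply: (le_trans (hf x)).
by rewrite /patch; case: ifPn => //; rewrite inE => /fg.
Qed.

(** [F] is not assumed measurable, because nothing is known about the dependence on [r] of the
    integrand defining a linear functional derivative. The positive and negative parts are bounded
    separately; the bounds recombine through max(l, 0) - max(-l, 0) = l. *)
Lemma Rintegral_itv01_bounds (R : realType) (F : R -> R) (l u : R) :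
  (forall r, 0 <= r <= 1 -> l <= F r <= u) ->
  l <= \int[@lebesgue_measure R]_(r in `[0, 1]) F r <= u.
Proof.
move=> lFu.
pose mu : {measure set (measurableTypeR R) -> \bar R} := @lebesgue_measure R.
have cst01 (c : R) : (\int[mu]_(r in `[0%R, 1%R]) (cst c%:E) r = c%:E)%E.
  by rewrite integral_cst//= lebesgue_measure_itv/= lte_fin ltr01 oppr0 adde0 mule1.
have bnd (H : R -> R) (a b : R) : (forall r, 0 <= r <= 1 -> 0 <= a <= H r /\ H r <= b) ->
    (a%:E <= \int[mu]_(r in `[0%R, 1%R]) (H r)%:E <= b%:E)%E.
  move=> h; apply/andP; split.
    rewrite -[leLHS]cst01; apply: ge0_le_integral_any => r /=; rewrite in_itv/= => /h[/andP[a0 aH] Hb].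
      by rewrite lee_fin.
    by rewrite lee_fin.
  rewrite -[leRHS]cst01; apply: ge0_le_integral_any => r /=; rewrite in_itv/= => /h[/andP[a0 aH] Hb].
    by rewrite lee_fin (le_trans a0).
  by rewrite lee_fin.
pose Fp r := Num.max (F r) 0; pose Fn r := Num.max (- F r) 0.
have hp : forall r, 0 <= r <= 1 ->
    0 <= Num.max l 0 <= Fp r /\ Fp r <= Num.max u 0.
  by move=> r /lFu/andP[lF Fu]; rewrite le_max lexx orbT/= !le_max2.
have hn : forall r, 0 <= r <= 1 ->
    0 <= Num.max (- u) 0 <= Fn r /\ Fn r <= Num.max (- l) 0.
  by move=> r /lFu/andP[lF Fu]; rewrite le_max lexx orbT/= !le_max2 ?lerN2.
rewrite /Rintegral integralE.
rewrite [X in fine (X - _)](_ : _ = \int[mu]_(r in `[0%R, 1%R]) (Fp r)%:E)%E; last first.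
  by apply: eq_integral => r _; rewrite funeposE/= /Fp EFin_max.
rewrite [X in fine (_ - X)](_ : _ = \int[mu]_(r in `[0%R, 1%R]) (Fn r)%:E)%E; last first.
  by apply: eq_integral => r _; rewrite funenegE/= /Fn EFin_max.
have /andP[] := bnd _ _ _ hp; have /andP[] := bnd _ _ _ hn.
have lu : l <= u.
  by have := lFu 0; rewrite lexx ler01 => /(_ isT)/andP[]; exact: le_trans.
case: (\int[mu]_(x in _) (Fp x)%:E)%E => [a| |]; case: (\int[mu]_(x in _) (Fn x)%:E)%E => [b| |]//=.
rewrite !lee_fin => b1 b2 a1 a2; apply/andP; split; move: b1 b2 a1 a2;
  case: (leP l 0); case: (leP u 0); case: (leP (- u) 0); case: (leP (- l) 0); lra.
Qed.

Lemma bounded_integrable d (T : measurableType d) (R : realType)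
    (m : probability T R) (f : T -> R) (K : R) :
  measurable_fun setT f -> (forall z, `|f z| <= K) ->
  m.-integrable setT (EFin \o f).
Proof.
move=> mf fK; apply: (@le_integrable _ _ _ _ _ _ _ (EFin \o cst K)) => //.
- exact/measurable_EFinP.
- move=> z _ /=; rewrite lee_fin (le_trans (fK z))// ler_norm//.
- exact: finite_measure_integrable_cst.
Qed.

Lemma Rintegral_probability_cst d (T : measurableType d) (R : realType)
    (m : probability T R) (K : R) : \int[m]_z K = K.
Proof.
rewrite Rintegral_cst// -[RHS]mulr1; congr (_ * _).
exact: (congr1 fine (probability_setT m)).
Qed.

Lemma Rintegral_probability_bound d (T : measurableType d) (R : realType)
    (m : probability T R) (f : T -> R) (K : R) :
  measurable_fun setT f -> (forall z, `|f z| <= K) ->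
  `|\int[m]_z f z| <= K.
Proof.
move=> mf fK; have If := bounded_integrable m mf fK.
apply: (le_trans (le_normr_Rintegral _ If)) => //.
apply: (@le_trans _ _ (\int[m]_z K)).
  apply: le_Rintegral => //; last exact: finite_measure_integrable_cst.
  exact: integrable_norm.
by rewrite Rintegral_probability_cst.
Qed.

Section shifted_mass.
Context (R : realType).
Implicit Types (f : measurableTypeR R -> R) (nu rho : probability (measurableTypeR R) R).

(** The signed identity nu2 - nu1 = a (rho2 - rho1), rearranged into sums so that it compares honest
    measures. In the replacement argument [a] is 1/N, [rho1] is [mu] and [rho2] is a Dirac mass. *)
Definition shifted_mass nu1 nu2 rho1 rho2 (a : R) : Prop :=
  forall A, measurable A -> (nu2 A + a%:E * rho1 A = nu1 A + a%:E * rho2 A)%E.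

Lemma integral_shifted_mass nu1 nu2 rho1 rho2 (a : R) f (K : R) :
  0 <= a -> shifted_mass nu1 nu2 rho1 rho2 a ->
  measurable_fun setT f -> (forall z, `|f z| <= K) ->
  \int[nu2]_z f z - \int[nu1]_z f z
    = a * (\int[rho2]_z f z - \int[rho1]_z f z).
Proof.
move=> a0 h mf fK.
(* Shifting by [K] makes the integrand nonnegative, so that its integral is additive in the measure;
   the constant cancels since all four measures are probabilities. *)
pose g z := f z + K.
have mg : measurable_fun setT (EFin \o g).
  by apply/measurable_EFinP/measurable_funD.
have g0 z : (0 <= (g z)%:E)%E.
  by rewrite lee_fin /g -lerBlDr sub0r; have := fK z; rewrite ler_norml => /andP[].
have gE nu : \int[nu]_z g z = \int[nu]_z f z + K.
  rewrite RintegralD//.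
  - by rewrite Rintegral_probability_cst.
  - exact: bounded_integrable fK.
  - exact: finite_measure_integrable_cst.
have gfin nu : (\int[nu]_z (g z)%:E)%E = (\int[nu]_z g z)%:E.
  rewrite /Rintegral fineK//; apply: integrable_fin_num => //.
  apply: (@bounded_integrable _ _ _ _ g (K + K)) => [|z].
    exact/measurable_EFinP.
  by rewrite /g (le_trans (ler_normD _ _))// lerD// ger0_norm// (le_trans _ (fK 0)).
pose a' := NngNum a0.
have addE (m1 m2 : probability (measurableTypeR R) R) :
    (\int[measure_add m1 (mscale a' m2)]_z (g z)%:E
     = (\int[m1]_z g z + a * \int[m2]_z g z)%:E)%E.
  by rewrite ge0_integral_measure_add// ge0_integral_mscale//= !gfin.
have : (\int[measure_add nu2 (mscale a' rho1)]_z (g z)%:E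
     = \int[measure_add nu1 (mscale a' rho2)]_z (g z)%:E)%E.
  apply: eq_measure_integral => A mA _.
  apply: (etrans (measure_addE nu2 (mscale a' rho1) A)).
  by apply: (etrans (h A mA)); apply/esym/(measure_addE nu1 (mscale a' rho2) A).
rewrite !addE => -[]; rewrite !gE; lra.
Qed.

Lemma shifted_mass_id nu1 nu2 : shifted_mass nu1 nu2 nu1 nu2 1.
Proof. by move=> A mA; rewrite !mul1e addeC. Qed.

End shifted_mass.

(** * Wasserstein couplings and resampled measures *)

Section probability_of_measure.
Context d (T : measurableType d) (R : realType).
Variables (m : {measure set T -> \bar R}) (m1 : m setT = 1%E).

Definition probability_of_measure of m setT = 1%E : set T -> \bar R := m.

HB.instance Definition _ := Measure.on (probability_of_measure m1).
HB.instance Definition _ :=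
  Measure_isProbability.Build _ _ _ (probability_of_measure m1) m1.

End probability_of_measure.

Section P2_theory.
Context (R : realType).
Implicit Types (nu mu : P2 R).

Lemma P2_of_measure (m : {measure set (measurableTypeR R) -> \bar R}) :
  m setT = 1%E -> (\int[m]_x (x ^+ 2)%:E < +oo)%E ->
  exists nu : P2 R, forall A, measurable A -> nu A = m A.
Proof.
move=> m1 m2.
by exists (@MkP2 R (probability_of_measure m1) m2).
Qed.

Lemma toP2E (m : set (measurableTypeR R) -> \bar R) :
  (exists nu : P2 R, forall A, measurable A -> nu A = m A) ->
  forall A, measurable A -> toP2 m A = m A.
Proof. by move=> [nu nuE] A mA; rewrite /toP2; case: xgetP => [? _ ->|/(_ nu)]. Qed.

Lemma eq_toP2 (m m' : set (measurableTypeR R) -> \bar R) :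
  (forall A, measurable A -> m A = m' A) -> toP2 m = toP2 m'.
Proof.
move=> mm'; congr xget; apply/seteqP; split=> nu /= h A mA.
  by rewrite h// mm'.
by rewrite h// mm'.
Qed.

Lemma mixtureE (r : R) nu1 nu2 : 0 <= r <= 1 ->
  forall A, measurable A ->
  mixture r nu1 nu2 A = ((1 - r)%:E * nu1 A + r%:E * nu2 A)%E.
Proof.
move=> /andP[r0 r1]; apply: toP2E.
have r1' : 0 <= 1 - r by rewrite subr_ge0.
pose m := measure_add (mscale (NngNum r1') nu1) (mscale (NngNum r0) nu2).
have mE A : m A = ((1 - r)%:E * nu1 A + r%:E * nu2 A)%E by exact: measure_addE.
have [||nu nuE] := @P2_of_measure m.
- apply: (etrans (mE setT)).
  by rewrite !probability_setT !mule1 -EFinD subrK.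
- rewrite ge0_integral_measure_add//=; last 2 first.
    by move=> x _; rewrite lee_fin sqr_ge0.
    by apply/measurable_EFinP; exact: measurable_funX.
  have mx2 : measurable_fun [set: measurableTypeR R] (fun x : R => (x ^+ 2)%:E).
    by apply/measurable_EFinP; exact: measurable_funX.
  rewrite !ge0_integral_mscale//=; try by move=> x _; rewrite lee_fin sqr_ge0.
  by apply: lte_add_pinfty; apply: lte_mul_pinfty => //; exact: p2_moment.
- by exists nu => A mA; rewrite (nuE _ mA); exact: mE.
Qed.

Lemma mixture_shifted_mass (r a : R) nu1 nu2
    (rho1 rho2 : probability (measurableTypeR R) R) : 0 <= r <= 1 -> 0 <= a ->
  shifted_mass nu1 nu2 rho1 rho2 a ->
  shifted_mass nu1 (mixture r nu1 nu2) rho1 rho2 (r * a).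
Proof.
move=> r01 a0 h A mA; rewrite mixtureE//; have := h _ mA.
have [x1 ->] : exists x, nu1 A = x%:E by exists (fine (nu1 A)); rewrite fineK// fin_num_measure.
have [x2 ->] : exists x, nu2 A = x%:E by exists (fine (nu2 A)); rewrite fineK// fin_num_measure.
have [y1 ->] : exists x, rho1 A = x%:E by exists (fine (rho1 A)); rewrite fineK// fin_num_measure.
have [y2 ->] : exists x, rho2 A = x%:E by exists (fine (rho2 A)); rewrite fineK// fin_num_measure.
by move=> -[e]; rewrite -!EFinM -!EFinD; congr EFin; nra.
Qed.

Lemma W2_le_coupling mu nu (q : probability (measurableTypeR R * measurableTypeR R)%type R) (c : R) :
  coupling mu nu q -> 0 <= c ->
  (\int[q]_u ((u.1 - u.2) ^+ 2)%:E <= (c ^+ 2)%:E)%E -> W2 mu nu <= c.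
Proof.
move=> cq c0 qc; rewrite /W2 -(ger0_norm c0) -sqrtr_sqr ler_wsqrtr//.
set I := ereal_inf _.
have I0 : (0 <= I)%E.
  apply: le_ereal_inf_tmp => _ [q' _ <-]; apply: integral_ge0 => u _.
  by rewrite lee_fin sqr_ge0.
have Ic : (I <= (c ^+ 2)%:E)%E.
  by apply: (le_trans _ qc); apply: ereal_inf_lbound; exists q.
have : (c ^+ 2 = fine (c ^+ 2)%:E) by [].
move=> ->; apply: fine_le => //.
by rewrite ge0_fin_numE// (le_lt_trans Ic)// ltry.
Qed.

End P2_theory.

Section partial_mean.
Context d (T : measurableType d) (R : realType).
Variables (N : nat) (mu : probability T R).
Implicit Types (s : seq T).

Let natV_ge0 (n : nat) : (0 : R) <= n%:R / N%:R.
Proof. by rewrite divr_ge0. Qed.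

Definition atoms s (m0 : {measure set T -> \bar R}) : {measure set T -> \bar R} :=
  foldr (fun z (m : {measure set T -> \bar R}) =>
    measure_add (mscale (NngNum (natV_ge0 1)) (@dirac _ T z R)) m
      : {measure set T -> \bar R}) m0 s.

(** The space is left arbitrary because the Wasserstein coupling of two such measures is the same
    construction on pairs. *)
Definition partial_mean s : {measure set T -> \bar R} :=
  atoms s (mscale (NngNum (natV_ge0 (N - size s))) mu).

Lemma atomsE s m0 A : (atoms s m0 A =
  (N%:R^-1)%:E * (\sum_(z <- s) @dirac _ T z R A) + m0 A)%E.
Proof.
elim: s => [|z s IH]; first by rewrite big_nil mule0 add0e.
apply: (etrans (measure_addE _ (atoms s m0) A)).
rewrite IH big_cons ge0_muleDr//; last by apply: sume_ge0 => i _; rewrite lee_fin.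
rewrite addeA; congr (_ * _ + _ + _)%E; by rewrite /= mul1r.
Qed.

Lemma integral_atoms s m0 (f : T -> \bar R) :
  measurable_fun setT f -> (forall z, 0 <= f z)%E ->
  (\int[atoms s m0]_z f z
    = (N%:R^-1)%:E * (\sum_(z <- s) f z) + \int[m0]_z f z)%E.
Proof.
move=> mf f0; elim: s => [|z s IH]; first by rewrite big_nil mule0 add0e.
rewrite /= ge0_integral_measure_add// IH.
rewrite ge0_integral_mscale//= integral_dirac// diracT mul1e mul1r.
by rewrite big_cons ge0_muleDr ?addeA//; exact: sume_ge0.
Qed.

Lemma partial_meanE s A : (partial_mean s A =
  (N%:R^-1)%:E * (\sum_(z <- s) @dirac _ T z R A)
    + ((N - size s)%:R / N%:R)%:E * mu A)%E.
Proof. exact: atomsE. Qed.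

Lemma integral_partial_mean s (f : T -> \bar R) :
  measurable_fun setT f -> (forall z, 0 <= f z)%E ->
  (\int[partial_mean s]_z f z = (N%:R^-1)%:E * (\sum_(z <- s) f z)
    + ((N - size s)%:R / N%:R)%:E * \int[mu]_z f z)%E.
Proof. by move=> mf f0; rewrite integral_atoms// ge0_integral_mscale. Qed.

Lemma partial_mean_setT s : (0 < N)%N -> (size s <= N)%N ->
  partial_mean s setT = 1%E.
Proof.
move=> N0 sN; rewrite partial_meanE probability_setT mule1.
rewrite (eq_bigr (fun=> 1%:E)); last by move=> z _; rewrite diracT.
rewrite sumEFin big_const_seq count_predT iter_addr_0 -EFinM -EFinD mulrC -mulrDl.
by rewrite -natrD subnKC// divff// pnatr_eq0 -lt0n.
Qed.

End partial_mean.

Section resampling.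
Context (R : realType) (N : nat) (mu : P2 R).
Hypothesis N_gt0 : (0 < N)%N.
Implicit Types (s : seq R).

Let T := measurableTypeR R.

(* The empirical measure of [s] completed by [N - size s] copies of [mu]/[N]. *)
Definition resampled s : P2 R :=
  toP2 (partial_mean (T := measurableTypeR R) N mu s).

Let mx2 : measurable_fun [set: measurableTypeR R] (fun x : R => (x ^+ 2)%:E).
Proof. by apply/measurable_EFinP; exact: measurable_funX. Qed.

Lemma resampledE s A : (size s <= N)%N -> measurable A ->
  (resampled s A = (N%:R^-1)%:E * (\sum_(z <- s) @dirac _ (measurableTypeR R) z R A)
    + ((N - size s)%:R / N%:R)%:E * mu A)%E.
Proof.
move=> sN mA; rewrite -(partial_meanE (T := measurableTypeR R)).
apply: toP2E => //; apply: P2_of_measure.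
  exact: partial_mean_setT.
rewrite integral_partial_mean//; last by move=> z; rewrite lee_fin sqr_ge0.
rewrite sumEFin -EFinM; apply: lte_add_pinfty; first exact: ltry.
by apply: lte_mul_pinfty => //; exact: p2_moment.
Qed.

Lemma resampled_nil A : measurable A -> resampled [::] A = mu A.
Proof.
by move=> mA; rewrite resampledE// big_nil mule0 add0e subn0 divff ?mul1e// pnatr_eq0 -lt0n.
Qed.

Lemma resampled_rcons s z : (size s < N)%N ->
  shifted_mass (resampled s) (resampled (rcons s z)) mu
    (@dirac _ (measurableTypeR R) z R) N%:R^-1.
Proof.
move=> sN A mA; have sN' := ltnW sN; rewrite !resampledE ?size_rcons//.
rewrite big_rcons/=.
have [x ->] : exists x, mu A = x%:E.
  by exists (fine (mu A)); rewrite fineK// fin_num_measure.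
under eq_bigr do rewrite diracE.
rewrite sumEFin diracE -EFinD -!EFinM -!EFinD; congr EFin.
have -> : (N - size s)%N = (N - (size s).+1).+1 by rewrite subnSK.
by rewrite -natr1; ring.
Qed.

(** The coupling keeps all common atoms and the remaining mass of [mu] on the diagonal and sends [z]
    to [z']. Its cost is |z - z'|^2 / N; the gain 1/N is dropped, since only continuity in a single
    atom is wanted. *)
Lemma W2_resampled s1 s2 z z' : (size s1 + size s2 < N)%N ->
  W2 (resampled (s1 ++ z :: s2)) (resampled (s1 ++ z' :: s2)) <= `|z - z'|.
Proof.
move=> sN.
have mdiag : measurable_fun setT (fun x : T => (x, x)) by exact: measurable_fun_pair.
pose muD := image_prob mu mdiag.
pose s := map (fun x => (x, x)) s1 ++ (z, z') :: map (fun x => (x, x)) s2.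
have sizes : size s = (size s1 + (size s2).+1)%N by rewrite size_cat/= !size_map.
have q1 : partial_mean (T := (T * T)%type) N muD s setT = 1%E.
  by apply: partial_mean_setT => //; rewrite sizes addnS.
have s1E : map fst s = s1 ++ z :: s2.
  by rewrite map_cat/= -!map_comp !map_id.
have s2E : map snd s = s1 ++ z' :: s2.
  by rewrite map_cat/= -!map_comp !map_id.
apply: (@W2_le_coupling _ _ _ (probability_of_measure q1)) => //.
  move=> A mA; split.
    rewrite [LHS]partial_meanE resampledE//; last first.
      by rewrite size_cat/= addnS.
    rewrite -s1E big_map size_map; congr (_ * _ + _ * _)%E.
      apply: eq_bigr => i _; rewrite !diracE; congr ((nat_of_bool _)%:R%:E).
      by apply/idP/idP; rewrite !inE => //= -[].
    by rewrite /muD image_probE; congr (mu _); apply/seteqP; split=> x //= -[].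
  rewrite [LHS]partial_meanE resampledE//; last first.
    by rewrite size_cat/= addnS.
  rewrite -s2E big_map size_map; congr (_ * _ + _ * _)%E.
    apply: eq_bigr => i _; rewrite !diracE; congr ((nat_of_bool _)%:R%:E).
    by apply/idP/idP; rewrite !inE => //= -[].
  by rewrite /muD image_probE; congr (mu _); apply/seteqP; split=> x //= -[].
have mf : measurable_fun [set: (T * T)%type] (fun u : (T * T)%type => ((u.1 - u.2) ^+ 2)%:E).
  apply/measurable_EFinP; apply: measurable_funX.
  by apply: measurable_funB; [exact: measurable_fst|exact: measurable_snd].
have f0 (u : (T * T)%type) : (0 <= ((u.1 - u.2) ^+ 2)%:E)%E by rewrite lee_fin sqr_ge0.
rewrite [leLHS](integral_partial_mean _ _ _ mf f0).
rewrite ge0_integral_image_prob//=.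
under eq_integral do rewrite subrr expr0n/=.
rewrite integral0 mule0 adde0 big_cat/= big_cons !big_map.
rewrite !big1; try by move=> ? _; rewrite subrr expr0n.
rewrite add0e adde0 real_normK ?num_real// -EFinM lee_fin.
rewrite ler_piMl ?sqr_ge0// invf_le1 ?ler1n// ltr0n//.
Qed.

End resampling.

(** * Linear functional derivatives *)

Lemma W2_refl (R : realType) (mu : P2 R) : W2 mu mu = 0.
Proof.
have mdiag : measurable_fun setT
    (fun x : measurableTypeR R => (x, x)) by exact: measurable_fun_pair.
apply/eqP; rewrite eq_le {2}/W2 sqrtr_ge0 andbT.
apply: (@W2_le_coupling _ _ _ (image_prob mu mdiag)) => //.
  move=> A mA; split.
    change (mu ((fun x => (x, x)) @^-1` (A `*` setT)) = mu A).
    by congr (mu _); apply/seteqP; split=> x //= -[].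
  change (mu ((fun x => (x, x)) @^-1` (setT `*` A)) = mu A).
  by congr (mu _); apply/seteqP; split=> x //= -[].
rewrite ge0_integral_image_prob/=; last 2 first.
- apply/measurable_EFinP; apply: measurable_funX.
  by apply: measurable_funB; [exact: measurable_fst|exact: measurable_snd].
- by move=> u; rewrite lee_fin sqr_ge0.
under eq_integral do rewrite subrr expr0n/=.
by rewrite integral0 expr0n.
Qed.

Lemma jcont_measurable (R : realType) (D : P2 R -> R -> R) (mu : P2 R) :
  jcont (fun z mu => D mu z) ->
  measurable_fun setT (D mu : measurableTypeR R -> measurableTypeR R).
Proof.
move=> jD; apply: continuous_measurable_fun => z.
apply/cvgrPdist_lt => e e0; have [d d0 h] := jD z mu e e0.
by exists d => // v zv; rewrite distrC; apply: h => //; rewrite W2_refl.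
Qed.

Section linear_functional_derivative.
Context (R : realType).
Implicit Types (G : P2 R -> R) (D : P2 R -> R -> R) (K a : R).
Implicit Types (nu : P2 R) (rho : probability (measurableTypeR R) R).

Lemma lfd_increment G D a (l u : R) nu1 nu2 :
  is_lfd G D ->
  (forall r, 0 <= r <= 1 -> l <= \int[nu2]_z D (mixture r nu1 nu2) z
    - \int[nu1]_z D (mixture r nu1 nu2) z <= u) ->
  l <= G nu2 - G nu1 <= u.
Proof. by move=> [_ _ ->] h; exact: Rintegral_itv01_bounds. Qed.

Lemma lfd_shifted_mass G D K a nu1 nu2 rho1 rho2 :
  is_lfd G D -> (forall m z, `|D m z| <= K) -> 0 <= a ->
  shifted_mass nu1 nu2 rho1 rho2 a -> `|G nu2 - G nu1| <= 2 * a * K.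
Proof.
move=> GD DK a0 h; rewrite ler_norml.
apply: (lfd_increment _ GD) => // r r01.
have mD : measurable_fun setT (D (mixture r nu1 nu2) : measurableTypeR R -> _).
  by apply: jcont_measurable; case: GD.
rewrite (integral_shifted_mass a0 h mD (DK _)).
have := Rintegral_probability_bound rho1 mD (DK _).
have := Rintegral_probability_bound rho2 mD (DK _).
rewrite !ler_norml => /andP[h1 h2] /andP[h3 h4].
by apply/andP; split; nra.
Qed.

(** The increment bound with [a] = 0. It is needed because elements of [P2] with the same values on
    Borel sets need not be equal. *)
Lemma lfd_ext G D K nu1 nu2 :
  is_lfd G D -> (forall m z, `|D m z| <= K) ->
  (forall A, measurable A -> nu1 A = nu2 A) -> G nu1 = G nu2.
Proof.
move=> GD DK nu12; apply/eqP; rewrite -subr_eq0 -normr_le0.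
rewrite (le_trans (@lfd_shifted_mass G D K 0 _ _ nu1 nu1 GD DK _ _))//.
  by move=> A mA; rewrite nu12.
by rewrite mulr0 mul0r.
Qed.

(** A first-order Taylor formula. Along the segment [D] moves by at most 2aK, by the increment bound
    applied to [D ^~ z]; integrating this error against a (rho2 - rho1) costs another factor 2a. *)
Lemma lfd_first_order G D (D2 : P2 R -> R -> R -> R) K a nu1 nu2 rho1 rho2 :
  is_lfd G D -> (forall m z, `|D m z| <= K) ->
  (forall z, is_lfd (D ^~ z) (D2 ^~ z)) ->
  (forall m z z', `|D2 m z z'| <= K) -> 0 <= a ->
  shifted_mass nu1 nu2 rho1 rho2 a ->
  `|G nu2 - G nu1 - a * (\int[rho2]_z D nu1 z - \int[rho1]_z D nu1 z)|
    <= 4 * a ^+ 2 * K.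
Proof.
move=> GD DK DD2 D2K a0 h.
have mD m : measurable_fun setT (D m : measurableTypeR R -> _).
  by apply: jcont_measurable; case: GD.
rewrite ler_norml lerBlDl lerBrDl.
apply: (lfd_increment _ GD) => // r /andP[r0 r1].
have r01 : 0 <= r <= 1 by apply/andP.
rewrite (integral_shifted_mass a0 h (mD _) (DK _)).
have K0 : 0 <= K := le_trans (normr_ge0 _) (DK nu1 0).
have DB z : `|D (mixture r nu1 nu2) z - D nu1 z| <= 2 * a * K.
  have := lfd_shifted_mass (DD2 z) (fun m => D2K m z)
    (mulr_ge0 r0 a0) (mixture_shifted_mass r01 a0 h).
  by move/le_trans; apply; have := mulr_ge0 a0 K0; nra.
have intB rho : `|\int[rho]_z D (mixture r nu1 nu2) z - \int[rho]_z D nu1 z|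
    <= 2 * a * K.
  have ID m : rho.-integrable setT (EFin \o D m).
    exact: bounded_integrable (mD m) (DK m).
  rewrite -RintegralB//.
  apply: Rintegral_probability_bound => //.
  exact: measurable_funB.
have := intB rho1; have := intB rho2.
rewrite !ler_norml => /andP[h1 h2] /andP[h3 h4].
by apply/andP; split; nra.
Qed.

Section lindeberg_step.
Context (G : P2 R -> R) (D : P2 R -> R -> R) (D2 : P2 R -> R -> R -> R) (K : R).
Hypotheses (GD : is_lfd G D) (DK : forall m z, `|D m z| <= K).
Hypotheses (DD2 : forall z, is_lfd (D ^~ z) (D2 ^~ z))
  (D2K : forall m z z', `|D2 m z z'| <= K).
Context (N : nat) (mu : P2 R).
Hypothesis N_gt0 : (0 < N)%N.

(* The conditional mean of each increment is of order 1/N^2, as its first-order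
   part integrates to zero against [mu]. *)
Lemma lindeberg_step (s : seq R) : (size s < N)%N ->
  (\int[mu]_z ((G (resampled N mu (rcons s z)) - G mu) ^+ 2)%:E
    <= ((G (resampled N mu s) - G mu) ^+ 2 + 20 * K ^+ 2 / N%:R ^+ 2)%:E)%E.
Proof.
move=> sN; set S := G (resampled N mu s) - G mu.
have K0 : 0 <= K := le_trans (normr_ge0 _) (DK mu 0).
have N0 : 0 <= (N%:R^-1 : R) by rewrite invr_ge0.
have mD m : measurable_fun setT (D m : measurableTypeR R -> _).
  by apply: jcont_measurable; case: GD.
pose nu := resampled N mu s.
pose c := \int[mu]_z D nu z.
(* [U] majorizes the integrand, is affine in [D nu z], and has [mu]-mean equal to the right-hand
   side. The constant is 20 = 16 + 4: the second-order error contributes 2 |S| 4K/N^2 <= 16 K^2/N^2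
   and the squared increment (2K/N)^2. *)
pose U z := (S ^+ 2 + 20 * K ^+ 2 / N%:R ^+ 2 - 2 * S / N%:R * c) + 2 * S / N%:R * D nu z.
have SK : `|S| <= 2 * K.
  by have := lfd_shifted_mass GD DK ler01 (@shifted_mass_id _ mu nu); rewrite mulr1.
have UK z : `|U z| <= `|S ^+ 2 + 20 * K ^+ 2 / N%:R ^+ 2 - 2 * S / N%:R * c| + `|2 * S / N%:R| * K.
  by rewrite (le_trans (ler_normD _ _))// lerD2l normrM ler_wpM2l.
have mU : measurable_fun setT (U : measurableTypeR R -> measurableTypeR R).
  by apply: measurable_funD => //; exact: measurable_funM.
apply: (@le_trans _ _ (\int[mu]_z (U z)%:E)%E).
  apply: ge0_le_integral_any => z _; first by rewrite lee_fin sqr_ge0.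
  rewrite lee_fin.
  set h := G (resampled N mu (rcons s z)) - G nu.
  have -> : G (resampled N mu (rcons s z)) - G mu = S + h by rewrite /S /h; lra.
  have sh := resampled_rcons mu N_gt0 z sN.
  have hK : `|h| <= 2 * N%:R^-1 * K by exact: lfd_shifted_mass GD DK N0 sh.
  have := lfd_first_order GD DK DD2 D2K N0 sh.
  have dE : \int[@dirac _ (measurableTypeR R) z R]_x D nu x = D nu z.
    rewrite /Rintegral integral_dirac ?diracT ?mul1e//.
    by apply/measurable_EFinP; exact: mD.
  rewrite -/nu -/h -/c dE => hE.
  rewrite /U; set b := N%:R^-1 in N0 hK hE *.
  rewrite -exprVn -/b.
  move: hK hE SK; rewrite !ler_norml => /andP[h1 h2] /andP[h3 h4] /andP[h5 h6].
  have e1 : S * (h - b * (D nu z - c)) <= 2 * K * (4 * b ^+ 2 * K) by nra.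
  have e2 : h ^+ 2 <= (2 * b * K) ^+ 2 by nra.
  nra.
have IU : mu.-integrable setT (EFin \o U) := bounded_integrable _ mU UK.
rewrite -(fineK (integrable_fin_num _ IU))// -/(Rintegral mu setT U) lee_fin.
rewrite /U RintegralD//.
- rewrite Rintegral_probability_cst RintegralZl// -/c; last exact: bounded_integrable.
  lra.
- exact: finite_measure_integrable_cst.
- apply: (@bounded_integrable _ _ _ _ _ (`|2 * S / N%:R| * K)) => [|z].
    exact: measurable_funM.
  by rewrite normrM ler_wpM2l.
Qed.

End lindeberg_step.
End linear_functional_derivative.

(** * Lindeberg replacement *)

Section resampled_measurable.
Context (R : realType) (p : R -> R -> P2 R -> R).
Hypotheses (p_measurable : measurable_xy p) (p_lipschitz : lipschitz_measure p).
Context (N : nat) (mu : P2 R).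
Hypothesis N_gt0 : (0 < N)%N.

Lemma resampled_continuous x y (s1 s2 : seq R) : (size s1 + size s2 < N)%N ->
  continuous (fun z => p x y (resampled N mu (s1 ++ z :: s2))).
Proof.
move=> sN z; have [L hL] := p_lipschitz x y.
apply/cvgrPdist_lt => e e0; near=> z'.
apply: (le_lt_trans (hL _ _)).
(* The Lipschitz constant [L] carries no sign, and the division below needs a positive factor. *)
apply: (@le_lt_trans _ _ ((`|L| + 1) * `|z - z'|)).
  apply: (@le_trans _ _ ((`|L| + 1) * W2 (resampled N mu (s1 ++ z :: s2))
      (resampled N mu (s1 ++ z' :: s2)))).
    by rewrite ler_wpM2r ?sqrtr_ge0// (le_trans (ler_norm L))// lerDl.
  by rewrite ler_wpM2l ?addr_ge0//; exact: W2_resampled.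
rewrite -ltr_pdivlMl ?ltr_wpDl//.
near: z'; apply: cvgr_dist_lt => //.
  by rewrite mulr_gt0// invr_gt0 ltr_wpDl.
Unshelve. all: by end_near.
Qed.

(** Atoms become random one at a time, [cs] holding those still frozen. With one more atom [z]
    released, the expression is measurable in [u] by induction and continuous in [z], hence jointly
    measurable by the Caratheodory argument. *)
Lemma measurable_resampled d (U : measurableType d)
    (x y : U -> measurableTypeR R) (Z : nat -> U -> measurableTypeR R)
    (s : seq nat) (cs : seq R) :
  measurable_fun setT x -> measurable_fun setT y ->
  (forall i, i \in s -> measurable_fun setT (Z i)) ->
  (size s + size cs <= N)%N ->
  measurable_fun setT (fun u => p (x u) (y u)
    (resampled N mu (map (Z ^~ u) s ++ cs)) : measurableTypeR R).
Proof.
move=> mx my; elim/last_ind: s cs => [|s i IH] cs mZ sN.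
  have := measurableT_comp (p_measurable (resampled N mu cs))
    (measurable_fun_pair mx my).
  by [].
have mf := @measurable_caratheodory _ U R (fun u z => p (x u) (y u)
    (resampled N mu (map (Z ^~ u) s ++ z :: cs))) _ _.
have mZi : measurable_fun setT (Z i) by apply: mZ; rewrite mem_rcons inE eqxx.
have := measurableT_comp (mf _ _) (measurable_fun_pair (@measurable_id _ U setT) mZi).
rewrite (_ : _ \o _ = (fun u => p (x u) (y u)
    (resampled N mu (map (Z ^~ u) (rcons s i) ++ cs)))); last first.
  by apply/funext => u /=; rewrite map_rcons cat_rcons.
move: sN; rewrite size_rcons addSnnS => sN.
apply.
  move=> z; apply: IH => // j js; apply: mZ.
  by rewrite mem_rcons inE js orbT.
move=> u; apply: resampled_continuous; rewrite size_map.
by rewrite -addnS.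
Qed.

End resampled_measurable.

Section lindeberg.
Context (R : realType) (p : R -> R -> P2 R -> R).
Hypotheses (p_measurable : measurable_xy p) (p_lipschitz : lipschitz_measure p).
Context (D : R -> R -> P2 R -> R -> R) (D2 : R -> R -> P2 R -> R -> R -> R).
Context (K : R -> R).
Hypotheses (pD : forall x y, is_lfd (p x y) (D x y) /\ is_lfd2 (D x y) (D2 x y))
  (DK : forall x y m z, `|D x y m z| <= K y)
  (D2K : forall x y m z z', `|D2 x y m z z'| <= K y)
  (mK : measurable_fun setT (K : measurableTypeR R -> measurableTypeR R)).
Context d (Omega : measurableType d) (P : probability Omega R).
Context (N : nat) (mu : P2 R).
Hypothesis N_gt0 : (0 < N)%N.

Let Psi x y s := p x y (resampled N mu s) - p x y mu.

(** [G] stands for the information already revealed. Since [Z j] is independent of it with law [mu],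
    the new atom is integrated out with [w] frozen, and [lindeberg_step] applies for each [w] to the
    functional [p (x w) (y w)]. *)
Lemma lindeberg_resample (G : set (set Omega))
    (x y : Omega -> measurableTypeR R) (Z : nat -> Omega -> measurableTypeR R)
    (s : seq nat) (j : nat) :
  G `<=` measurable -> setI_closed G -> G setT ->
  measurable_fun setT (x : g_sigma_algebraType G -> _) ->
  measurable_fun setT (y : g_sigma_algebraType G -> _) ->
  (forall i, i \in s -> measurable_fun setT (Z i : g_sigma_algebraType G -> _)) ->
  measurable_fun setT (Z j) ->
  (forall A B, G A -> measurable B -> (P (A `&` Z j @^-1` B) = P A * mu B)%E) ->
  (size s < N)%N ->
  (\int[P]_w (Psi (x w) (y w) (map (Z ^~ w) (rcons s j)) ^+ 2)%:E
   <= \int[P]_w (Psi (x w) (y w) (map (Z ^~ w) s) ^+ 2)%:E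
      + \int[P]_w (20 * K (y w) ^+ 2 / N%:R ^+ 2)%:E)%E.
Proof.
move=> Gm GI GT mx my mZ mZj indep sN.
pose h (u : g_sigma_algebraType G * measurableTypeR R) :=
  ((Psi (x u.1) (y u.1) (rcons (map (Z ^~ u.1) s) u.2)) ^+ 2)%:E.
have mpmu : measurable_fun setT (fun u : g_sigma_algebraType G => p (x u) (y u) mu).
  exact: (measurableT_comp (p_measurable mu) (measurable_fun_pair mx my)).
have mh : measurable_fun setT h.
  apply/measurable_EFinP; apply: measurable_funX; apply: measurable_funB.
    apply: (@measurable_caratheodory _ (g_sigma_algebraType G) R (fun u z => p (x u) (y u)
      (resampled N mu (rcons (map (Z ^~ u) s) z)))) => [z|u].
      under eq_fun do rewrite -cats1.
      by apply: measurable_resampled => //; rewrite addn1.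
    under eq_fun do rewrite -cats1.
    by apply: resampled_continuous => //; rewrite size_map addn0.
  exact: (measurableT_comp mpmu measurable_fst).
have h0 u : (0 <= h u)%E by rewrite lee_fin sqr_ge0.
have mid : measurable_fun setT (id : Omega -> g_sigma_algebraType G).
  move=> _ A mA; rewrite setTI preimage_id; move: mA.
  by apply: smallest_sub => //; exact: sigma_algebra_measurable.
have GP (f : Omega -> R) : measurable_fun setT (f : g_sigma_algebraType G -> _) ->
    measurable_fun setT f by move=> mf; exact: measurableT_comp mf mid.
rewrite (eq_integral (fun w => h (w, Z j w))); last first.
  by move=> w _; rewrite /h/= map_rcons.
rewrite (independent_tonelli Gm GI GT mZj indep mh h0).
rewrite -ge0_integralD//; last 4 first.
- by move=> w _; rewrite lee_fin sqr_ge0.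
- apply/measurable_EFinP; apply/measurable_funX/GP.
  apply: measurable_funB => //.
  have := measurable_resampled p_measurable p_lipschitz mu N_gt0 (cs := [::]) mx my mZ.
  rewrite addn0 => /(_ (ltnW sN)).
  by under eq_fun do rewrite cats0.
- by move=> w _; rewrite lee_fin divr_ge0 ?exprn_ge0// mulr_ge0// sqr_ge0.
- apply/measurable_EFinP; apply: measurable_funM => //.
  apply: measurable_funM => //; apply: measurable_funX.
  by apply: measurableT_comp mK _; exact: GP.
apply: ge0_le_integral_any => w _; first exact: integral_ge0.
rewrite /h/= -EFinD.
have [hD hD2] := pD (x w) (y w).
apply: (@lindeberg_step R _ _ (D2 (x w) (y w)) _ hD _ _ _ N mu N_gt0) => //.
- by move=> z; exact: (proj2 hD2).
- by rewrite size_map.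
Qed.

End lindeberg.

(** * Independence of the particles and summation of the increments *)

Section cylinders.
Context (R : realType) d (Omega : measurableType d) (P : probability Omega R).
Context (events : nat -> set (set Omega)).
Hypotheses (eventsm : forall i, events i `<=` measurable)
  (eventsI : forall i, setI_closed (events i))
  (eventsT : forall i, events i setT).
Hypothesis events_indep : forall (s : seq nat) (A : nat -> set Omega), uniq s ->
  (forall i, i \in s -> events i (A i)) ->
  P (\bigcap_(i in [set` s]) A i) = (\prod_(i <- s) fine (P (A i)))%:E.

(** One event per particle of [s]: a pi-system for their joint sigma-algebra, on which independence
    of the family is exactly a product formula. *)
Definition cylinders (s : seq nat) : set (set Omega) :=
  [set E | exists2 A, (forall i, i \in s -> events i (A i)) &
    E = \bigcap_(i in [set` s]) A i].

Lemma cylinders_measurable s : cylinders s `<=` measurable.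
Proof.
move=> _ [A eA ->]; apply: fin_bigcap_measurable => // i si.
by apply: (@eventsm i); exact: eA.
Qed.

Lemma cylindersI s : setI_closed (cylinders s).
Proof.
move=> _ _ [A eA ->] [B eB ->]; exists (fun i => A i `&` B i).
  by move=> i si; exact: eventsI (eA _ si) (eB _ si).
by rewrite bigcapI.
Qed.

Lemma cylindersT s : cylinders s setT.
Proof. by exists (fun=> setT) => //; apply/seteqP; split. Qed.

Lemma cylinders1 s i A : i \in s -> events i A -> cylinders s A.
Proof.
move=> si eA; exists (fun j => if j == i then A else setT).
  by move=> j js; case: eqP => [->|].
apply/seteqP; split => w /=; first by move=> Aw j _; case: ifP.
by move=> /(_ i si); rewrite eqxx.
Qed.

Lemma cylinders_indep s j A B : uniq (j :: s) -> cylinders s A -> events j B ->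
  (P (A `&` B) = P A * P B)%E.
Proof.
move=> /[dup] ujs /= /andP[js us] [C eC ->] eB.
pose C' i := if i == j then B else C i.
have C'E i : i \in s -> C' i = C i.
  by rewrite /C'; case: eqP => // -> sj; rewrite sj in js.
have -> : \bigcap_(i in [set` s]) C i `&` B = \bigcap_(i in [set` j :: s]) C' i.
  apply/seteqP; split => w /=.
    move=> [h Bw] i /=; rewrite inE => /orP[/eqP->|si]; first by rewrite /C' eqxx.
    by rewrite C'E//; exact: h.
  move=> h; split; last by have := h j; rewrite /= inE eqxx /C' eqxx; apply.
  by move=> i /= si; rewrite -C'E//; apply: h; rewrite /= inE si orbT.
rewrite events_indep//; last first.
  move=> i; rewrite inE => /orP[/eqP->|si]; first by rewrite /C' eqxx.
  by rewrite C'E//; exact: eC.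
rewrite events_indep// big_cons /C' eqxx EFinM muleC fineK ?fin_num_measure//; last first.
  exact: eventsm eB.
congr (_%:E * _)%E; apply: eq_big_seq => i si.
by have := C'E i si; rewrite /C' => ->.
Qed.

Context (p : R -> R -> P2 R -> R).
Hypotheses (p_measurable : measurable_xy p) (p_lipschitz : lipschitz_measure p).
Context (D : R -> R -> P2 R -> R -> R) (D2 : R -> R -> P2 R -> R -> R -> R).
Context (K : R -> R).
Hypotheses (pD : forall x y, is_lfd (p x y) (D x y) /\ is_lfd2 (D x y) (D2 x y))
  (DK : forall x y m z, `|D x y m z| <= K y)
  (D2K : forall x y m z z', `|D2 x y m z z'| <= K y)
  (mK : measurable_fun setT (K : measurableTypeR R -> measurableTypeR R)).
Context (N : nat) (mu : P2 R).
Hypothesis N_gt0 : (0 < N)%N.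
Context (X Y : nat -> Omega -> measurableTypeR R).
Hypotheses (Xevents : forall i B, measurable B -> events i (X i @^-1` B))
  (Yevents : forall i B, measurable B -> events i (Y i @^-1` B))
  (Xlaw : forall i B, measurable B -> P (X i @^-1` B) = mu B).

Let EK2 i := (\int[P]_w (K (Y i w) ^+ 2)%:E)%E.

(** Each step conditions on the cylinders of [i :: s]: particle [i] must be included because [p] is
    evaluated at its position. For the same reason [i] may not be one of the resampled atoms, whence
    [uniq (i :: s)]. *)
Lemma integral_resampled_le i s : uniq (i :: s) -> (size s <= N)%N ->
  (\int[P]_w ((p (X i w) (Y i w) (resampled N mu (map (X ^~ w) s))
      - p (X i w) (Y i w) mu) ^+ 2)%:E
    <= ((size s)%:R * 20 / N%:R ^+ 2)%:E * EK2 i)%E.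
Proof.
have mYi : measurable_fun setT (Y i).
  by move=> _ B mB; rewrite setTI; exact: eventsm (Yevents _ mB).
have mK2 : measurable_fun setT (fun w => (K (Y i w) ^+ 2)%:E).
  by apply/measurable_EFinP; apply: measurable_funX; exact: measurableT_comp mK mYi.
have EK20 : (0 <= EK2 i)%E by apply: integral_ge0 => w _; rewrite lee_fin sqr_ge0.
elim/last_ind: s => [|s j IH].
  move=> _ _; rewrite !mul0r mul0e integral0_eq// => w _.
  rewrite /= (@lfd_ext _ _ _ _ (resampled N mu [::]) mu (proj1 (pD (X i w) (Y i w))) (DK _ _)).
    by rewrite subrr expr0n.
  by move=> A mA; rewrite resampled_nil.
rewrite -rcons_cons rcons_uniq size_rcons inE negb_or => /andP[/andP[ji js] uis] sN.
pose G := cylinders (i :: s).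
have mG l (f : Omega -> measurableTypeR R) : l \in i :: s ->
    (forall B, measurable B -> events l (f @^-1` B)) ->
    measurable_fun setT (f : g_sigma_algebraType G -> _).
  move=> ls ef _ B mB; rewrite setTI; apply: sub_sigma_algebra.
  by apply: cylinders1 ls _; exact: ef.
have := @lindeberg_resample R p p_measurable p_lipschitz D D2 K pD DK D2K mK
  d Omega P N mu N_gt0 G (X i) (Y i) X s j (@cylinders_measurable _) (@cylindersI _)
  (@cylindersT _) _ _ _ _ _ sN.
move=> /(_ _ _ _ _ _)/le_trans; apply.
- by apply: (mG i); [rewrite inE eqxx|exact: Xevents].
- by apply: (mG i); [rewrite inE eqxx|exact: Yevents].
- by move=> l ls; apply: (mG l); [rewrite inE ls orbT|exact: Xevents].
- by move=> _ B mB; rewrite setTI; exact: eventsm (Xevents _ mB).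
- move=> A B GA mB; rewrite (@cylinders_indep (i :: s) j)//.
  + by rewrite Xlaw.
  + by rewrite /= inE negb_or ji js.
  + exact: Xevents.
have -> : (size s).+1%:R * 20 / N%:R ^+ 2 =
    (size s)%:R * 20 / N%:R ^+ 2 + 20 / N%:R ^+ 2 :> R.
  by rewrite -(natr1 (size s)) 2!mulrDl mul1r.
rewrite EFinD ge0_muleDl//.
apply: leeD; first exact: IH uis (ltnW sN).
rewrite /EK2 -ge0_integralZl_EFin//; last first.
  by move=> w _; rewrite lee_fin sqr_ge0.
by rewrite le_eqVlt; apply/orP; left; apply/eqP/eq_integral => w _; rewrite -EFinM mulrAC.
Qed.

(** The atoms are listed with [i] at the end, so that the first N - 1 replacements never involve it.
    Once all N atoms are present no mass of [mu] is left. *)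
Lemma empirical_resampled (x : nat -> R) i : (i < N)%N ->
  empirical (fun j : 'I_N => x j)
    = resampled N mu (map x (rcons (rem i (iota 0 N)) i)).
Proof.
move=> iN; apply: eq_toP2 => A mA; rewrite partial_meanE size_map.
have pe : perm_eq (rcons (rem i (iota 0 N)) i) (iota 0 N).
  by rewrite perm_rcons perm_sym perm_to_rem// mem_iota add0n iN.
rewrite (perm_size pe) size_iota subnn mul0r mul0e adde0; congr (_ * _)%E.
rewrite big_map (perm_big _ pe) -[N in iota 0 N]subn0 big_mkord.
by [].
Qed.

(** The last atom, particle [i] itself, is not independent of the evaluation point, so it is paid
    for by the deterministic bound 2K/N. By (u - m)^2 <= 2 (v - m)^2 + 2 (u - v)^2 the total is 40
    (N - 1)/N^2 + 8/N^2, below 48/N. *)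
Lemma integral_empirical_le i : (i < N)%N ->
  (\int[P]_w (`|p (X i w) (Y i w) (empirical (fun j : 'I_N => X j w))
      - p (X i w) (Y i w) mu| ^+ 2)%:E
    <= (48 / N%:R)%:E * EK2 i)%E.
Proof.
move=> iN; set s := rem i (iota 0 N).
have us : uniq (i :: s).
  rewrite /= mem_rem_uniq ?iota_uniq// rem_uniq ?iota_uniq//.
  by rewrite !inE eqxx.
have ss : size s = N.-1 by rewrite size_rem ?size_iota// mem_iota add0n iN.
have mYi : measurable_fun setT (Y i).
  by move=> _ B mB; rewrite setTI; exact: eventsm (Yevents _ mB).
have mXl l : measurable_fun setT (X l).
  by move=> _ B mB; rewrite setTI; exact: eventsm (Xevents _ mB).
have mK2 : measurable_fun setT (fun w => (K (Y i w) ^+ 2)%:E).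
  by apply/measurable_EFinP; apply: measurable_funX; exact: measurableT_comp mK mYi.
have EK20 : (0 <= EK2 i)%E by apply: integral_ge0 => w _; rewrite lee_fin sqr_ge0.
have sN : (size s < N)%N by rewrite ss prednK.
pose S w := p (X i w) (Y i w) (resampled N mu (map (X ^~ w) s)) - p (X i w) (Y i w) mu.
have mS : measurable_fun setT S.
  apply: measurable_funB.
    have := measurable_resampled p_measurable p_lipschitz mu N_gt0 (s := s) (cs := [::])
      (mXl i) mYi (fun l _ => mXl l).
    rewrite addn0 => /(_ (ltnW sN)).
    by under eq_fun do rewrite cats0.
  exact: (measurableT_comp (p_measurable mu) (measurable_fun_pair (mXl i) mYi)).
apply: (@le_trans _ _ (\int[P]_w (2%:E * (S w ^+ 2)%:E
    + (8 / N%:R ^+ 2)%:E * (K (Y i w) ^+ 2)%:E))%E).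
  apply: ge0_le_integral_any => w _; first by rewrite lee_fin exprn_ge0.
  rewrite -!EFinM -EFinD lee_fin.
  rewrite (empirical_resampled (X ^~ w) iN) -/s.
  rewrite map_rcons.
  have sN' : (size (map (X ^~ w) s) < N)%N by rewrite size_map.
  have sh := resampled_rcons mu N_gt0 (X i w) sN'.
  have N0 : 0 <= (N%:R^-1 : R) by rewrite invr_ge0.
  have h := lfd_shifted_mass (proj1 (pD (X i w) (Y i w))) (DK (X i w) (Y i w)) N0 sh.
  move: h; rewrite /S.
  set u := p _ _ (resampled N mu (rcons _ _)).
  set v := p _ _ (resampled N mu (map _ _)); set m := p _ _ mu.
  move: u v m => u v m h.
  rewrite real_normK ?num_real// -exprVn.
  have h3 : (u - v) ^+ 2 <= 4 * N%:R^-1 ^+ 2 * K (Y i w) ^+ 2.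
    have -> : 4 * N%:R^-1 ^+ 2 * K (Y i w) ^+ 2 = (2 * N%:R^-1 * K (Y i w)) ^+ 2 by ring.
    by rewrite -[leLHS]real_normK ?num_real// lerXn2r ?nnegrE// (le_trans _ h).
  have h4 : (u - m) ^+ 2 <= 2 * (v - m) ^+ 2 + 2 * (u - v) ^+ 2.
    rewrite -subr_ge0 (_ : _ - _ = (v - m - (u - v)) ^+ 2) ?sqr_ge0//.
    by ring.
  by apply: (le_trans h4); rewrite lerD2l; lra.
rewrite ge0_integralD//; last 4 first.
- by move=> w _; rewrite -EFinM lee_fin mulr_ge0// sqr_ge0.
- by apply: measurable_funeM; apply/measurable_EFinP; exact: measurable_funX.
- by move=> w _; rewrite -EFinM lee_fin mulr_ge0 ?sqr_ge0// divr_ge0// exprn_ge0.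
- exact: measurable_funeM.
have mS2 : measurable_fun setT (fun w => (S w ^+ 2)%:E).
  by apply/measurable_EFinP; exact: measurable_funX.
rewrite !ge0_integralZl_EFin//; try by move=> w _; rewrite lee_fin sqr_ge0.
apply: (@le_trans _ _ (2%:E * ((N.-1%:R * 20 / N%:R ^+ 2)%:E * EK2 i)
    + (8 / N%:R ^+ 2)%:E * EK2 i)%E).
  apply: leeD => //; rewrite lee_pmul2l ?lte_fin// -ss.
  exact: integral_resampled_le us (ltnW sN).
rewrite muleA -ge0_muleDl//.
apply: lee_wpmul2r => //; rewrite -EFinM -EFinD lee_fin.
have N0 : 0 < (N%:R : R) by rewrite ltr0n.
have -> : (N.-1%:R : R) = N%:R - 1 by rewrite -subn1 natrB.
have -> : 48 / N%:R = 48 * N%:R / N%:R ^+ 2 :> R by field; rewrite gt_eqF.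
rewrite mulrA -mulrDl ler_wpM2r ?invr_ge0 ?exprn_ge0//.
have : 1 <= (N%:R : R) by rewrite ler1n.
lra.
Qed.

End cylinders.

(** * Exponential moments of Ito integrals *)

Section density.
Context d (T : measurableType d) (R : realType).
Context (mu nu : {measure set T -> \bar R}) (g : T -> R).
Hypotheses (mg : measurable_fun setT g) (g0 : forall x, 0 <= g x).
Hypothesis nuE : forall A, measurable A -> nu A = (\int[mu]_(x in A) (g x)%:E)%E.

Lemma integral_density_nnsfun (h : {nnsfun T >-> R}) :
  (\int[nu]_x (h x)%:E = \int[mu]_x ((h x)%:E * (g x)%:E))%E.
Proof.
under eq_integral do rewrite fimfunE -fsumEFin//.
under [RHS]eq_integral => x _.
  rewrite fimfunE -fsumEFin// muleC ge0_mule_fsumr; last first.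
    by move=> r; rewrite EFinM nnfun_muleindic_ge0.
  over.
have mi r : measurable_fun setT (fun x : T => (r * \1_(h @^-1` [set r]) x)%:E).
  by apply/measurable_EFinP; apply: measurable_funM.
rewrite ge0_integral_fsum//; last by move=> r x _; rewrite EFinM nnfun_muleindic_ge0.
rewrite ge0_integral_fsum//; last 2 first.
- by move=> r; apply: emeasurable_funM => //; exact/measurable_EFinP.
- move=> r x _; rewrite mule_ge0 ?lee_fin// -lee_fin EFinM.
  exact: nnfun_muleindic_ge0.
apply: eq_fsbigr => r rh.
rewrite integralZl_indic_nnsfun// integral_indic// setIT nuE//.
under [RHS]eq_integral do rewrite muleC EFinM -muleA.
rewrite [RHS]ge0_integralZl//; last 3 first.
- apply: emeasurable_funM => //; last exact/measurable_EFinP.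
  by apply/measurable_EFinP.
- by move=> x _; rewrite mule_ge0// lee_fin.
- by rewrite lee_fin; move: rh; rewrite inE => -[x _ <-].
congr (_ * _)%E; rewrite [LHS]integral_mkcond; apply: eq_integral => x _.
by rewrite patchE indicE; case: ifPn => _; rewrite ?mul1e ?mul0e.
Qed.

Lemma ge0_integral_density (f : T -> \bar R) :
  measurable_fun setT f -> (forall x, 0 <= f x)%E ->
  (\int[nu]_x f x = \int[mu]_x (f x * (g x)%:E))%E.
Proof.
move=> mf f0; pose f_ := nnsfun_approx measurableT mf.
transitivity (limn (fun n => \int[nu]_x (f_ n x)%:E))%E.
  rewrite -monotone_convergence//=.
  - apply: eq_integral => x _; apply/esym/cvg_lim => //=.
    exact: cvg_nnsfun_approx.
  - by move=> n; exact/measurable_EFinP/measurable_funTS.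
  - by move=> n x _; rewrite lee_fin.
  - by move=> x _ a b ab; rewrite lee_fin//; exact/lefP/nd_nnsfun_approx.
transitivity (limn (fun n => \int[mu]_x ((f_ n x)%:E * (g x)%:E)))%E.
  by congr (limn _); apply/funext => n; exact: integral_density_nnsfun.
rewrite -monotone_convergence//=.
- apply: eq_integral => x _; apply/cvg_lim => //=.
  by apply: cvgeZr => //; exact: cvg_nnsfun_approx.
- by move=> n; apply: emeasurable_funM; exact/measurable_EFinP.
- by move=> n x _; rewrite mule_ge0 ?lee_fin.
- move=> x _ a b ab; rewrite lee_wpmul2r ?lee_fin//; exact/lefP/nd_nnsfun_approx.
Qed.

End density.

(* Completing the square turns the tilted normal density into a shifted one. *)
Lemma normal_exponential_moment (R : realType) (c s : R) : s != 0 ->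
  (\int[normal_prob 0 s]_x (expR (c * x - c ^+ 2 * s ^+ 2 / 2))%:E = 1)%E.
Proof.
move=> s0.
rewrite (@ge0_integral_density _ _ _ lebesgue_measure _ (normal_pdf 0 s))//.
- rewrite -(integral_normal_pdf (c * s ^+ 2) s).
  apply: eq_integral => x _; rewrite -EFinM; congr EFin.
  rewrite !normal_pdfE// mulrCA; congr (_ * _); rewrite -expRD; congr expR.
  rewrite mulr2n; field.
  by rewrite s0.
- exact: measurable_normal_pdf.
- exact: normal_pdf_ge0.
- apply/measurable_EFinP; apply: measurableT_comp => //.
  by apply: measurable_funB => //; exact: measurable_funM.
Qed.

Lemma g_sigma_algebraS d (T : measurableType d) d' (T' : measurableType d')
    (G G' : set (set T)) (f : T -> T') : G `<=` G' ->
  measurable_fun setT (f : g_sigma_algebraType G -> T') ->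
  measurable_fun setT (f : g_sigma_algebraType G' -> T').
Proof.
move=> GG' mf _ B mB; have := mf measurableT B mB; rewrite !setTI.
exact: sub_smallest2r.
Qed.

Lemma g_sigma_algebra_measurable d (T : measurableType d) d' (T' : measurableType d')
    (G : set (set T)) (f : T -> T') : G `<=` measurable ->
  measurable_fun setT (f : g_sigma_algebraType G -> T') ->
  measurable_fun setT f.
Proof.
move=> Gm mf _ B mB; have := mf measurableT B mB; rewrite !setTI.
by apply: smallest_sub => //; exact: sigma_algebra_measurable.
Qed.

(** * The exponential martingale identity for simple integrands *)

Section exponential_martingale.
Context (R : realType) d (Omega : measurableType d) (P : probability Omega R).
Context (F : R -> set (set Omega)) (W : R -> Omega -> R).
Hypothesis F_filtration : filtration F.
Hypothesis W_adapted : forall t (B : set (measurableTypeR R)), 0 <= t ->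
  measurable B -> F t (W t @^-1` B).
Hypothesis W_increment : forall (s t : R) A (B : set (measurableTypeR R)),
  0 <= s -> s < t -> F s A -> measurable B ->
  (P (A `&` [set w | B (W t w - W s w)%R])
    = P A * normal_prob 0 (Num.sqrt (t - s)%R) B)%E.

Let Fm t : 0 <= t -> F t `<=` measurable.
Proof. by move=> t0; have [h _] := F_filtration; have [] := h t t0. Qed.

Let FS s t : 0 <= s <= t -> F s `<=` F t.
Proof. by have [_] := F_filtration; apply. Qed.

Let mW s t : 0 <= s <= t ->
  measurable_fun setT (W s : g_sigma_algebraType (F t) -> measurableTypeR R).
Proof.
move=> /andP[s0 st] _ B mB; rewrite setTI; apply: sub_sigma_algebra.
by apply: (FS (s := s)); [rewrite s0|exact: W_adapted].
Qed.

(** Given [F a] the increment is centred Gaussian with variance b - a, so with [w] frozen the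
    exponential factor has mean 1. All integrands are nonnegative, hence no integrability is
    required. *)
Lemma gaussian_increment_exponential (a b c : R) (Z xi : Omega -> measurableTypeR R) :
  0 <= a -> a < b -> (forall w, 0 <= Z w) ->
  measurable_fun setT (Z : g_sigma_algebraType (F a) -> _) ->
  measurable_fun setT (xi : g_sigma_algebraType (F a) -> _) ->
  (\int[P]_w (Z w * expR (c * xi w * (W b w - W a w)
      - c ^+ 2 * xi w ^+ 2 * (b - a) / 2))%:E = \int[P]_w (Z w)%:E)%E.
Proof.
move=> a0 ab Z0 mZ mxi.
have ab0 : 0 < b - a by rewrite subr_gt0.
have b0 : 0 <= b := ltW (le_lt_trans a0 ab).
have [sF _] := proj1 F_filtration _ a0.
pose h (u : g_sigma_algebraType (F a) * measurableTypeR R) :=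
  (Z u.1 * expR (c * xi u.1 * u.2 - c ^+ 2 * xi u.1 ^+ 2 * (b - a) / 2))%:E.
have mZ1 : measurable_fun setT (fun u : g_sigma_algebraType (F a) * measurableTypeR R => Z u.1).
  exact: (measurableT_comp mZ measurable_fst).
have mxi1 : measurable_fun setT (fun u : g_sigma_algebraType (F a) * measurableTypeR R => xi u.1).
  exact: (measurableT_comp mxi measurable_fst).
have mh : measurable_fun setT h.
  apply/measurable_EFinP; apply: measurable_funM => //; apply: measurableT_comp => //.
  apply: measurable_funB.
    by apply: measurable_funM; [exact: measurable_funM|exact: measurable_snd].
  apply: measurable_funM => //; apply: measurable_funM => //.
  by apply: measurable_funM => //; exact: measurable_funX.
have h0 u : (0 <= h u)%E by rewrite lee_fin mulr_ge0// expR_ge0.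
have mV : measurable_fun setT (fun w => W b w - W a w : measurableTypeR R).
  apply: measurable_funB.
    by apply: g_sigma_algebra_measurable (Fm b0) _; apply: mW; rewrite b0 lexx.
  by apply: g_sigma_algebra_measurable (Fm a0) _; apply: mW; rewrite a0 lexx.
have FT : F a setT by rewrite -[setT]setD0; case: sF => s0 sD _; exact: sD.
have FI : setI_closed (F a).
  move=> A B FA FB; rewrite -(sigma_algebra_id sF).
  by apply: (@measurableI _ (g_sigma_algebraType (F a))); apply: sub_sigma_algebra.
have := independent_tonelli (m := normal_prob 0 (Num.sqrt (b - a))) (Fm a0) FI FT mV
  (fun A B => @W_increment a b A B a0 ab) mh h0.
rewrite /h/= => ->; apply: eq_integral => w _.
under eq_integral do rewrite EFinM.
rewrite ge0_integralZl_EFin//; last first.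
  apply/measurable_EFinP; apply: measurableT_comp => //.
  by apply: measurable_funB => //; exact: measurable_funM.
rewrite -[RHS]mule1; congr (_ * _)%E.
rewrite -(@normal_exponential_moment R (c * xi w) (Num.sqrt (b - a))); last first.
  by rewrite gt_eqF// sqrtr_gt0.
by apply: eq_integral => z _; rewrite sqr_sqrtr ?(ltW ab0)// exprMn.
Qed.

Context (S : @simple_process R d Omega).
Hypothesis S_ok : simple_ok F S.
Context (s t : R).
Hypotheses (s_ge0 : 0 <= s) (st : s <= t).

(** Partition times clipped to [[s, t]]. When [a n < a n.+1], clipping has not lowered
    [sp_time S n], so [sp_val S n] is known at time [a n]. In the degenerate case this may fail, but
    then the corresponding factor is 1. *)
Let a k : R := Num.min (Num.max (sp_time S k) s) t.

Let a_ge k : s <= a k <= t.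
Proof. by rewrite /a ge_min lexx orbT le_min st le_max lexx orbT. Qed.

Let a_nd k : a k <= a k.+1.
Proof.
have [_ h _ _] := S_ok; rewrite /a le_min2//; apply: le_max2 => //; exact: h.
Qed.

(** The quadratic variation over [[s, t]] of the elementary integral. *)
Definition simple_variation (w : Omega) : R :=
  \sum_(k < sp_size S) sp_val S k w ^+ 2 * (a k.+1 - a k).

Lemma simple_integral_increment w :
  simple_integral S W t w - simple_integral S W s w =
  \sum_(k < sp_size S) sp_val S k w * (W (a k.+1) w - W (a k) w).
Proof.
rewrite /simple_integral -sumrB; apply: eq_bigr => k _; rewrite -mulrBr; congr (_ * _).
(* Clipping to [[s, t]] amounts to the difference of stopping at [t] and at [s], up to the term
   [W s], which cancels in increments. *)
have E r : W (Num.min (Num.max r s) t) w = W (Num.min t r) w - W (Num.min s r) w + W s w.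
  have [rs|sr] := leP r s.
    by rewrite (min_l st) (min_r (le_trans rs st)) subrr add0r.
  by rewrite subrK minC.
by rewrite /a !E; ring.
Qed.

Let expo (c : R) n w : R := expR (\sum_(k < n)
  (c * sp_val S k w * (W (a k.+1) w - W (a k) w)
   - c ^+ 2 * sp_val S k w ^+ 2 * (a k.+1 - a k) / 2)).

Let expo_eq c n : a n = a n.+1 -> expo c n.+1 = expo c n.
Proof.
move=> an; apply/funext => w; rewrite /expo big_ord_recr/= -an !subrr.
by rewrite !mulr0 mul0r subrr addr0.
Qed.

Let expoS c n w : expo c n.+1 w = expo c n w *
  expR (c * sp_val S n w * (W (a n.+1) w - W (a n) w)
   - c ^+ 2 * sp_val S n w ^+ 2 * (a n.+1 - a n) / 2).
Proof. by rewrite /expo big_ord_recr/= expRD. Qed.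

Let val_measurable n : a n < a n.+1 -> measurable_fun setT
  (sp_val S n : g_sigma_algebraType (F (a n)) -> measurableTypeR R).
Proof.
move=> an; have [S0 Snd Sval _] := S_ok.
have Sge0 k : 0 <= sp_time S k.
  by elim: k => // k /le_trans; apply; exact: Snd.
have nt : sp_time S n <= a n.
  have : a n < t by apply: (lt_le_trans an); have /andP[] := a_ge n.+1.
  rewrite /a gt_min ltxx orbF => h.
  by rewrite le_min le_max lexx/= (le_trans _ (ltW h))// le_max lexx.
move=> _ B mB; rewrite setTI; apply: sub_sigma_algebra.
by apply: (FS (s := sp_time S n)); [rewrite Sge0|exact: Sval].
Qed.

Let expo_measurable c n : measurable_fun setT
  (expo c n : g_sigma_algebraType (F (a n)) -> measurableTypeR R).
Proof.
have aS k : F (a k) `<=` F (a k.+1).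
  by apply: FS; rewrite a_nd (le_trans s_ge0)//; have /andP[] := a_ge k.
elim: n => [|n IH].
  by rewrite [X in measurable_fun _ X](_ : _ = cst (expR 0))//; apply/funext => w; rewrite /expo big_ord0.
have [an|an] := eqVneq (a n) (a n.+1).
  by rewrite expo_eq// -an.
have {}an : a n < a n.+1 by rewrite lt_neqAle an a_nd.
have a0 k : 0 <= a k by rewrite (le_trans s_ge0)//; have /andP[] := a_ge k.
rewrite (_ : expo c n.+1 = (fun w => expo c n w *
    expR (c * sp_val S n w * (W (a n.+1) w - W (a n) w)
     - c ^+ 2 * sp_val S n w ^+ 2 * (a n.+1 - a n) / 2))); last first.
  by apply/funext => w; exact: expoS.
have mIH := g_sigma_algebraS (aS n) IH.
have mval := g_sigma_algebraS (aS n) (val_measurable an).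
apply: measurable_funM => //; apply: measurableT_comp => //.
apply: measurable_funB.
  apply: measurable_funM; first exact: measurable_funM.
  by apply: measurable_funB; apply: mW; rewrite a0 ?lexx// ltW.
apply: measurable_funM => //; apply: measurable_funM => //.
by apply: measurable_funM => //; exact: measurable_funX.
Qed.

Let integral_expo c n : (\int[P]_w (expo c n w)%:E = 1)%E.
Proof.
elim: n => [|n IH].
  rewrite (eq_integral (cst 1%E)); first by rewrite integral_cst// mul1e; exact: probability_setT.
  by move=> w _; rewrite /expo big_ord0 expR0.
have [an|an] := eqVneq (a n) (a n.+1); first by rewrite expo_eq.
have {}an : a n < a n.+1 by rewrite lt_neqAle an a_nd.
rewrite -IH; under eq_integral do rewrite expoS.
apply: gaussian_increment_exponential => //.
- by rewrite (le_trans s_ge0)//; have /andP[] := a_ge n.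
- by move=> w; exact: expR_ge0.
- exact: val_measurable.
Qed.

Lemma simple_integral_exponential c :
  (\int[P]_w (expR (c * (simple_integral S W t w - simple_integral S W s w)
     - c ^+ 2 * simple_variation w / 2))%:E = 1)%E.
Proof.
rewrite -(integral_expo c (sp_size S)); apply: eq_integral => w _.
congr (expR _)%:E; rewrite simple_integral_increment /simple_variation.
rewrite mulr_sumr [in RHS]sumrB; congr (_ - _); first by apply: eq_bigr => k _; rewrite mulrA.
by rewrite mulr_sumr mulr_suml; apply: eq_bigr => k _; rewrite !mulrA.
Qed.

End exponential_martingale.

(** Truncations are bounded, so events of vanishing probability contribute nothing to them in the
    limit. This is how a bound survives convergence in probability. *)
Lemma ge0_integral_le_truncations d (T : measurableType d) (R : realType)
    (mu : {measure set T -> \bar R}) (f : T -> R) (b : \bar R) :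
  measurable_fun setT f -> (forall x, 0 <= f x) ->
  (forall n : nat, \int[mu]_x (Num.min (f x) n%:R)%:E <= b)%E ->
  (\int[mu]_x (f x)%:E <= b)%E.
Proof.
move=> mf f0 fb.
have lim_f x : limn (fun n => (Num.min (f x) n%:R)%:E) = (f x)%:E.
  apply/cvg_lim => //; apply: cvg_near_cst.
  exists (Num.truncn (f x)).+1 => // m /= nm; rewrite min_l//.
  by rewrite (le_trans (ltW (Num.Theory.truncnS_gt _)))// ler_nat.
rewrite -(eq_integral _ _ (fun x _ => lim_f x)).
have mc : (\int[mu]_x (Num.min (f x) n%:R)%:E)%E @[n --> \oo]
    --> (\int[mu]_x limn (fun n => (Num.min (f x) n%:R)%:E))%E.
  apply: (@cvg_monotone_convergence _ T R mu setT measurableT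
    (fun n x => (Num.min (f x) n%:R)%:E)).
  - by move=> n; apply/measurable_EFinP; exact: measurable_minr.
  - by move=> n x _; rewrite lee_fin le_min f0 ler0n.
  - by move=> x _ m n mn; rewrite lee_fin le_min2// ler_nat.
rewrite -(cvg_lim _ mc)//; apply: lime_le; first by apply/cvg_ex; eexists; exact: mc.
exact: nearW.
Qed.

Lemma within_continuous_dist (R : realType) (A : set R) (f : R -> R) :
  {within A, continuous f} ->
  forall u, A u -> forall e, 0 < e -> exists2 del, 0 < del &
    forall v, A v -> `|u - v| < del -> `|f u - f v| < e.
Proof.
move=> /subspace_continuousP cf u Au e e0.
have /cvgrPdist_lt/(_ e e0) := cf u Au.
rewrite /= near_withinE => -[del del0 h]; exists del => // v Av uv.
exact: h.
Qed.

(** It turns an existential over the times of [[0, T]] into a countable union, which makes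
    uniform-distance events measurable. *)
Lemma exists_rational_itv (R : realType) (T : R) (g : R -> R) (e : R) : 0 < T ->
  (forall u, 0 <= u <= T -> forall e, 0 < e -> exists2 del, 0 < del &
    forall v, 0 <= v <= T -> `|u - v| < del -> `|g u - g v| < e) ->
  (exists2 u : R, 0 <= u <= T & e < g u) ->
  exists2 q : rat, 0 <= (ratr q : R) <= T & e < g (ratr q).
Proof.
move=> T0 cg [u u0T eg]; have [del del0 h] := cg u u0T (g u - e) ltac:(by rewrite subr_gt0).
have [q] : exists q : rat, 0 <= (ratr q : R) <= T /\ `|u - ratr q| < del.
  have /andP[u0 uT] := u0T.
  (* [T] may be irrational, so at the right endpoint the rational is sought to the left. *)
  have [{}uT|Tu] := ltP u T.
    have [|q] := @rat_in_itvoo R u (Num.min (u + del) T).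
      by rewrite lt_min uT ltrDl del0.
    rewrite in_itv/= lt_min => /and3P[uq qd qT]; exists q; split.
      by rewrite (le_trans u0 (ltW uq)) ltW.
    by rewrite ltr0_norm ?subr_lt0// opprB ltrBlDl.
  have [|q] := @rat_in_itvoo R (Num.max (u - del) 0) u.
    by rewrite gt_max ltrBlDr ltrDl del0 (lt_le_trans T0).
  rewrite in_itv/= gt_max => /andP[/andP[uq q0] qu]; exists q; split.
    by rewrite (ltW q0) (le_trans (ltW qu)).
  by rewrite gtr0_norm ?subr_gt0// ltrBlDl -ltrBlDr.
move=> [q0T uq]; exists q => //; have := h _ q0T uq.
by rewrite ltr_norml => /andP[_]; lra.
Qed.

Lemma dist_minr_le (R : realDomainType) (u v r : R) :
  `|Num.min u r - Num.min v r| <= `|u - v|.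
Proof.
have /andP[n1 n2] : - `|u - v| <= u - v <= `|u - v| by rewrite -ler_norml.
have n0 := normr_ge0 (u - v); rewrite ler_norml.
by case: (leP u r) => ur; case: (leP v r) => vr; apply/andP; split; lra.
Qed.

(** * From simple integrands to Ito integrals *)

Section ito_exponential.
Context (R : realType) d (Omega : measurableType d) (P : probability Omega R).
Context (F : R -> set (set Omega)) (W : R -> Omega -> R) (T : R).
Hypothesis T_gt0 : 0 < T.
Hypothesis F_filtration : filtration F.
Hypothesis W_adapted : forall t (B : set (measurableTypeR R)), 0 <= t ->
  measurable B -> F t (W t @^-1` B).
Hypothesis W_increment : forall (s t : R) A (B : set (measurableTypeR R)),
  0 <= s -> s < t -> F s A -> measurable B ->
  (P (A `&` [set w | B (W t w - W s w)%R])
    = P A * normal_prob 0 (Num.sqrt (t - s)%R) B)%E.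
Hypothesis W_continuous : forall w, {within `[0, +oo[, continuous (W ^~ w)}.

Let Fm t : 0 <= t -> F t `<=` measurable.
Proof. by move=> t0; have [h _] := F_filtration; have [] := h t t0. Qed.

Lemma adapted_measurable (Z : Omega -> measurableTypeR R) t : 0 <= t ->
  (forall B, measurable B -> F t (Z @^-1` B)) -> measurable_fun setT Z.
Proof. by move=> t0 h _ B mB; rewrite setTI; exact: Fm t0 _ (h _ mB). Qed.

Lemma progressive_measurable (H : R -> Omega -> R) : progressive F T H ->
  measurable_fun (`[0, T]%classic `*` setT)
    (fun u : measurableTypeR R * Omega => H u.1 u.2 : measurableTypeR R).
Proof.
move=> /(_ T); rewrite ltW// lexx => /(_ isT) pH mD B mB.
have := pH B mB.
have -> : [set u : R * Omega | 0 <= u.1 <= T /\ B (H u.1 u.2)] =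
    (`[0, T]%classic `*` setT) `&`
    (fun u : measurableTypeR R * Omega => H u.1 u.2 : measurableTypeR R) @^-1` B.
  by apply/seteqP; split=> -[r w] /=; rewrite in_itv/=; [move=> [? ?]|move=> [[? ?] ?]].
apply: smallest_sub; first exact: sigma_algebra_measurable.
move=> _ [A mA [E FE <-]]; apply: measurableX => //.
exact: Fm (ltW T_gt0) _ FE.
Qed.

Section simple.
Context (S : @simple_process R d Omega).
Hypothesis S_ok : simple_ok F S.

Let S_time_ge0 k : 0 <= sp_time S k.
Proof.
have [S0 Snd _ _] := S_ok.
by elim: k => // k /le_trans; apply; exact: Snd.
Qed.

Lemma simple_time_nd : {homo sp_time S : m n / (m <= n)%N >-> m <= n}.
Proof.
have [_ Snd _ _] := S_ok.
by apply: homo_leq => //; exact: le_trans.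
Qed.

Let val_measurable k : measurable_fun setT (sp_val S k : Omega -> measurableTypeR R).
Proof.
have [_ _ Sval _] := S_ok.
by apply: (adapted_measurable (S_time_ge0 k)) => B; exact: Sval.
Qed.

Lemma simple_eval_measurable : measurable_fun setT
  (fun u : measurableTypeR R * Omega => simple_eval S u.1 u.2 : measurableTypeR R).
Proof.
apply: measurable_sum => k; apply: measurable_funM.
  by apply: measurableT_comp measurable_snd => //; exact: val_measurable.
apply: (@measurableT_comp _ _ _ _ _ _ (fun r : measurableTypeR R =>
  ((sp_time S k < r <= sp_time S k.+1)%R)%:R : measurableTypeR R)); last exact: measurable_fst.
rewrite (_ : (fun r => _) = \1_(`]sp_time S k, sp_time S k.+1]%classic)).
  exact: measurable_indic.
by apply/funext => r; rewrite indicE mem_setE in_itv.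
Qed.

Lemma simple_integral_measurable t : 0 <= t ->
  measurable_fun setT (simple_integral S W t : Omega -> measurableTypeR R).
Proof.
move=> t0; apply: measurable_sum => k; apply: measurable_funM; first exact: val_measurable.
have mW r : 0 <= r -> measurable_fun setT (W r : Omega -> measurableTypeR R).
  by move=> r0; apply: (adapted_measurable r0) => B mB; exact: W_adapted.
by apply: measurable_funB; apply: mW; rewrite le_min t0 S_time_ge0.
Qed.

Lemma simple_integral_continuous w :
  {within `[0, +oo[, continuous (fun t => simple_integral S W t w)}.
Proof.
apply/subspace_continuousP => u; rewrite /= in_itv/= andbT => u0.
have cW r : 0 <= r -> W (Num.min t r) w @[t --> within `[0, +oo[%classic (nbhs u)]
    --> W (Num.min u r) w.
  move=> r0; apply/cvgrPdist_lt => e e0.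
  have ur : (`[0, +oo[%classic : set R) (Num.min u r).
    by rewrite /= in_itv/= andbT le_min u0.
  have [del del0 h] := within_continuous_dist (@W_continuous w) ur e0.
  rewrite near_withinE; exists del => // v uv; rewrite /= in_itv/= andbT => v0.
  apply: h; first by rewrite /= in_itv/= andbT le_min v0.
  by move: uv; rewrite /ball_/=; apply: le_lt_trans; exact: dist_minr_le.
apply: cvg_big => [|k _]; first exact: add_continuous.
apply: cvgM; first exact: cvg_cst.
by apply: cvgB; exact: cW.
Qed.

Lemma simple_evalE n r w : (n < sp_size S)%N ->
  sp_time S n < r <= sp_time S n.+1 -> simple_eval S r w = sp_val S n w.
Proof.
move=> nS /andP[nr rn]; rewrite /simple_eval (bigD1 (Ordinal nS))//= nr rn mulr1.
rewrite big1 ?addr0// => k kn; rewrite (_ : (_ && _) = false) ?mulr0//.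
apply/negbTE/negP => /andP[kr rk].
have [{}kn|nk|] := ltngtP k n; last by move=> kE; move/eqP: kn; apply; apply/val_inj.
- by have := lt_le_trans nr (le_trans rk (simple_time_nd kn)); rewrite ltxx.
- by have := lt_le_trans kr (le_trans rn (simple_time_nd nk)); rewrite ltxx.
Qed.

Context (H : R -> Omega -> R) (K : R).
Hypothesis H_progressive : progressive F T H.
Hypothesis H_bound : forall r w, 0 <= r <= T -> `|H r w| <= K.

Let error r w := (simple_eval S r w - H r w) ^+ 2.

Lemma simple_error_measurable w : measurable_fun `[0, T]
  (error ^~ w : measurableTypeR R -> measurableTypeR R).
Proof.
have mD : measurable (`[0, T]%classic `*` setT : set (measurableTypeR R * Omega)).
  by apply: measurableX => //; exact: measurable_itv.
have mpair : measurable_fun `[0, T]%classic (fun r : measurableTypeR R => (r, w)).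
  exact/measurable_funTS/pair2_measurable.
apply: (@measurable_comp _ _ _ _ _ _ (`[0, T]%classic `*` setT)
  (fun u : measurableTypeR R * Omega => error u.1 u.2 : measurableTypeR R) _
  (fun r : measurableTypeR R => (r, w))) => //.
  by move=> _ [r rT <-].
apply: measurable_funX; apply: measurable_funB; last exact: progressive_measurable.
apply: measurable_funTS. exact: simple_eval_measurable.
Qed.

(** The variation is an integral over []s, t]] of the square v^2 of the simple process, and v^2 <= 2
    (v - H)^2 + 2 H^2, which is (v - 2H)^2 >= 0 rearranged. *)
Lemma simple_variation_le s t w : 0 <= s -> s <= t -> t <= T ->
  ((simple_variation S s t w)%:E <=
    2%:E * (\int[@lebesgue_measure R]_(r in `[0%R, T]) (error r w)%:E)
    + (2 * K ^+ 2 * (t - s))%:E)%E.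
Proof.
move=> s0 st tT.
pose a k : R := Num.min (Num.max (sp_time S k) s) t.
have a_ge k : s <= a k <= t.
  by rewrite /a ge_min lexx orbT le_min st le_max lexx orbT.
have a_nd k : a k <= a k.+1.
  by have [_ h _ _] := S_ok; rewrite /a le_min2//; apply: le_max2 => //; exact: h.
pose phi r : \bar R := (2%:E * (error r w)%:E + (2 * K ^+ 2)%:E)%E.
pose mu : {measure set (measurableTypeR R) -> \bar R} := @lebesgue_measure R.
have phi0 r : (0 <= phi r)%E.
  rewrite /phi -EFinM -EFinD lee_fin; apply: addr_ge0.
    by rewrite mulr_ge0// sqr_ge0.
  by rewrite mulr_ge0// sqr_ge0.
have merr D : measurable D -> D `<=` `[0, T]%classic ->
    measurable_fun (D : set (measurableTypeR R)) (fun r => (error r w)%:E).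
  move=> mD DT; apply/measurable_EFinP.
  apply: (measurable_funS _ DT (simple_error_measurable w)).
  exact: measurable_itv.
have mphi D : measurable D -> D `<=` `[0, T]%classic ->
    measurable_fun (D : set (measurableTypeR R)) phi.
  move=> mD DT; apply: emeasurable_funD => //.
  by apply: measurable_funeM; exact: merr.
have subT x y : s <= x -> y <= t -> `]x, y]%classic `<=` (`[0, T]%classic : set R).
  move=> sx yt r /=; rewrite !in_itv/= => /andP[xr ry].
  by rewrite (le_trans s0 (le_trans sx (ltW xr))) (le_trans ry (le_trans yt tT)).
have main n : (n <= sp_size S)%N ->
  ((\sum_(k < n) sp_val S k w ^+ 2 * (a k.+1 - a k))%:E
    <= \int[mu]_(r in `]a 0%N, a n]) phi r)%E.
  elim: n => [_|n IH nS]; first by rewrite big_ord0 integral_ge0.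
  have a0n : a 0%N <= a n.
    by elim: n {IH nS} => // n /le_trans; apply; exact: a_nd.
  rewrite big_ord_recr/= EFinD.
  rewrite (@itv_bndbnd_setU _ _ _ (BRight (a n)))//; try by rewrite bnd_simp.
  have /andP[sa0 _] := a_ge 0%N; have /andP[_ atn] := a_ge n.
  have /andP[san _] := a_ge n; have /andP[_ atS] := a_ge n.+1.
  rewrite ge0_integral_setU//=; last 2 first.
  - rewrite -itv_bndbnd_setU; try by rewrite bnd_simp.
    by apply: mphi; [exact: measurable_itv|exact: subT].
  - apply/disj_setPS => r [] /=; rewrite !in_itv/= => /andP[_ h1] /andP[h2 _].
    by move: (le_lt_trans h1 h2); rewrite ltxx.
  apply: leeD; first exact/IH/ltnW.
  have -> : (sp_val S n w ^+ 2 * (a n.+1 - a n))%:E =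
      (\int[mu]_(r in `]a n, a n.+1]) (cst (sp_val S n w ^+ 2)%:E) r)%E.
    rewrite integral_cst//= /mu lebesgue_measure_itv/= lte_fin.
    have [//|] := ltP (a n) (a n.+1) => h.
    by rewrite mule0 (@le_anti _ _ (a n.+1) (a n)) ?h ?a_nd// subrr mulr0.
  apply: ge0_le_integral_any => r /=; first by rewrite lee_fin sqr_ge0.
  rewrite in_itv/= => /andP[ar ra].
  have rt : a n < t by rewrite (lt_le_trans ar)// (le_trans ra).
  have nr : sp_time S n < r.
    apply: le_lt_trans ar; move: rt; rewrite /a gt_min ltxx orbF => h.
    by rewrite le_min le_max lexx/= (le_trans _ (ltW h))// le_max lexx.
  have rn : r <= sp_time S n.+1.
    move: ra; rewrite /a le_min le_max => /andP[/orP[//|rs] _].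
    by have := lt_le_trans ar rs; rewrite ltNge san.
  have Sr : simple_eval S r w = sp_val S n w by apply: simple_evalE; rewrite ?nr.
  have Hr : `|H r w| <= K.
    apply: H_bound; rewrite (le_trans s0 (le_trans san (ltW ar)))/=.
    exact: le_trans ra (le_trans atS tT).
  have Hr2 : H r w ^+ 2 <= K ^+ 2.
    by rewrite -[leLHS]real_normK ?num_real// lerXn2r ?nnegrE// (le_trans _ Hr).
  rewrite /phi -EFinM -EFinD lee_fin /error Sr.
  have := sqr_ge0 (sp_val S n w - 2 * H r w); lra.
have /andP[sa0 _] := a_ge 0%N; have /andP[_ atn] := a_ge (sp_size S).
rewrite /simple_variation -/a; apply: (le_trans (main _ (leqnn _))).
apply: (@le_trans _ _ (\int[mu]_(r in `]s, t]) phi r)%E).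
  apply: ge0_subset_integral => //; try exact: measurable_itv.
    by apply: mphi; [exact: measurable_itv|exact: subT].
  move=> r /=; rewrite !in_itv/= => /andP[h1 h2].
  by rewrite (le_lt_trans sa0 h1) (le_trans h2 atn).
have mst : measurable (`]s, t]%classic : set (measurableTypeR R)) by exact: measurable_itv.
rewrite /phi ge0_integralD//; last 3 first.
- by move=> r _; rewrite -EFinM lee_fin mulr_ge0// sqr_ge0.
- by apply: measurable_funeM; apply: merr => //; exact: subT.
- by move=> r _; rewrite lee_fin mulr_ge0// sqr_ge0.
rewrite ge0_integralZl_EFin//; last 2 first.
- by move=> r _; rewrite lee_fin sqr_ge0.
- by apply: merr => //; exact: subT.
apply: leeD.
  rewrite lee_pmul2l ?lte_fin//; apply: ge0_subset_integral => //.
  - exact: merr.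
  - by move=> r _; rewrite lee_fin sqr_ge0.
  - exact: subT.
rewrite integral_cst//= /mu lebesgue_measure_itv/= lte_fin.
case: ifPn => // _; rewrite mule0 lee_fin mulr_ge0 ?subr_ge0//.
by rewrite mulr_ge0// sqr_ge0.
Qed.

Lemma simple_error_event_measurable (e : \bar R) : measurable
  [set w | (e < \int[@lebesgue_measure R]_(r in `[0%R, T]) (error r w)%:E)%E].
Proof.
pose f (u : measurableTypeR R * Omega) : \bar R :=
  ((fun u => (error u.1 u.2)%:E) \_ (`[0, T]%classic `*` setT)) u.
have mD : measurable (`[0, T]%classic `*` setT : set (measurableTypeR R * Omega)).
  by apply: measurableX => //; exact: measurable_itv.
have mf : measurable_fun setT f.
  apply/(measurable_restrictT _ mD)/measurable_EFinP.
  apply: measurable_funX; apply: measurable_funB; last exact: progressive_measurable.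
  by apply: measurable_funTS; exact: simple_eval_measurable.
have f0 u : (0 <= f u)%E.
  by rewrite /f patchE; case: ifPn => // _; rewrite lee_fin sqr_ge0.
pose mu : {sigma_finite_measure set (measurableTypeR R) -> \bar R} := @lebesgue_measure R.
have mG := @measurable_fun_fubini_tonelli_G _ _ _ _ R mu f mf f0.
have E w : (\int[@lebesgue_measure R]_(r in `[0%R, T]) (error r w)%:E)%E
    = fubini_G mu f w.
  transitivity (\int[@lebesgue_measure R]_r f (r, w))%E => //.
  rewrite integral_mkcond; apply: eq_integral => r _.
  rewrite /f !patchE; congr (if _ then _ else _).
  by apply/idP/idP; rewrite !inE => // -[].
have := emeasurable_fun_o_infty measurableT mG e; rewrite setTI.
by rewrite (_ : mkset _ = [set w | (e < \int[@lebesgue_measure R]_(r in `[0%R, T])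
  (error r w)%:E)%E])//; apply/seteqP; split=> w /=; rewrite E.
Qed.

End simple.

Lemma uniform_distance_event_measurable (I M : R -> Omega -> R) (e : R) :
  (forall t, 0 <= t <= T -> measurable_fun setT (I t : Omega -> measurableTypeR R)) ->
  (forall t, 0 <= t <= T -> measurable_fun setT (M t : Omega -> measurableTypeR R)) ->
  (forall w, {within `[0, T], continuous (I ^~ w)}) ->
  (forall w, {within `[0, T], continuous (M ^~ w)}) ->
  measurable [set w | exists2 t : R, 0 <= t <= T & e < `|I t w - M t w|].
Proof.
move=> mI mM cI cM.
rewrite [X in measurable X](_ : _ = \bigcup_(q : rat)
    (if 0 <= (ratr q : R) <= T then [set w | e < `|I (ratr q) w - M (ratr q) w|]
     else set0)).
  apply: bigcupT_measurable_rat => q; case: ifPn => // qT.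
  rewrite -[X in measurable X]setTI.
  apply: (@measurable_fun_ltr _ _ _ setT (cst e) (fun w => `|I (ratr q) w - M (ratr q) w|)) => //.
  by apply: measurableT_comp => //; apply: measurable_funB; [exact: mI|exact: mM].
apply/seteqP; split=> w /=.
  move=> h.
  have [|q qT eq] := exists_rational_itv T_gt0 _ h; last by exists q => //; rewrite qT.
  move=> u uT e' e'0.
  have uT' : (`[0, T]%classic : set R) u by rewrite /= in_itv.
  have e2 : 0 < e' / 2 by rewrite divr_gt0.
  have [d1 d10 h1] := within_continuous_dist (@cI w) uT' e2.
  have [d2 d20 h2] := within_continuous_dist (@cM w) uT' e2.
  exists (Num.min d1 d2); first by rewrite lt_min d10.
  move=> v vT; rewrite lt_min => /andP[v1 v2].
  have vT' : (`[0, T]%classic : set R) v by rewrite /= in_itv.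
  apply: (le_lt_trans (ler_dist_dist _ _)).
  have -> : I u w - M u w - (I v w - M v w) = (I u w - I v w) - (M u w - M v w).
    by ring.
  apply: (le_lt_trans (ler_normB _ _)).
  by have := h1 _ vT' v1; have := h2 _ vT' v2; lra.
by move=> [q _]; case: ifPn => // qT h; exists (ratr q).
Qed.

Context (H M : R -> Omega -> R) (K : R).
Hypothesis H_bound : forall r w, 0 <= r <= T -> `|H r w| <= K.
Hypothesis M_ito : ito_integral P F T H W M.

(** Discard the event that the squared L2 error of the integrand exceeds 1 and the event that the
    uniform error of the integral does. Elsewhere the variation is at most 2 + 2 K^2 (t - s), and
    [M] has increments within 2 of the elementary ones, so the exponential is at most [b] times a
    variable of mean 1. On the discarded events the truncation bounds it by [L], while their
    probabilities vanish as n grows with [L] fixed. *)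
Lemma ito_exponential_bound (s t c : R) : 0 <= s -> s <= t -> t <= T ->
  (\int[P]_w (expR (c * (M t w - M s w)))%:E
    <= (expR (2 * `|c| + c ^+ 2 * (K ^+ 2 * (t - s) + 1)))%:E)%E.
Proof.
move=> s0 st tT; set b := expR _.
have [pH cM mM [S [S_ok S_H S_M]]] := M_ito.
have t0 := le_trans s0 st.
have sT : 0 <= s <= T by rewrite s0 (le_trans st).
have tT' : 0 <= t <= T by rewrite t0.
pose bad1 n := [set w | (1%:E < \int[@lebesgue_measure R]_(r in `[0%R, T])
  ((simple_eval (S n) r w - H r w) ^+ 2)%:E)%E].
pose bad2 n := [set w | exists2 u : R, 0 <= u <= T &
  1 < `|simple_integral (S n) W u w - M u w|].
have mbad1 n : measurable (bad1 n) by exact: simple_error_event_measurable.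
have mbad2 n : measurable (bad2 n).
  apply: uniform_distance_event_measurable => //.
  - by move=> u /andP[u0 _]; exact: simple_integral_measurable.
  - move=> w.
    apply: (@continuous_subspaceW R R _ `[0, +oo[%classic (fun u => simple_integral (S n) W u w)); last first.
      exact: simple_integral_continuous.
    by move=> u /=; rewrite !in_itv/= andbT => /andP[].
pose D n w := simple_integral (S n) W t w - simple_integral (S n) W s w.
pose E n w := expR (c * D n w - c ^+ 2 * simple_variation (S n) s t w / 2).
have mE n : measurable_fun setT (E n).
  apply: measurableT_comp => //; apply: measurable_funB.
    apply: measurable_funM => //.
    by apply: measurable_funB; exact: simple_integral_measurable.
  apply: measurable_funM => //; apply: measurable_funM => //.
  apply: measurable_sum => k; apply: measurable_funM => //; apply: measurable_funX.
  have [S0 Snd Sval _] := S_ok n.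
  have Sge0 : 0 <= sp_time (S n) k by rewrite (le_trans S0)//; exact: (simple_time_nd (S_ok n) (leq0n k)).
  by apply: (adapted_measurable Sge0) => B; exact: Sval.
have IE n : (\int[P]_w (E n w)%:E = 1)%E.
  exact: (simple_integral_exponential F_filtration W_adapted W_increment (S_ok n) s0 st c).
have mexp : measurable_fun setT (fun w => expR (c * (M t w - M s w))).
  apply: measurableT_comp => //; apply: measurable_funM => //.
  by apply: measurable_funB; exact: mM.
have b0 : 0 <= b := expR_ge0 _.
apply: ge0_integral_le_truncations => // L.
have pointwise n w : Num.min (expR (c * (M t w - M s w))) L%:R <=
    b * E n w + (L%:R * \1_(bad1 n) w + L%:R * \1_(bad2 n) w).
  have nn : 0 <= b * E n w by rewrite mulr_ge0// expR_ge0.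
  have [w1|w1] := pselect (bad1 n w).
    rewrite (@indicE _ _ (bad1 n)) mem_set// mulr1 ge_min; apply/orP; right.
    have : 0 <= L%:R * \1_(bad2 n) w :> R by rewrite mulr_ge0.
    lra.
  have [w2|w2] := pselect (bad2 n w).
    rewrite (@indicE _ _ (bad2 n)) mem_set// mulr1 ge_min; apply/orP; right.
    have : 0 <= L%:R * \1_(bad1 n) w :> R by rewrite mulr_ge0.
    lra.
  rewrite !indicE !memNset// !mulr0 !addr0 ge_min; apply/orP; left.
  rewrite /b /E -expRD ler_expR.
  have V : simple_variation (S n) s t w <= 2 + 2 * K ^+ 2 * (t - s).
    rewrite -lee_fin; apply: (le_trans (simple_variation_le (S_ok n) pH H_bound w s0 st tT)).
    rewrite [leRHS]EFinD; apply: leeD => //; rewrite -[leRHS]mule1 lee_pmul2l ?lte_fin//.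
    by rewrite leNgt; apply/negP.
  have dist u : 0 <= u <= T -> `|simple_integral (S n) W u w - M u w| <= 1.
    by move=> uT; rewrite leNgt; apply/negP => h; apply: w2; exists u.
  have MD : c * (M t w - M s w) <= c * D n w + 2 * `|c|.
    rewrite -lerBlDl -mulrBr (le_trans (ler_norm _))// normrM mulrC ler_wpM2r//.
    rewrite (_ : _ - _ = (simple_integral (S n) W s w - M s w)
      - (simple_integral (S n) W t w - M t w)); last by rewrite /D; ring.
    rewrite (le_trans (ler_normB _ _))//.
    by rewrite (_ : (2 : R) = 1 + 1)// lerD ?dist.
  have := ler_wpM2l (sqr_ge0 c) V; lra.
have cvgR : (b%:E + (L%:R%:E * P (bad1 n) + L%:R%:E * P (bad2 n)))%E @[n --> \oo]
    --> (b%:E + (L%:R%:E * 0 + L%:R%:E * 0))%E.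
  have c1 : (L%:R%:E * P (bad1 n))%E @[n --> \oo] --> (L%:R%:E * 0)%E.
    by apply: cvgeZl => //; exact: S_H ltr01.
  have c2 : (L%:R%:E * P (bad2 n))%E @[n --> \oo] --> (L%:R%:E * 0)%E.
    by apply: cvgeZl => //; exact: S_M ltr01.
  apply: cvgeD; [by rewrite !mule0 adde0|exact: cvg_cst|].
  by apply: cvgeD => //; rewrite !mule0.
rewrite !mule0 !adde0 in cvgR.
rewrite -(cvg_lim _ cvgR)//; apply: lime_ge; first by apply/cvg_ex; exists b%:E.
apply: nearW => n.
apply: (@le_trans _ _ (\int[P]_w (b%:E * (E n w)%:E + (L%:R%:E * (\1_(bad1 n) w)%:E
    + L%:R%:E * (\1_(bad2 n) w)%:E)))%E).
  apply: ge0_le_integral_any => w _.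
    by rewrite lee_fin le_min expR_ge0 ler0n.
  by rewrite -!EFinM -!EFinD lee_fin.
have mI (A : set Omega) : measurable A ->
    measurable_fun setT (fun w => (\1_A w : R)%:E).
  by move=> mA; apply/measurable_EFinP; exact: measurable_indic.
have L0 : (0 <= L%:R%:E :> \bar R)%E by rewrite lee_fin.
rewrite ge0_integralD//; last 4 first.
- by move=> w _; rewrite -EFinM lee_fin mulr_ge0// expR_ge0.
- by apply: measurable_funeM; exact/measurable_EFinP.
- by move=> w _; rewrite -!EFinM -EFinD lee_fin addr_ge0// mulr_ge0.
- by apply: emeasurable_funD; apply: measurable_funeM; exact: mI.
rewrite ge0_integralD//; last 2 first.
- by apply: measurable_funeM; exact: mI.
- by apply: measurable_funeM; exact: mI.
rewrite !ge0_integralZl_EFin//; try exact: mI; try exact/measurable_EFinP.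
  by rewrite IE mule1 !integral_indic// !setIT.
by move=> w _; rewrite lee_fin; exact: expR_ge0.
Qed.

End ito_exponential.

(** * Uniform moments of dissipative processes *)

(** Convexity of powers in tangent form. Taken at a convex combination it gives the two-point
    inequality below, and at a time average it gives Jensen for integrals. *)
Lemma exprn_tangent (R : realDomainType) (x a : R) m : 0 <= x -> 0 <= a ->
  a ^+ m.+1 + m.+1%:R * a ^+ m * (x - a) <= x ^+ m.+1.
Proof.
move=> x0 a0; elim: m => [|m IH]; first by rewrite !expr1 expr0 !mul1r; lra.
rewrite [leRHS]exprS; apply: (le_trans _ (ler_wpM2l x0 IH)).
rewrite -subr_ge0 [X in 0 <= X](_ : _ = m.+1%:R * a ^+ m * (x - a) ^+ 2).
  by rewrite mulr_ge0 ?sqr_ge0// mulr_ge0// exprn_ge0.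
by rewrite -[m.+2%:R]natr1 !exprS; ring.
Qed.

Lemma exprn_convex (R : realFieldType) (r x y : R) m : 0 <= r <= 1 -> 0 <= x -> 0 <= y ->
  (r * x + (1 - r) * y) ^+ m.+1 <= r * x ^+ m.+1 + (1 - r) * y ^+ m.+1.
Proof.
move=> /andP[r0 r1] x0 y0; have r1' : 0 <= 1 - r by rewrite subr_ge0.
set a := r * x + (1 - r) * y.
have a0 : 0 <= a by rewrite addr_ge0// mulr_ge0.
have hx := ler_wpM2l r0 (exprn_tangent m x0 a0).
have hy := ler_wpM2l r1' (exprn_tangent m y0 a0).
apply: (le_trans _ (lerD hx hy)); rewrite le_eqVlt; apply/orP; left; apply/eqP.
by rewrite /a; ring.
Qed.

Lemma exprnD_le (R : realFieldType) (x y : R) m : 0 <= x -> 0 <= y ->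
  (x + y) ^+ m.+1 <= 2 ^+ m.+1 * (x ^+ m.+1 + y ^+ m.+1).
Proof.
move=> x0 y0; have h2 : 0 <= (2^-1 : R) <= 1 by apply/andP; split; lra.
have := exprn_convex m h2 x0 y0.
have -> : 1 - 2^-1 = 2^-1 :> R by lra.
rewrite -!mulrDr exprMn exprVn.
rewrite -ler_pdivlMl; last by rewrite invr_gt0 exprn_gt0.
rewrite invrK => /le_trans; apply; rewrite ler_wpM2l ?exprn_ge0//.
rewrite ler_piMl ?invf_le1 ?ler1n// addr_ge0// exprn_ge0//.
Qed.

Section real_integrable.
Context d (T : measurableType d) (R : realType) (m : {measure set T -> \bar R}).
Context (D : set T) (mD : measurable D).

Lemma integrableD_EFin (f g : T -> R) : m.-integrable D (EFin \o f) ->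
  m.-integrable D (EFin \o g) -> m.-integrable D (EFin \o (fun x => f x + g x)).
Proof.
move=> If Ig; have := integrableD mD If Ig.
by apply: eq_integrable => // x _; rewrite /= EFinD.
Qed.

Lemma integrableZl_EFin (f : T -> R) a : m.-integrable D (EFin \o f) ->
  m.-integrable D (EFin \o (fun x => a * f x)).
Proof.
move=> If; have := integrableZl mD a If.
by apply: eq_integrable => // x _; rewrite /= EFinM.
Qed.

End real_integrable.

(** * One step of a dissipative equation, path by path *)

Section pathwise.
Context (R : realType) (T lam kappa l C y0 : R) (y alpha n : R -> R).
Hypotheses (lam_ge0 : 0 <= lam) (kappa_ge0 : 0 <= kappa) (l_ge0 : 0 <= l) (C_ge0 : 0 <= C).
Let mu := @lebesgue_measure R.
Hypothesis y_continuous : {within `[0, T], continuous y}.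
Hypothesis n_continuous : {within `[0, T], continuous n}.
Hypothesis alpha_integrable : mu.-integrable `[0, T] (EFin \o alpha).
Hypothesis alpha_bound : forall r, 0 <= r <= T ->
  `|alpha r + lam * kappa * y r| <= lam * (l * `|y r| + C).
Hypothesis y_equation : forall t, 0 <= t <= T ->
  y t = y0 + \int[mu]_(r in `[0, t]) alpha r + n t.

Let Lam := kappa + l.

(** An Euler step. Freezing the linear drift at [y s] yields 1 - lam kappa h, the perturbation adds
    lam l h, and the motion within the window enters only through the integral [J] of |y r - y s|.
    The equation bounds [J] in terms of itself; [small] lets that term be absorbed, leaving the
    second-order correction and the time average of the noise. *)
Lemma dissipative_step s t : 0 <= s -> s < t -> t <= T ->
  lam * Lam * (t - s) <= 2^-1 ->
  `|y t| <= (1 - lam * (kappa - l) * (t - s) + 2 * (lam * Lam * (t - s)) ^+ 2) * `|y s|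
    + 2 * lam * (t - s) * C + `|n t - n s|
    + 2 * (lam * Lam * (t - s)) * ((t - s)^-1 * \int[mu]_(r in `]s, t]) `|n r - n s|).
Proof.
move=> s0 st tT small; set h := t - s; set J := \int[mu]_(r in `]s, t]) `|y r - y s|.
have h0 : 0 < h by rewrite subr_gt0.
have L0 : 0 <= Lam by rewrite addr_ge0.
have subT a b : s <= a -> b <= t -> `]a, b]%classic `<=` (`[0, T]%classic : set R).
  move=> sa bt r /=; rewrite !in_itv/= => /andP[ar rb].
  by rewrite (le_trans s0 (le_trans sa (ltW ar))) (le_trans rb (le_trans bt tT)).
have mitv a b : measurable (`]a, b]%classic : set (measurableTypeR R)) by exact: measurable_itv.
have mT : measurable (`[0, T]%classic : set (measurableTypeR R)) by exact: measurable_itv.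
have sub a b f : s <= a -> b <= t -> mu.-integrable `[0, T] (EFin \o f) ->
    mu.-integrable `]a, b] (EFin \o f).
  by move=> sa bt; apply: integrableS => //; exact: subT.
have cint f : {within `[0, T], continuous f} -> mu.-integrable `[0, T] (EFin \o f).
  by apply: continuous_compact_integrable; exact: segment_compact.
have Iy : mu.-integrable `[0, T] (EFin \o (fun u => `|y u - y s|)).
  apply: cint => u; apply: cvg_norm; apply: cvgB; [exact: y_continuous|exact: cvg_cst].
have In : mu.-integrable `[0, T] (EFin \o (fun u => `|n u - n s|)).
  apply: cint => u; apply: cvg_norm; apply: cvgB; [exact: n_continuous|exact: cvg_cst].
have Icst (c : R) : mu.-integrable `[0, T] (EFin \o (fun=> c)).
  by apply: cint => u; exact: cvg_cst.
have cstE (c : R) : \int[mu]_(r in `]s, t]) c = c * h.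
  rewrite Rintegral_cst//; congr (_ * _).
  have mst : @lebesgue_measure R `]s, t]%classic = h%:E.
    by rewrite lebesgue_measure_itv/= lte_fin st.
  exact: (congr1 fine mst).
have Iphi (a b : R) : mu.-integrable `[0, T] (EFin \o (fun u => a * `|y u - y s| + b)).
  by apply: integrableD_EFin => //; apply: integrableZl_EFin.
have phiE (a b : R) : \int[mu]_(r in `]s, t]) (a * `|y r - y s| + b) = a * J + b * h.
  rewrite RintegralD//; last 2 first.
  - by apply: sub => //; exact: integrableZl_EFin.
  - exact: sub (Icst b).
  rewrite cstE RintegralZl//; exact: sub Iy.
have bound g a b r : s <= r <= t -> 0 <= a -> 0 <= b ->
    mu.-integrable `[0, T] (EFin \o g) ->
    (forall u, s < u <= t -> `|g u| <= a * `|y u - y s| + b) ->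
    `|\int[mu]_(u in `]s, r]) g u| <= a * J + b * h.
  move=> /andP[sr rt] a0 b0 Ig gb.
  apply: (le_trans (le_normr_Rintegral _ _)) => //; first exact: sub Ig.
  rewrite -phiE.
  apply: (@le_trans _ _ (\int[mu]_(u in `]s, r]) (a * `|y u - y s| + b))).
    apply: le_Rintegral => //.
    - apply: sub => //; exact: integrable_norm Ig.
    - exact: sub (Iphi a b).
    - by move=> u /=; rewrite in_itv/= => /andP[su ur]; apply: gb; rewrite su (le_trans ur).
  rewrite [leRHS](_ : _ = \int[mu]_(u in `]s, r] `|` `]r, t]) (a * `|y u - y s| + b)).
    rewrite Rintegral_setU//.
    - rewrite lerDl; apply: Rintegral_ge0 => u _.
      by rewrite addr_ge0// mulr_ge0.
    - rewrite -itv_bndbnd_setU ?bnd_simp//; exact: sub (Iphi a b).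
    - apply/disj_setPS => u [] /=; rewrite !in_itv/= => /andP[_ h1] /andP[h2 _].
      by move: (le_lt_trans h1 h2); rewrite ltxx.
  by rewrite -itv_bndbnd_setU ?bnd_simp.
have ys r : s <= r <= t -> y r = y s + \int[mu]_(u in `]s, r]) alpha u + (n r - n s).
  move=> /andP[sr rt].
  have := @Rintegral_itvB _ alpha (BLeft 0) (BRight r) s.
  rewrite !bnd_simp => <-//; last first.
    apply: integrableS alpha_integrable => //.
    by apply: subset_itvl; rewrite bnd_simp (le_trans rt).
  rewrite (y_equation (t := s)) ?s0 ?(le_trans (ltW st))//.
  rewrite (y_equation (t := r)) ?(le_trans s0 sr) ?(le_trans rt)//.
  by ring.
have st' : s <= t <= t by rewrite (ltW st) lexx.
have yus u : `|y u| <= `|y u - y s| + `|y s|.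
  by rewrite -[in leLHS](subrK (y s) (y u)) ler_normD.
(* The drift is bounded here in absolute value, its sign being lost. This is harmless because [J]
   carries a further factor lam Lam in [step3], where the sign is kept. *)
have step1 r : s <= r <= t ->
    `|y r - y s| <= lam * Lam * J + lam * (Lam * `|y s| + C) * h + `|n r - n s|.
  move=> rst; have -> : y r - y s = \int[mu]_(u in `]s, r]) alpha u + (n r - n s).
    by rewrite (ys r rst); ring.
  rewrite (le_trans (ler_normD _ _))// lerD2r.
  apply: bound => //.
  - by rewrite mulr_ge0.
  - by rewrite mulr_ge0// addr_ge0// mulr_ge0.
  move=> u /andP[su ut].
  have uT : 0 <= u <= T by rewrite (le_trans s0 (ltW su)) (le_trans ut).
  have h1 : `|alpha u| <= lam * (l * `|y u| + C) + lam * kappa * `|y u|.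
    rewrite -[in leLHS](addrK (lam * kappa * y u) (alpha u)).
    rewrite (le_trans (ler_normB _ _))// lerD ?alpha_bound//.
    by rewrite !normrM (ger0_norm lam_ge0) (ger0_norm kappa_ge0).
  apply: (le_trans h1).
  have -> : lam * (l * `|y u| + C) + lam * kappa * `|y u| = lam * (Lam * `|y u| + C).
    by rewrite /Lam; ring.
  rewrite (_ : lam * Lam * _ + _ = lam * (Lam * (`|y u - y s| + `|y s|) + C)); last by ring.
  by rewrite ler_wpM2l// lerD2r ler_wpM2l.
have J0 : 0 <= J by apply: Rintegral_ge0.
pose I := \int[mu]_(r in `]s, t]) `|n r - n s|.
have I0 : 0 <= I by apply: Rintegral_ge0.
have step2 : J <= (lam * Lam * J + lam * (Lam * `|y s| + C) * h) * h + I.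
  rewrite -cstE -RintegralD//; [|exact: sub (Icst _)|exact: sub In].
  apply: le_Rintegral => //; first exact: sub Iy.
    by apply: sub => //; exact: integrableD_EFin.
  move=> u /=; rewrite in_itv/= => /andP[su ut]; apply: step1.
  by rewrite (ltW su).
have step3 : `|y t| <= (1 - lam * kappa * h) * `|y s|
    + (lam * Lam * J + lam * (l * `|y s| + C) * h) + `|n t - n s|.
  have Ib : mu.-integrable `[0, T] (EFin \o (fun u => alpha u + lam * kappa * y s)).
    exact: integrableD_EFin.
  have yt : y t = (1 - lam * kappa * h) * y s
      + \int[mu]_(u in `]s, t]) (alpha u + lam * kappa * y s) + (n t - n s).
    rewrite RintegralD//; [|exact: sub alpha_integrable|exact: sub (Icst _)].
    by rewrite cstE (ys t st'); ring.
  rewrite {1}yt (le_trans (ler_normD _ _))// lerD2r (le_trans (ler_normD _ _))// lerD//.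
    rewrite normrM ger0_norm// subr_ge0 (le_trans _ (le_trans small _))//; last by lra.
    by rewrite ler_wpM2r ?(ltW h0)// ler_wpM2l// lerDl.
  apply: bound => //.
  - by rewrite mulr_ge0.
  - by rewrite mulr_ge0// addr_ge0// mulr_ge0.
  move=> u /andP[su ut].
  have uT : 0 <= u <= T by rewrite (le_trans s0 (ltW su)) (le_trans ut).
  rewrite (_ : alpha u + _ = (alpha u + lam * kappa * y u) - lam * kappa * (y u - y s)); last by ring.
  rewrite (le_trans (ler_normB _ _))// normrM (ger0_norm (_ : 0 <= lam * kappa)) ?mulr_ge0//.
  apply: (le_trans (lerD (alpha_bound uT) (lexx _))).
  rewrite (_ : lam * Lam * _ + _ =
    lam * (l * (`|y u - y s| + `|y s|) + C) + lam * kappa * `|y u - y s|); last by rewrite /Lam; ring.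
  by rewrite lerD2r ler_wpM2l// lerD2r ler_wpM2l.
rewrite -/h -/I in small *.
have -> : 2 * (lam * Lam * h) * (h^-1 * I) = 2 * (lam * Lam) * I.
  by field; rewrite gt_eqF.
set del := lam * Lam * h in small *.
have d0 : 0 <= del by rewrite mulr_ge0 ?mulr_ge0// ltW.
have ys0 := normr_ge0 (y s).
(* The coefficient of [J] on the right of [step2] is [del <= 1/2], so half of [J] moves to the left;
   hence the factor 2. *)
have J2 : J <= 2 * (lam * (Lam * `|y s| + C) * h * h + I).
  have : del * J <= 2^-1 * J by rewrite ler_wpM2r.
  have -> : del * J = lam * Lam * J * h by rewrite /del; ring.
  by move: step2; rewrite mulrDl; lra.
have J3 : lam * Lam * J <= 2 * del ^+ 2 * `|y s| + 2 * del * (lam * h * C) + 2 * (lam * Lam) * I.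
  apply: (le_trans (ler_wpM2l (mulr_ge0 lam_ge0 L0) J2)).
  by rewrite le_eqVlt; apply/orP; left; apply/eqP; rewrite /del; ring.
have J4 : 2 * del * (lam * h * C) <= lam * h * C.
  rewrite ler_piMl ?mulr_ge0 ?(ltW h0)//; lra.
apply: (le_trans step3).
rewrite (_ : lam * (l * `|y s| + C) * h = lam * l * h * `|y s| + lam * h * C); last by ring.
rewrite (_ : (1 - lam * (kappa - l) * h + 2 * del ^+ 2) * `|y s|
  = (1 - lam * kappa * h) * `|y s| + lam * l * h * `|y s| + 2 * del ^+ 2 * `|y s|); last by ring.
rewrite (_ : 2 * lam * h * C = 2 * (lam * h * C)); last by ring.
lra.
Qed.

End pathwise.

Lemma normr_exprn_le_expR (R : realType) (x : R) m :
  `|x| ^+ m <= m`!%:R * (expR x + expR (- x)).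
Proof.
have H : `|x| ^+ m <= m`!%:R * expR `|x|.
  case: m => [|m]; first by rewrite expr0 fact0 mul1r -expR0 ler_expR.
  have f0 : 0 < (m.+1`!%:R : R) by rewrite ltr0n fact_gt0.
  rewrite -ler_pdivrMl// mulrC; apply: le_trans _ (expR_ge1Dxn m (normr_ge0 x)).
  by rewrite lerDr.
apply: (le_trans H); rewrite ler_wpM2l//.
by have [x0|x0] := ger0P x; rewrite ?lerDl ?lerDr expR_ge0.
Qed.

Definition scalar_brownian (R : realType) d (Omega : measurableType d)
    (P : probability Omega R) (F : R -> set (set Omega)) (W : R -> Omega -> R) :=
  [/\ forall t (B : set (measurableTypeR R)), 0 <= t -> measurable B -> F t (W t @^-1` B),
      forall (s t : R) A (B : set (measurableTypeR R)),
        0 <= s -> s < t -> F s A -> measurable B ->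
        (P (A `&` [set w | B (W t w - W s w)%R])
          = P A * normal_prob 0 (Num.sqrt (t - s)%R) B)%E &
      forall w, {within `[0, +oo[, continuous (W ^~ w)}].

Section ito_moments.
Context (R : realType) d (Omega : measurableType d) (P : probability Omega R).
Context (F : R -> set (set Omega)) (W : R -> Omega -> R) (T : R).
Hypotheses (T_gt0 : 0 < T) (F_filtration : filtration F).
Hypothesis W_brownian : scalar_brownian P F W.
Context (H M : R -> Omega -> R) (K : R).
Hypothesis H_bound : forall r w, 0 <= r <= T -> `|H r w| <= K.
Hypothesis M_ito : ito_integral P F T H W M.

Let mM t : 0 <= t <= T -> measurable_fun setT (M t : Omega -> measurableTypeR R).
Proof. by case: M_ito => _ _ h _; exact: h. Qed.

(** A power is dominated by m! times exp(x) + exp(-x), and the exponential bound is used with c = 1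
    and c = -1. The 3 in the exponent is 2 |c| + c^2. *)
Lemma ito_increment_moment (s t : R) m : 0 <= s -> s <= t -> t <= T ->
  (\int[P]_w (`|M t w - M s w| ^+ m)%:E
    <= (m`!%:R * (2 * expR (3 + K ^+ 2 * (t - s))))%:E)%E.
Proof.
move=> s0 st tT; have [Wa Wi Wc] := W_brownian.
have mD : measurable_fun setT (fun w => M t w - M s w : measurableTypeR R).
  by apply: measurable_funB; apply: mM; rewrite ?s0 ?(le_trans st)// (le_trans s0).
have b c : `|c| = 1 -> (\int[P]_w (expR (c * (M t w - M s w)))%:E
    <= (expR (3 + K ^+ 2 * (t - s)))%:E)%E.
  move=> c1; have := ito_exponential_bound T_gt0 F_filtration Wa Wi Wc H_bound M_ito c s0 st tT.
  rewrite -[c ^+ 2]real_normK ?num_real// c1 expr1n.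
  by rewrite (_ : 2 * 1 + _ = 3 + K ^+ 2 * (t - s))//; ring.
have me c : measurable_fun setT (fun w => (expR (c * (M t w - M s w)))%:E).
  by apply/measurable_EFinP; apply: measurableT_comp => //; exact: measurable_funM.
apply: (@le_trans _ _ (\int[P]_w (m`!%:R%:E * ((expR (1 * (M t w - M s w)))%:E
    + (expR (-1 * (M t w - M s w)))%:E)))%E).
  apply: ge0_le_integral_any => w _; first by rewrite lee_fin exprn_ge0.
  by rewrite -EFinD -EFinM lee_fin mul1r mulN1r normr_exprn_le_expR.
rewrite ge0_integralZl_EFin//; last 2 first.
- by move=> w _; rewrite -EFinD lee_fin addr_ge0// expR_ge0.
- by apply: emeasurable_funD.
rewrite EFinM lee_pmul2l ?lte_fin ?ltr0n ?fact_gt0//.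
rewrite ge0_integralD//.
rewrite (_ : (2 * _)%:E = (expR (3 + K ^+ 2 * (t - s)))%:E
    + (expR (3 + K ^+ 2 * (t - s)))%:E)%E; last by rewrite -EFinD; congr EFin; ring.
by apply: leeD; apply: b; rewrite ?normrN normr1.
Qed.

(** The definition of the Ito integral does not impose the value at 0. Elementary integrals vanish
    there, and uniform convergence in probability carries this to [M], first for each threshold and
    then along 1/(k+1). *)
Lemma ito_integral_start : {ae P, forall w, M 0 w = 0}.
Proof.
have [Wa Wi Wc] := W_brownian.
have T00 : (0 : R) <= 0 <= T by rewrite lexx ltW.
have [_ cM _ [S [S_ok _ S_M]]] := M_ito.
have m0 (e : R) : measurable [set w | e < `|M 0 w|].
  rewrite -[X in measurable X]setTI.
  apply: (@measurable_fun_ltr _ _ _ setT (cst e) (fun w => `|M 0 w|)) => //.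
  by apply: measurableT_comp => //; exact: mM.
have P0 (e : R) : 0 < e -> P [set w | e < `|M 0 w|] = 0%E.
  move=> e0; apply/eqP; rewrite eq_le measure_ge0 andbT.
  have c0 := S_M e e0; rewrite -(cvg_lim _ c0)//.
  apply: lime_ge; first by apply/cvg_ex; exists 0%E.
  apply: nearW => n; apply: le_measure; rewrite ?inE//.
    apply: uniform_distance_event_measurable => //.
    - by move=> u /andP[u0 _]; exact: (simple_integral_measurable F_filtration Wa (S_ok n)).
    - move=> w.
      apply: (@continuous_subspaceW R R _ `[0, +oo[%classic (fun u => simple_integral (S n) W u w)); last first.
        exact: (simple_integral_continuous Wc (S_ok n)).
      by move=> u /=; rewrite !in_itv/= andbT => /andP[].
  move=> w /= eM; exists 0 => //; rewrite /simple_integral big1 ?sub0r ?normrN// => k _.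
  have S0 j : 0 <= sp_time (S n) j.
    have [S00 _ _ _] := S_ok n.
    by rewrite (le_trans S00)//; exact: (simple_time_nd (S_ok n) (leq0n j)).
  by rewrite !min_l// subrr mulr0.
apply: (@negligibleS _ _ _ _ (\bigcup_k [set w | k.+1%:R^-1 < `|M 0 w|])).
  move=> w /= Mw; have M0 : 0 < `|M 0 w| by rewrite normr_gt0; exact/eqP.
  have [k _ hk] := near_infty_natSinv_lt (PosNum M0).
  by exists k => //=; apply: (hk k) => /=.
apply: negligible_bigcup => k.
by apply/negligibleP => //; apply: P0; rewrite invr_gt0.
Qed.

End ito_moments.

(** * Moments of the time average of the noise *)

Section time_average.
Context (R : realType) d (Omega : measurableType d) (P : probability Omega R).
Context (Z : R -> Omega -> R) (s t : R).
Hypothesis st : s < t.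
Hypothesis mZ : forall r, s <= r <= t ->
  measurable_fun setT (Z r : Omega -> measurableTypeR R).
Hypothesis cZ : forall w, {within `[s, t], continuous (Z ^~ w)}.

(** [Z] is controlled only for times in [[s, t]]. Composed with [clamp] it is continuous in time on
    the whole line, so the Caratheodory lemma gives the joint measurability that Tonelli
    requires. *)
Let clamp (r : R) := Num.min (Num.max r s) t.

Let clamp_itv r : s <= clamp r <= t.
Proof. by rewrite /clamp ge_min lexx orbT le_min le_max lexx orbT (ltW st). Qed.

Let clampE r : s <= r <= t -> clamp r = r.
Proof. by move=> /andP[sr rt]; rewrite /clamp max_l// min_l. Qed.

Let clamp_dist u v : `|clamp u - clamp v| <= `|u - v|.
Proof.
apply: (le_trans (dist_minr_le _ _ _)).
have E (r : R) : Num.max r s = - Num.min (- r) (- s) by rewrite -oppr_max opprK.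
rewrite !E -opprD normrN; apply: (le_trans (dist_minr_le _ _ _)).
by rewrite -opprD normrN.
Qed.

Let mZc : measurable_fun setT
  (fun u : Omega * measurableTypeR R => Z (clamp u.2) u.1 : measurableTypeR R).
Proof.
apply: (@measurable_caratheodory _ Omega R (fun w r => Z (clamp r) w)) => [r|w r].
  exact: mZ.
apply/cvgrPdist_lt => e e0.
have cr : (`[s, t]%classic : set R) (clamp r).
  by rewrite /= in_itv; exact: clamp_itv.
have [del del0 h] := within_continuous_dist (@cZ w) cr e0.
exists del => // v rv; apply: h; first by rewrite /= in_itv; exact: clamp_itv.
exact: le_lt_trans (clamp_dist _ _) rv.
Qed.

Let f m (u : Omega * measurableTypeR R) : \bar R :=
  (`|Z (clamp u.2) u.1| ^+ m * \1_(`]s, t]%classic) u.2)%:E.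

Let mf m : measurable_fun setT (f m).
Proof.
apply/measurable_EFinP; apply: measurable_funM.
  by apply: measurable_funX; exact: measurableT_comp mZc.
rewrite (_ : (fun u => _) = \1_(setT `*` `]s, t]%classic)).
  by apply: measurable_indic; apply: measurableX => //; exact: measurable_itv.
apply/funext => u; rewrite !indicE; congr (nat_of_bool _)%:R.
by apply/idP/idP; rewrite !inE => // -[].
Qed.

Let f_ge0 m u : (0 <= f m u)%E.
Proof. by rewrite lee_fin mulr_ge0// exprn_ge0. Qed.

Let mu : {sigma_finite_measure set (measurableTypeR R) -> \bar R} := @lebesgue_measure R.

Let integral_f m w : (\int[mu]_r f m (w, r) =
  \int[@lebesgue_measure R]_(r in `]s, t]) (`|Z r w| ^+ m)%:E)%E.
Proof.
rewrite [RHS]integral_mkcond; apply: eq_integral => r _.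
rewrite /f patchE indicE; case: ifPn; last by rewrite mulr0.
by rewrite inE/= in_itv/= => /andP[sr rt]; rewrite mulr1 clampE// rt ltW.
Qed.

Definition time_average w : R :=
  (t - s)^-1 * \int[@lebesgue_measure R]_(r in `]s, t]) `|Z r w|.

Lemma time_average_measurable :
  measurable_fun setT (time_average : Omega -> measurableTypeR R).
Proof.
apply: measurable_funM => //.
rewrite (_ : (fun w => _) = fine \o (fubini_F mu (f 1))); last first.
  apply/funext => w; rewrite /= /fubini_F integral_f /Rintegral.
  by under [in RHS]eq_integral do rewrite expr1.
apply: measurableT_comp; first exact: fine_measurable.
exact: measurable_fun_fubini_tonelli_F.
Qed.

Lemma time_average_ge0 w : 0 <= time_average w.
Proof.
by rewrite mulr_ge0 ?invr_ge0 ?subr_ge0 ?(ltW st)//; apply: Rintegral_ge0.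
Qed.

Let integrable_pow m w :
  (@lebesgue_measure R).-integrable `]s, t] (EFin \o (fun r => `|Z r w| ^+ m)).
Proof.
have : (@lebesgue_measure R).-integrable `[s, t] (EFin \o (fun r => `|Z r w| ^+ m)).
  apply: continuous_compact_integrable; first exact: segment_compact.
  have cn : {within `[s, t], continuous (fun r => `|Z r w|)}.
    by move=> r; apply: cvg_norm; exact: cZ.
  elim: m => [|m IH] r.
    by rewrite (_ : (fun r => _) = (fun=> 1)); [exact: cvg_cst|apply/funext => ?; rewrite expr0].
  rewrite (_ : (fun r => _) = (fun r => `|Z r w| * `|Z r w| ^+ m)).
    by apply: cvgM; [exact: cn|exact: IH].
  by apply/funext => u; rewrite exprS.
by apply: integrableS => // r /=; rewrite !in_itv/= => /andP[/ltW -> ->].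
Qed.

Let length_st : \int[@lebesgue_measure R]_(r in `]s, t]) (1 : R) = t - s.
Proof.
rewrite Rintegral_cst// mul1r.
have mst : @lebesgue_measure R `]s, t]%classic = (t - s)%:E.
  by rewrite lebesgue_measure_itv/= lte_fin st.
exact: (congr1 fine mst).
Qed.

Lemma time_average_exprn m w : ((time_average w ^+ m.+1)%:E <=
  (t - s)^-1%:E * \int[mu]_r f m.+1 (w, r))%E.
Proof.
set A := time_average w; have A0 : 0 <= A := time_average_ge0 w.
have h0 : 0 < t - s by rewrite subr_gt0.
have mst : measurable (`]s, t]%classic : set (measurableTypeR R)) by exact: measurable_itv.
have Ic (c : R) : (@lebesgue_measure R).-integrable `]s, t] (EFin \o (fun=> c)).
  have := integrableZl_EFin mst c (integrable_pow 0 w).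
  by apply: eq_integrable => // r _; rewrite /= expr0 mulr1.
have I1 : (@lebesgue_measure R).-integrable `]s, t] (EFin \o (fun r => `|Z r w|)).
  have := integrable_pow 1 w.
  by apply: eq_integrable => // r _; rewrite /= expr1.
rewrite integral_f -[X in (_ * X)%E]fineK; last exact: integrable_fin_num (integrable_pow _ _).
rewrite -/(Rintegral _ _ _) -EFinM lee_fin mulrC ler_pdivlMr//.
(* The line a + b x is the tangent to x^(m+1) at the average [A]. Its integral over the window is (t
   - s) A^(m+1), as the linear part cancels. *)
pose a := A ^+ m.+1 - m.+1%:R * A ^+ m * A; pose b := m.+1%:R * A ^+ m.
apply: (@le_trans _ _ (\int[@lebesgue_measure R]_(r in `]s, t]) (a + b * `|Z r w|))).
  rewrite RintegralD//; last exact: integrableZl_EFin.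
  rewrite RintegralZl//.
  have -> : \int[@lebesgue_measure R]_(r in `]s, t]) `|Z r w| = (t - s) * A.
    by rewrite /A /time_average mulrA divff ?gt_eqF// mul1r.
  have -> : \int[@lebesgue_measure R]_(r in `]s, t]) a = a * (t - s).
    by rewrite -length_st -RintegralZl//; under [RHS]eq_Rintegral do rewrite mulr1.
  by rewrite le_eqVlt; apply/orP; left; apply/eqP; rewrite /a /b; ring.
apply: le_Rintegral => //.
- by apply: integrableD_EFin => //; exact: integrableZl_EFin.
- move=> r _; apply: (le_trans _ (exprn_tangent m (normr_ge0 (Z r w)) A0)).
  by rewrite le_eqVlt; apply/orP; left; apply/eqP; rewrite /a /b; ring.
Qed.

Lemma time_average_moment m (b : R) : 
  (forall r, s <= r <= t -> (\int[P]_w (`|Z r w| ^+ m.+1)%:E <= b%:E)%E) ->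
  (\int[P]_w (time_average w ^+ m.+1)%:E <= b%:E)%E.
Proof.
move=> Zb; have h0 : 0 < t - s by rewrite subr_gt0.
apply: (@le_trans _ _ (\int[P]_w ((t - s)^-1%:E * \int[mu]_r f m.+1 (w, r)))%E).
  apply: ge0_le_integral_any => w _; last exact: time_average_exprn.
  by rewrite lee_fin exprn_ge0// time_average_ge0.
rewrite ge0_integralZl_EFin//; last 3 first.
- by move=> w _; apply: integral_ge0 => r _; exact: f_ge0.
- exact: measurable_fun_fubini_tonelli_F.
- by rewrite invr_ge0 ltW.
rewrite fubini_tonelli//.
apply: (@le_trans _ _ ((t - s)^-1%:E * \int[mu]_(r in `]s, t]) (cst b%:E r))%E).
  rewrite lee_pmul2l ?lte_fin ?invr_gt0//.
  rewrite [leRHS]integral_mkcond; apply: ge0_le_integral_any => r _.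
    by apply: integral_ge0 => w _; exact: f_ge0.
  rewrite patchE; case: ifPn => [|rst].
    rewrite inE/= in_itv/= => /andP[sr rt].
    have rst : s <= r <= t by rewrite rt ltW.
    apply: le_trans (Zb r rst); rewrite le_eqVlt; apply/orP; left; apply/eqP.
    apply: eq_integral => w _.
    by rewrite /f/= clampE// indicE mem_set ?mulr1//= in_itv/= sr.
  rewrite integral0_eq// => w _.
  by rewrite /f/= indicE (negbTE rst) mulr0.
rewrite integral_cst; last exact: measurable_itv.
have mst : @lebesgue_measure R `]s, t]%classic = (t - s)%:E.
  by rewrite lebesgue_measure_itv/= lte_fin st.
rewrite (_ : (b%:E * _)%E = (b * (t - s))%:E); last by rewrite EFinM; congr (_ * _)%E.
by rewrite -EFinM lee_fin mulrCA mulVf ?mulr1// gt_eqF.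
Qed.

End time_average.

(** * Moment recursion over short time windows *)

Section uniform_moment.
Context (R : realType) d (Omega : measurableType d) (P : probability Omega R).
Context (F : R -> set (set Omega)) (T : R).
Hypotheses (T_gt0 : 0 < T) (F_filtration : filtration F).
Context (W H M : bool -> R -> Omega -> R) (K : R).
Hypothesis W_brownian : forall j, scalar_brownian P F (W j).
Hypothesis H_bound : forall j r w, 0 <= r <= T -> `|H j r w| <= K.
Hypothesis M_ito : forall j, ito_integral P F T (H j) (W j) (M j).
Context (Y alpha : R -> Omega -> R) (y0 lam kappa l C : R).
Hypotheses (lam_gt0 : 0 < lam) (l_ge0 : 0 <= l) (l_kappa : l < kappa) (C_ge0 : 0 <= C).
Hypothesis Y_measurable : forall t, 0 <= t <= T ->
  measurable_fun setT (Y t : Omega -> measurableTypeR R).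
Hypothesis Y_continuous : forall w, {within `[0, T], continuous (Y ^~ w)}.
Hypothesis alpha_integrable : {ae P, forall w,
  (@lebesgue_measure R).-integrable `[0, T] (EFin \o alpha ^~ w)}.
Hypothesis alpha_bound : forall r w, 0 <= r <= T ->
  `|alpha r w + lam * kappa * Y r w| <= lam * (l * `|Y r w| + C).
Hypothesis Y_equation : {ae P, forall w, forall t, 0 <= t <= T ->
  Y t w = y0 + \int[@lebesgue_measure R]_(r in `[0, t]) alpha r w
    + \sum_j M j t w}.
Context (del k0 : R) (m : nat).
Hypotheses (del_gt0 : 0 < del) (del_small : del * (kappa + l) <= 2^-1)
  (del_small2 : 2 * (kappa + l) ^+ 2 * del <= (kappa - l) / 2).
Hypothesis K_k0 : K ^+ 2 * (del / lam) <= k0.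

(** Half of the dissipation rate. By [del_small2] the other half pays for the second-order term of
    the pathwise step. *)
Let theta := (kappa - l) / 2.

(** There are two stochastic integrals, separated at the cost 2^(m+1); [k0] bounds K^2 (t - s) over
    one window. *)
Definition noise_moment : R :=
  2 ^+ m.+1 * (2 * (m.+1`!%:R * (2 * expR (3 + k0)))).

Definition step_moment : R :=
  2 ^+ m.+1 * ((2 * del * C) ^+ m.+1 + 2 ^+ m.+1 * (2 * noise_moment)).

(** The first summand covers the initial window. With r = [theta * del], the second is the fixed
    point of b = (1 - r) b + r r^-(m+1) [step_moment], the recursion from one window to the next. *)
Definition uniform_moment_bound : R :=
  2 ^+ m.+1 * (`|y0| ^+ m.+1 + step_moment) + (theta * del)^-1 ^+ m.+1 * step_moment.

Let mM j t : 0 <= t <= T -> measurable_fun setT (M j t : Omega -> measurableTypeR R).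
Proof. by case: (M_ito j) => _ _ h _; exact: h. Qed.

Let cM j w : {within `[0, T], continuous (M j ^~ w)}.
Proof. by case: (M_ito j) => _ h _ _; exact: h. Qed.

Let n t w := \sum_j M j t w.

Let nE t w : n t w = M true t w + M false t w.
Proof. by rewrite /n big_bool. Qed.

Let noise_moment_le s t : 0 <= s -> s <= t -> t <= T -> t - s <= del / lam ->
  (\int[P]_w (`|n t w - n s w| ^+ m.+1)%:E <= noise_moment%:E)%E.
Proof.
move=> s0 st tT ts.
have t0 := le_trans s0 st; have sT := le_trans st tT.
pose b := m.+1`!%:R * (2 * expR (3 + k0)) : R.
have Mb j : (\int[P]_w (`|M j t w - M j s w| ^+ m.+1)%:E <= b%:E)%E.
  apply: (le_trans (ito_increment_moment T_gt0 F_filtration (W_brownian j)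
    (@H_bound j) (M_ito j) m.+1 s0 st tT)).
  rewrite lee_fin !ler_wpM2l// ler_expR lerD2l.
  by apply: le_trans K_k0; rewrite ler_wpM2l// sqr_ge0.
have mD j : measurable_fun setT (fun w => (`|M j t w - M j s w| ^+ m.+1)%:E).
  apply/measurable_EFinP; apply: measurable_funX; apply: measurableT_comp => //.
  by apply: measurable_funB; apply: mM; rewrite ?s0 ?t0.
apply: (@le_trans _ _ (\int[P]_w ((2 ^+ m.+1)%:E * ((`|M true t w - M true s w| ^+ m.+1)%:E
    + (`|M false t w - M false s w| ^+ m.+1)%:E)))%E).
  apply: ge0_le_integral_any => w _; first by rewrite lee_fin exprn_ge0.
  rewrite -EFinD -EFinM lee_fin; apply: le_trans (exprnD_le _ _ _) => //.
  rewrite lerXn2r ?nnegrE ?addr_ge0// !nE opprD addrACA.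
  exact: ler_normD.
rewrite ge0_integralZl_EFin//; last 2 first.
- by move=> w _; rewrite -EFinD lee_fin addr_ge0// exprn_ge0.
- exact: emeasurable_funD.
rewrite /noise_moment EFinM lee_pmul2l ?lte_fin ?exprn_gt0//.
rewrite ge0_integralD//.
by rewrite mulr2n mulrDl mul1r EFinD; apply: leeD; exact: Mb.
Qed.

Let noise_moment_ge0 : 0 <= noise_moment.
Proof. by rewrite /noise_moment !mulr_ge0 ?exprn_ge0 ?expR_ge0. Qed.

Let step_moment_ge0 : 0 <= step_moment.
Proof.
by rewrite /step_moment mulr_ge0 ?exprn_ge0// addr_ge0 ?exprn_ge0 ?mulr_ge0 ?exprn_ge0// ltW.
Qed.

Lemma one_step s t : 0 <= s -> s < t -> t <= T -> t - s <= del / lam ->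
  exists xi : Omega -> measurableTypeR R,
  [/\ measurable_fun setT xi, forall w, 0 <= xi w,
      (\int[P]_w (xi w ^+ m.+1)%:E <= step_moment%:E)%E &
      {ae P, forall w, `|Y t w| <= (1 - theta * (lam * (t - s))) * `|Y s w| + xi w}].
Proof.
move=> s0 st tT ts.
have t0 : 0 <= t := le_trans s0 (ltW st).
pose Z r w := n r w - n s w.
have subT r : s <= r <= t -> 0 <= r <= T.
  by move=> /andP[sr rt]; rewrite (le_trans s0 sr) (le_trans rt tT).
have sT : 0 <= s <= T by rewrite s0 (le_trans (ltW st)).
have mn r : 0 <= r <= T -> measurable_fun setT (n r : Omega -> measurableTypeR R).
  move=> rT; rewrite (_ : n r = (fun w => M true r w + M false r w)).
    by apply: measurable_funD; exact: mM.
  by apply/funext => w; exact: nE.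
have cn w : {within `[0, T], continuous (n ^~ w)}.
  rewrite (_ : n ^~ w = (fun r => M true r w + M false r w)).
    by move=> r; apply: cvgD; exact: cM.
  by apply/funext => r; exact: nE.
have mZ r : s <= r <= t -> measurable_fun setT (Z r : Omega -> measurableTypeR R).
  by move=> rst; apply: measurable_funB; apply: mn => //; exact: subT.
have cZ w : {within `[s, t], continuous (Z ^~ w)}.
  apply: (@continuous_subspaceW R R _ `[0, T]%classic).
    by move=> r /=; rewrite !in_itv/=; exact: subT.
  by move=> r; apply: cvgB; [exact: cn|exact: cvg_cst].
pose A := time_average Z s t.
have mA : measurable_fun setT (A : _ -> measurableTypeR R) by exact: time_average_measurable.
have A0 w : 0 <= A w by exact: time_average_ge0.
have Zt : s <= t <= t by rewrite (ltW st) lexx.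
have Zb r : s <= r <= t -> (\int[P]_w (`|Z r w| ^+ m.+1)%:E <= noise_moment%:E)%E.
  move=> /andP[sr rt]; apply: noise_moment_le => //; first exact: le_trans tT.
  by apply: le_trans ts; rewrite lerD2r.
have Ab : (\int[P]_w (A w ^+ m.+1)%:E <= noise_moment%:E)%E by exact: time_average_moment.
pose c0 := 2 * del * C.
have c00 : 0 <= c0 by rewrite !mulr_ge0// ltW.
(* As lam (t - s) <= del, the constant part of the drift contributes at most [c0], and the time
   average [A] has weight at most 1. *)
exists (fun w => c0 + (`|Z t w| + A w)); split.
- apply: measurable_funD => //; apply: measurable_funD => //.
  by apply: measurableT_comp => //; exact: mZ.
- by move=> w; rewrite addr_ge0// addr_ge0.
- apply: (@le_trans _ _ (\int[P]_w ((2 ^+ m.+1)%:E * ((c0 ^+ m.+1)%:E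
      + (2 ^+ m.+1)%:E * ((`|Z t w| ^+ m.+1)%:E + (A w ^+ m.+1)%:E))))%E).
    apply: ge0_le_integral_any => w _.
      by rewrite lee_fin exprn_ge0// addr_ge0// addr_ge0.
    change (((c0 + (`|Z t w| + A w)) ^+ m.+1)%:E <= (2 ^+ m.+1 * (c0 ^+ m.+1
      + 2 ^+ m.+1 * (`|Z t w| ^+ m.+1 + A w ^+ m.+1)))%:E)%E.
    rewrite lee_fin.
    apply: (le_trans (exprnD_le m c00 _)); first by rewrite addr_ge0.
    by rewrite ler_wpM2l ?exprn_ge0// lerD2l exprnD_le.
  have mZA : measurable_fun setT (fun w => ((`|Z t w| ^+ m.+1)%:E + (A w ^+ m.+1)%:E)%E).
    apply: emeasurable_funD; apply/measurable_EFinP; apply: measurable_funX => //.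
    by apply: measurableT_comp => //; exact: mZ.
  have ZA0 w : (0 <= (`|Z t w| ^+ m.+1)%:E + (A w ^+ m.+1)%:E)%E.
    by rewrite -EFinD lee_fin addr_ge0// exprn_ge0.
  rewrite ge0_integralZl_EFin//; last 2 first.
  + by move=> w _; rewrite adde_ge0 ?mule_ge0// lee_fin exprn_ge0.
  + by apply: emeasurable_funD => //; exact: measurable_funeM.
  rewrite /step_moment EFinM lee_pmul2l ?lte_fin ?exprn_gt0//.
  rewrite ge0_integralD//; last 3 first.
  + by move=> w _; rewrite lee_fin exprn_ge0.
  + by move=> w _; rewrite mule_ge0// lee_fin exprn_ge0.
  + exact: measurable_funeM.
  rewrite EFinD; apply: leeD.
    rewrite (_ : (fun=> _) = cst (c0 ^+ m.+1)%:E)// integral_cst//.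
    rewrite -[leRHS]mule1; apply: lee_wpmul2l; first by rewrite lee_fin exprn_ge0.
    exact: probability_le1.
  rewrite ge0_integralZl_EFin//.
  rewrite EFinM lee_pmul2l ?lte_fin ?exprn_gt0//.
  rewrite ge0_integralD//.
  + by rewrite mulr2n mulrDl mul1r EFinD; apply: leeD => //; exact: Zb.
  + by apply/measurable_EFinP; apply: measurable_funX; apply: measurableT_comp => //; exact: mZ.
  + by move=> w _; rewrite lee_fin exprn_ge0.
  + by apply/measurable_EFinP; exact: measurable_funX.
- move: alpha_integrable Y_equation; apply: filterS2 => w Ia Yeq.
  have ktot : 0 <= kappa by rewrite (le_trans l_ge0)// ltW.
  have dts : lam * (t - s) <= del by rewrite mulrC -ler_pdivlMr.
  have h0 : 0 < t - s by rewrite subr_gt0.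
  have kl0 : 0 <= kappa + l by rewrite addr_ge0.
  have small : lam * (kappa + l) * (t - s) <= 2^-1.
    by apply: le_trans del_small; rewrite mulrAC ler_wpM2r.
  have := dissipative_step (ltW lam_gt0) ktot l_ge0 C_ge0 (@Y_continuous w) (@cn w)
    Ia (fun r => @alpha_bound r w) (Yeq) s0 st tT small.
  move/le_trans; apply.
  set dd := lam * (t - s) in dts *.
  have dd0 : 0 <= dd by rewrite mulr_ge0 ?ltW.
  rewrite (_ : lam * (kappa + l) * (t - s) = dd * (kappa + l)); last by rewrite /dd; ring.
  rewrite (_ : lam * (kappa - l) * (t - s) = dd * (kappa - l)); last by rewrite /dd; ring.
  rewrite (_ : 2 * lam * (t - s) * C = 2 * dd * C); last by rewrite /dd; ring.
  have q1 : 2 * (dd * (kappa + l)) ^+ 2 <= dd * theta.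
    rewrite (_ : 2 * _ = dd * (2 * (kappa + l) ^+ 2 * dd)); last by ring.
    rewrite ler_wpM2l//; apply: le_trans del_small2.
    by rewrite ler_wpM2l// mulr_ge0// sqr_ge0.
  have q2 : 2 * (dd * (kappa + l)) * A w <= A w.
    rewrite ler_piMl//; have : dd * (kappa + l) <= 2^-1.
      by apply: le_trans del_small; rewrite ler_wpM2r.
    lra.
  have q3 : 2 * dd * C <= c0 by rewrite /c0 ler_wpM2r// ler_wpM2l.
  have q4 : (1 - dd * (kappa - l) + 2 * (dd * (kappa + l)) ^+ 2) * `|Y s w|
      <= (1 - theta * dd) * `|Y s w|.
    by rewrite ler_wpM2r//; move: q1; rewrite /theta; lra.
  rewrite -/(Z t w) (_ : (t - s)^-1 * _ = A w)//.
  by move: q2 q3 q4; lra.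
Qed.

Let theta_del_gt0 : 0 < theta * del.
Proof. by rewrite mulr_gt0// divr_gt0// subr_gt0. Qed.

Let theta_le : theta <= kappa + l.
Proof. by rewrite /theta; have := l_ge0; have := l_kappa; lra. Qed.

Let theta_del_le1 : theta * del <= 1.
Proof.
have : theta * del <= (kappa + l) * del by rewrite ler_wpM2r// ltW.
have := del_small; rewrite mulrC; lra.
Qed.

Let mYm t : 0 <= t <= T -> measurable_fun setT (fun w => (`|Y t w| ^+ m.+1)%:E).
Proof.
move=> tT; apply/measurable_EFinP; apply: measurable_funX.
by apply: measurableT_comp => //; exact: Y_measurable.
Qed.

(** The bound (1 - r) |Y s| + xi is a convex combination of |Y s| and xi / r. Convexity of the power
    keeps the factor 1 - r in front of the moment of Y, which the cruder splitting with 2^(m+1)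
    would destroy. *)
Lemma moment_contraction s t : 0 <= s -> t <= T -> t - s = del / lam ->
  (\int[P]_w (`|Y s w| ^+ m.+1)%:E <= uniform_moment_bound%:E)%E ->
  (\int[P]_w (`|Y t w| ^+ m.+1)%:E <= uniform_moment_bound%:E)%E.
Proof.
move=> s0 tT ts Ys.
have st : s < t by rewrite -subr_gt0 ts divr_gt0.
have ts' : t - s <= del / lam by rewrite ts.
have [xi [mxi xi0 xim Yst]] := one_step s0 st tT ts'.
set r := theta * del; have r0 : 0 < r := theta_del_gt0; have r1 : r <= 1 := theta_del_le1.
have E1 : theta * (lam * (t - s)) = r by rewrite ts /r; field; rewrite gt_eqF.
have sT : 0 <= s <= T by rewrite s0 (le_trans (ltW st)).
have tT' : 0 <= t <= T by rewrite (le_trans s0 (ltW st)).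
pose c := r * r^-1 ^+ m.+1.
have c0 : 0 <= c by rewrite mulr_ge0 ?exprn_ge0 ?invr_ge0 ?ltW.
have mxim : measurable_fun setT (fun w => (xi w ^+ m.+1)%:E).
  by apply/measurable_EFinP; exact: measurable_funX.
apply: (@le_trans _ _ (\int[P]_w ((1 - r)%:E * (`|Y s w| ^+ m.+1)%:E + c%:E * (xi w ^+ m.+1)%:E))%E).
  apply: ae_ge0_le_integral => //.
  - exact: mYm.
  - move=> w _; rewrite -!EFinM -EFinD lee_fin addr_ge0// mulr_ge0 ?subr_ge0 ?exprn_ge0//.
  - by apply: emeasurable_funD; apply: measurable_funeM => //; exact: mYm.
  move: Yst; apply: filterS => w; rewrite E1 => Yw _.
  rewrite -!EFinM -EFinD lee_fin.
  have r01 : 0 <= 1 - r <= 1 by rewrite subr_ge0 r1 gerBl ltW.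
  have x0 : 0 <= r^-1 * xi w by apply: mulr_ge0 => //; rewrite invr_ge0 ltW.
  have := exprn_convex m r01 (normr_ge0 (Y s w)) x0.
  rewrite subKr mulrA divff ?gt_eqF// mul1r exprMn mulrA -/c; apply: le_trans.
  rewrite lerXn2r ?nnegrE//.
  by rewrite addr_ge0// mulr_ge0// subr_ge0.
rewrite ge0_integralD//; last 4 first.
- by move=> w _; rewrite -EFinM lee_fin mulr_ge0 ?subr_ge0 ?exprn_ge0.
- by apply: measurable_funeM; exact: mYm.
- by move=> w _; rewrite -EFinM lee_fin mulr_ge0 ?exprn_ge0.
- exact: measurable_funeM.
rewrite !ge0_integralZl_EFin//; try exact: mYm; try by rewrite subr_ge0.
  apply: (@le_trans _ _ ((1 - r)%:E * uniform_moment_bound%:E + c%:E * step_moment%:E)%E).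
    by apply: leeD; apply: lee_wpmul2l => //; rewrite lee_fin ?subr_ge0.
  rewrite -!EFinM -EFinD lee_fin.
  have -> : c * step_moment = r * (r^-1 ^+ m.+1 * step_moment) by rewrite /c -mulrA.
  rewrite mulrBl mul1r -addrA gerDl addrC subr_le0 ler_wpM2l ?(ltW r0)//.
  by rewrite /uniform_moment_bound lerDr mulr_ge0 ?exprn_ge0// addr_ge0 ?exprn_ge0.
by move=> w _; rewrite lee_fin exprn_ge0.
Qed.

Lemma moment_start t : 0 <= t <= T -> t <= del / lam ->
  (\int[P]_w (`|Y t w| ^+ m.+1)%:E <= uniform_moment_bound%:E)%E.
Proof.
move=> /andP[t0 tT] td.
have T00 : (0 : R) <= 0 <= T by rewrite lexx ltW.
have tT' : 0 <= t <= T by rewrite t0.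
have Y0 : {ae P, forall w, Y 0 w = y0}.
  have := ito_integral_start T_gt0 F_filtration (W_brownian true) (M_ito true).
  have := ito_integral_start T_gt0 F_filtration (W_brownian false) (M_ito false).
  move: Y_equation; apply: filterS3 => w Yeq M0 M1.
  rewrite (Yeq 0 T00) -/(n 0 w) nE M0 M1 set_itv1 Rintegral_set1.
  by rewrite !addr0.
have [xi [mxi xi0 xim Yst]] : exists xi : Omega -> measurableTypeR R,
  [/\ measurable_fun setT xi, forall w, 0 <= xi w,
      (\int[P]_w (xi w ^+ m.+1)%:E <= step_moment%:E)%E &
      {ae P, forall w, `|Y t w| <= `|y0| + xi w}].
  have [->|tn0] := eqVneq t 0.
    exists (fun=> 0); split => //.
    - rewrite (eq_integral (cst 0%E)); last by move=> w _; rewrite expr0n.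
      by rewrite integral0 lee_fin.
    - by move: Y0; apply: filterS => w ->; rewrite addr0.
  have tgt0 : 0 < t by rewrite lt_neqAle eq_sym tn0.
  have [|xi [h1 h2 h3 h4]] := one_step (lexx 0) tgt0 tT; first by rewrite subr0.
  exists xi; split => //; move: Y0 h4; apply: filterS2 => w -> /le_trans; apply.
  rewrite lerD2r ler_piMl// gerBl subr0; apply: mulr_ge0.
    by rewrite /theta divr_ge0// subr_ge0 ltW.
  by rewrite mulr_ge0// ltW.
have mxim : measurable_fun setT (fun w => (xi w ^+ m.+1)%:E).
  by apply/measurable_EFinP; exact: measurable_funX.
apply: (@le_trans _ _ (\int[P]_w ((2 ^+ m.+1)%:E * ((`|y0| ^+ m.+1)%:E + (xi w ^+ m.+1)%:E)))%E).
  apply: ae_ge0_le_integral => //.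
  - exact: mYm.
  - by move=> w _; rewrite -EFinD -EFinM lee_fin mulr_ge0 ?exprn_ge0// addr_ge0 ?exprn_ge0.
  - by apply: measurable_funeM; exact: emeasurable_funD.
  move: Yst; apply: filterS => w Yw _.
  rewrite -EFinD -EFinM lee_fin; apply: le_trans (exprnD_le m (normr_ge0 y0) (xi0 w)).
  by rewrite lerXn2r ?nnegrE// addr_ge0.
rewrite ge0_integralZl_EFin//; last 2 first.
- by move=> w _; rewrite -EFinD lee_fin addr_ge0 ?exprn_ge0.
- exact: emeasurable_funD.
rewrite ge0_integralD//; last first.
  by move=> w _; rewrite lee_fin exprn_ge0.
apply: (@le_trans _ _ ((2 ^+ m.+1)%:E * ((`|y0| ^+ m.+1)%:E + step_moment%:E))%E).
  rewrite lee_pmul2l ?lte_fin ?exprn_gt0//; apply: leeD => //.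
  rewrite (_ : (fun=> _) = cst (`|y0| ^+ m.+1)%:E)// integral_cst//.
  rewrite -[leRHS]mule1; apply: lee_wpmul2l; first by rewrite lee_fin exprn_ge0.
  exact: probability_le1.
rewrite -EFinD -EFinM lee_fin /uniform_moment_bound lerDl.
by rewrite mulr_ge0 ?exprn_ge0// invr_ge0 ltW.
Qed.

(** Induction on the number of full windows needed to go back from [t] to the initial one. The bound
    is a fixed point of the recursion, so it does not depend on that number. *)
Lemma uniform_moment t : 0 <= t <= T ->
  (\int[P]_w (`|Y t w| ^+ m.+1)%:E <= uniform_moment_bound%:E)%E.
Proof.
move=> tT; have dl0 : 0 < del / lam by rewrite divr_gt0.
have [k tk] : exists k : nat, t <= k.+1%:R * (del / lam).
  exists (Num.truncn (t / (del / lam))).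
  rewrite -ler_pdivrMr//; exact/ltW/Num.Theory.truncnS_gt.
elim: k t tT tk => [|k IH] t tT tk; first by apply: moment_start => //; rewrite -[leRHS]mul1r.
have [td|dt] := leP t (del / lam); first exact: moment_start.
have /andP[t0 tT'] := tT.
apply: (@moment_contraction (t - del / lam)) => //.
- by rewrite subr_ge0 ltW.
- by rewrite subKr.
apply: IH.
  by rewrite subr_ge0 ltW//= (le_trans _ tT')// gerBl ltW.
by rewrite lerBlDr -[X in _ + X]mul1r -mulrDl natr1.
Qed.

End uniform_moment.

(** * The slow-fast particles *)

Lemma brownian_scalar (R : realType) d (Omega : measurableType d)
    (P : probability Omega R) (F : R -> set (set Omega)) (J : eqType)
    (W : J -> R -> Omega -> R) (j : J) :
  brownian P F W -> scalar_brownian P F (W j).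
Proof.
move=> [_ Wc Wa Wi]; split.
- by move=> t B t0 mB; apply: (Wa j t) => //; rewrite t0 lexx.
- move=> s t A B s0 st FA mB.
  have := Wi s t s0 st A [:: j] (fun=> B) FA isT (fun=> mB).
  rewrite big_seq1 fineK ?fin_num_measure// => <-; congr (P (_ `&` _)).
  apply/seteqP; split=> w /=; first by move=> Bw i /=; rewrite inE => /eqP ->.
  by apply; rewrite /= inE.
- exact: Wc.
Qed.

Lemma lawE (R : realType) d (Omega : measurableType d) (P : probability Omega R)
    (X : Omega -> measurableTypeR R) (A : set (measurableTypeR R)) :
  measurable_fun setT X -> (\int[P]_w (X w ^+ 2)%:E < +oo)%E ->
  measurable A -> law P X A = P (X @^-1` A).
Proof.
move=> mX X2; apply: toP2E; apply: (P2_of_measure (m := image_prob P mX)).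
  exact: probability_setT.
rewrite ge0_integral_image_prob//.
  by apply/measurable_EFinP; exact: measurable_funX.
by move=> x; rewrite lee_fin sqr_ge0.
Qed.

Section fast_moments.
Context (R : realType) (T : R) (eps : nat -> R) (q : coeffs R) (etax etay : R).
Context (d : measure_display) (Omega : measurableType d) (P : probability Omega R).
Context (F : R -> set (set Omega)) (W B : nat -> R -> Omega -> R).
Context (X Y : nat -> nat -> R -> Omega -> R).
Hypotheses (T_gt0 : 0 < T) (eps_gt0 : forall N, 0 < eps N).
Hypothesis eps_cvg0 : eps n @[n --> \oo] --> (0 : R).
Hypothesis H1 : uniformly_nondegenerate q.
Hypothesis H2 : dissipative q.
Hypothesis g_bounded : bounded3 (cg q).
Hypothesis F_filtration : filtration F.
Hypothesis WB_brownian : brownian P F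
  (fun j : nat * bool => if j.2 then W j.1 else B j.1).
Hypothesis XY_solution : forall N, (0 < N)%N -> forall i,
  mckean_vlasov_solution P q T (eps N) etax etay F (W i) (B i) (X N i) (Y N i).

(** The rate is lam = eps^-2 and the integrands are at most sqrt(lp)/eps, so K^2 del/lam = lp del.
    The drift without its linear part is eps^-2 (eta + eps g), where [eta] is compared with its
    value at y = 0 and eps with its supremum bound [E]. All arguments of [uniform_moment_bound] are
    thus free of N. *)
Lemma fast_moments m : exists V : R, forall N, (0 < N)%N -> forall i t, 0 <= t <= T ->
  (\int[P]_w (`|Y N i t w| ^+ m.+1)%:E <= V%:E)%E.
Proof.
have [E E0 epsE] : exists2 E : R, 0 <= E & forall N, eps N <= E.
  have /cvgP/cvg_seq_bounded[M [_ hM]] := eps_cvg0.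
  exists (`|M| + 1); first by rewrite addr_ge0.
  move=> N; apply: (le_trans (ler_norm _)); apply: hM => //.
  by rewrite (le_lt_trans (ler_norm _))// ltrDl.
have [[lm [lp [lm0 tau_b]]] _ _] := H1.
have [beta [kappa [l [eta [[beta0 kappa0 lk] fE eta0 [_ etaL] _]]]]] := H2.
have [G gG] := g_bounded.
have [C0 etaC0] := eta0 0.
have l0 : 0 <= l.
  have := etaL 0 1 0 (delta0 R); rewrite subr0 normr1 mulr1.
  exact: le_trans.
have lp0 : 0 <= lp.
  by have /andP[h1 h2] := tau_b 0 0 (delta0 R); rewrite (le_trans _ h2)// (le_trans _ h1)// ltW.
have C00 : 0 <= C0 := le_trans (normr_ge0 _) (etaC0 0 (delta0 R)).
have G0 : 0 <= G := le_trans (normr_ge0 _) (gG 0 0 (delta0 R)).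
pose C := C0 + E * G.
have C_ge0 : 0 <= C by rewrite addr_ge0// mulr_ge0.
have kl0 : 0 < kappa + l by rewrite ltr_wpDr.
(* This choice makes [del2] an equality, and del (kappa + l) is then at most 1/4. *)
pose del := (kappa - l) / (4 * (kappa + l) ^+ 2).
have del0 : 0 < del by rewrite divr_gt0 ?subr_gt0// mulr_gt0// exprn_gt0.
have del1 : del * (kappa + l) <= 2^-1.
  rewrite (_ : del * _ = (kappa - l) / (4 * (kappa + l))); last first.
    by rewrite /del; field; rewrite gt_eqF.
  by rewrite ler_pdivrMr ?mulr_gt0//; lra.
have del2 : 2 * (kappa + l) ^+ 2 * del <= (kappa - l) / 2.
  rewrite le_eqVlt; apply/orP; left; apply/eqP; rewrite /del; field.
  by rewrite gt_eqF.
exists (uniform_moment_bound etay kappa l C del (lp * del) m) => N N0 i t tT.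
have e0 := eps_gt0 N; set e := eps N in e0 *.
have [X2 [Xeq Yeq]] := XY_solution N0 i.
have [[Yad Yc] _ Ia [M [Mito Ydec]]] := Yeq.
pose WB (j : bool) := if j then W i else B i.
have WB_scalar j : scalar_brownian P F (WB j).
  by have := brownian_scalar (i, j) WB_brownian.
have Hb (j : bool) r w : 0 <= r <= T ->
    `|(if j then ctau1 q else ctau2 q) (X N i r w) (Y N i r w) (law P (X N i r)) / e|
      <= Num.sqrt lp / e.
  move=> _; rewrite normrM normfV (gtr0_norm e0) ler_wpM2r ?invr_ge0 ?(ltW e0)//.
  have /andP[_ h] := tau_b (X N i r w) (Y N i r w) (law P (X N i r)).
  rewrite -sqrtr_sqr ler_wsqrtr//.
  by case: j; apply: le_trans h; rewrite ?lerDl ?lerDr sqr_ge0.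
have lam0 : 0 < e ^- 2 by rewrite invr_gt0 exprn_gt0.
have mY r : 0 <= r <= T -> measurable_fun setT (Y N i r : Omega -> measurableTypeR R).
  move=> rT; have /andP[r0 _] := rT.
  by apply: (adapted_measurable F_filtration r0) => A mA; exact: Yad.
have eN : e != 0 by rewrite gt_eqF.
have drift r w : 0 <= r <= T ->
    `|(cf q (X N i r w) (Y N i r w) (law P (X N i r)) / e
        + cg q (X N i r w) (Y N i r w) (law P (X N i r))) / e + e ^- 2 * kappa * Y N i r w|
      <= e ^- 2 * (l * `|Y N i r w| + C).
  move=> rT; rewrite fE.
  set y := Y N i r w; set x := X N i r w; set mu := law P (X N i r).
  rewrite (_ : _ + _ = e ^- 2 * (eta x y mu + e * cg q x y mu)); last by field.
  rewrite normrM gtr0_norm ?invr_gt0 ?exprn_gt0// ler_wpM2l ?invr_ge0 ?exprn_ge0 ?(ltW e0)//.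
  rewrite (le_trans (ler_normD _ _))// /C addrA lerD//.
    have := etaL x y 0 mu; rewrite subr0 => h.
    rewrite -[in leLHS](subrK (eta x 0 mu) (eta x y mu)) (le_trans (ler_normD _ _))//.
    exact: lerD.
  by rewrite normrM (gtr0_norm e0) ler_pM// ?(ltW e0)// epsE.
have Kk0 : (Num.sqrt lp / e) ^+ 2 * (del / e ^- 2) <= lp * del.
  rewrite invrK exprMn sqr_sqrtr// exprVn.
  by rewrite le_eqVlt; apply/orP; left; apply/eqP; field.
exact: (uniform_moment T_gt0 F_filtration WB_scalar Hb Mito lam0 l0 lk C_ge0
  mY Yc Ia drift Ydec m del0 del1 del2 Kk0 tT).
Qed.

End fast_moments.

Theorem lemmaD7 (R : realType) (T : R) (eps : nat -> R) (q : coeffs R)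
  (etax etay : R) (pi : R -> P2 R -> probability (measurableTypeR R) R)
  (Phi : R -> R -> P2 R -> R) (chi : R * R -> R * R -> P2 R -> R)
  (p : R -> R -> P2 R -> R)
  (d : measure_display) (Omega : measurableType d) (P : probability Omega R)
  (F : R -> set (set Omega)) (W B : nat -> R -> Omega -> R)
  (X Y : nat -> nat -> R -> Omega -> R)
  (T_gt0 : 0 < T)
  (eps_gt0 : forall N, 0 < eps N)
  (eps_cvg0 : eps n @[n --> \oo] --> (0 : R))
  (p_measurable : measurable_xy p)
  (p_lfds : bounded_lfds p)
  (p_lipschitz : lipschitz_measure p)
  (H1 : uniformly_nondegenerate q)
  (H2 : dissipative q)
  (Hpi : is_invariant_measure q pi)
  (H3 : centering q pi)
  (HPhi : is_corrector q pi Phi)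
  (H4 : systems_well_posed q (averaged pi (coef_gamma q Phi))
          (averaged pi (coef_D q Phi)) T etax etay eps)
  (H5 : coeffs_growth q)
  (H6 : corrector_regular Phi)
  (Hchi : is_double_corrector q pi Phi chi)
  (H7 : double_corrector_regular chi)
  (H9 : effective_lipschitz q Phi)
  (F_filtration : filtration F)
  (WB_brownian : brownian P F
     (fun j : nat * bool => if j.2 then W j.1 else B j.1))
  (XY_solution : forall N, (0 < N)%N -> forall i,
     mckean_vlasov_solution P q T (eps N) etax etay F (W i) (B i) (X N i) (Y N i))
  (XY_independent : forall N, (0 < N)%N -> independent_pairs P T (X N) (Y N))
  (XY_identical : forall N, (0 < N)%N -> identically_distributed P T (X N) (Y N)) :
  exists2 C : R, 0 < C &
    forall N, (2 <= N)%N -> forall i, (i < N)%N -> forall t : R, 0 <= t <= T ->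
      (\int[P]_w
         (`| p (X N i t w) (Y N i t w) (empirical (fun j : 'I_N => X N j t w))
             - p (X N i t w) (Y N i t w) (law P (X N i t)) | ^+ 2)%:E
       <= (C / (N.-1)%:R)%:E)%E.
Proof.
have [D [D2 [pD [C [k [C_gt0 DC]]]]]] := p_lfds.
have g_bounded : bounded3 (cg q) by case: H5 => -[].
(* The moment bounds have exponents of the form [m.+1]; order 2k + 1 dominates the power 2k
   occurring in K^2, including k = 0. *)
have [V YV] := fast_moments T_gt0 eps_gt0 eps_cvg0 H1 H2 g_bounded F_filtration
  WB_brownian XY_solution (2 * k)%N.
pose K (y : R) : R := C * (1 + `|y| ^+ k).
have K0 y : 0 <= K y by rewrite mulr_ge0 ?(ltW C_gt0)// addr_ge0// exprn_ge0.
have DK x y m z : `|D x y m z| <= K y.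
  by apply: le_trans (DC y x m z 0 (delta0 R) 0 0); rewrite lerDl.
have D2K x y m z z' : `|D2 x y m z z'| <= K y.
  by apply: le_trans (DC y 0 (delta0 R) 0 x m z z'); rewrite lerDr.
have mK : measurable_fun setT (K : measurableTypeR R -> measurableTypeR R).
  apply: measurable_funM => //; apply: measurable_funD => //.
  by apply: measurable_funX; exact: normr_measurable.
(* With y = |Y|, (1 + y^k)^2 <= 2 + 2 y^(2k) <= 4 + 2 y^(2k+1). The absolute value is taken because
   the sign of [V] is not recorded. *)
pose c := C ^+ 2 * (4 + 2 * `|V|).
have c0 : 0 <= c by rewrite mulr_ge0 ?sqr_ge0// addr_ge0// mulr_ge0.
exists (48 * c + 1); first by rewrite ltr_wpDl// mulr_ge0.
move=> N N2 i iN t tT.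
have N0 : (0 < N)%N := ltnW N2.
have /andP[t0 _] := tT.
have mX j : measurable_fun setT (X N j t : Omega -> measurableTypeR R).
  have [_ [[[Xad _] _ _ _] _]] := XY_solution N N0 j.
  by apply: (adapted_measurable F_filtration t0) => A mA; exact: Xad.
have mY j r : 0 <= r <= T -> measurable_fun setT (Y N j r : Omega -> measurableTypeR R).
  move=> rT; have /andP[r0 _] := rT.
  have [_ [_ [[Yad _] _ _ _]]] := XY_solution N N0 j.
  by apply: (adapted_measurable F_filtration r0) => A mA; exact: Yad.
have mXr j r : 0 <= r <= T -> measurable_fun setT (X N j r : Omega -> measurableTypeR R).
  move=> rT; have /andP[r0 _] := rT.
  have [_ [[[Xad _] _ _ _] _]] := XY_solution N N0 j.
  by apply: (adapted_measurable F_filtration r0) => A mA; exact: Xad.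
pose mu := law P (X N i t).
have Xlaw j A : measurable A -> P (X N j t @^-1` A) = mu A.
  move=> mA; have [X2 _] := XY_solution N N0 i.
  rewrite /mu lawE//; last exact: X2.
  have /= := XY_identical N N0 j i 1 (fun=> t) (fun=> A) (fun=> setT) (fun=> tT)
    (fun=> mA) (fun=> measurableT).
  rewrite (_ : \bigcap_(_ in _) _ = X N j t @^-1` A); last first.
    by apply/seteqP; split=> w /=; [move=> /(_ 0%N isT)[]|].
  rewrite (_ : \bigcap_(_ in _) _ = X N i t @^-1` A)//.
  by apply/seteqP; split=> w /=; [move=> /(_ 0%N isT)[]|].
(* [events j] repeats the sigma-algebra used in [independent_pairs], generated by the whole path of
   particle j on [[0, T]], so that the independence hypothesis applies verbatim. *)
pose gen j := [set A | exists r (E : set (measurableTypeR R)),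
  [/\ 0 <= r <= T, measurable E & A = X N j r @^-1` E \/ A = Y N j r @^-1` E]].
pose events j := <<s gen j >>.
have eventsm j : events j `<=` measurable.
  apply: smallest_sub; first exact: sigma_algebra_measurable.
  move=> _ [r [E [rT mE [->|->]]]].
    by rewrite -[X in measurable X]setTI; exact: mXr.
  by rewrite -[X in measurable X]setTI; exact: mY.
have eventsI j : setI_closed (events j).
  by move=> A A' eA eA'; apply: (@measurableI _ (g_sigma_algebraType (gen j))).
have eventsT j : events j setT.
  exact: (@measurableT _ (g_sigma_algebraType (gen j))).
have Xev j A : measurable A -> events j (X N j t @^-1` A).
  by move=> mA; apply: sub_sigma_algebra; exists t, A; split => //; left.
have Yev j A : measurable A -> events j (Y N j t @^-1` A).
  by move=> mA; apply: sub_sigma_algebra; exists t, A; split => //; right.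
have main := @integral_empirical_le R d Omega P events eventsm eventsI eventsT
  (XY_independent N N0) p p_measurable p_lipschitz D D2 K pD DK D2K mK N mu N0
  (fun j => X N j t) (fun j => Y N j t) Xev Yev Xlaw i iN.
apply: (le_trans main).
have EK : (\int[P]_w (K (Y N i t w) ^+ 2)%:E <= c%:E)%E.
  have mYt := mY i t tT.
  apply: (@le_trans _ _ (\int[P]_w ((C ^+ 2 * 4)%:E
      + (C ^+ 2 * 2)%:E * (`|Y N i t w| ^+ (2 * k).+1)%:E))%E).
    apply: ge0_le_integral_any => w _; first by rewrite lee_fin sqr_ge0.
    change ((K (Y N i t w) ^+ 2)%:E
      <= (C ^+ 2 * 4 + C ^+ 2 * 2 * `|Y N i t w| ^+ (2 * k).+1)%:E)%E.
    rewrite lee_fin /K exprMn -mulrA -mulrDr ler_wpM2l ?sqr_ge0//.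
    set y := `|_|; have y0 : 0 <= y by rewrite normr_ge0.
    have h1 : y ^+ (2 * k) <= 1 + y ^+ (2 * k).+1.
      have [y1|y1] := leP y 1.
        by rewrite (le_trans (exprn_ile1 _ _ _))// lerDl exprn_ge0.
      by rewrite (le_trans (ler_weXn2l (ltW y1) (leqnSn _)))// lerDr.
    have : 0 <= (1 - y ^+ k) ^+ 2 by exact: sqr_ge0.
    move: h1; rewrite mulnC exprM; lra.
  have mYk : measurable_fun setT (fun w => (`|Y N i t w| ^+ (2 * k).+1)%:E).
    apply/measurable_EFinP; apply: measurable_funX.
    by apply: measurableT_comp mYt; exact: normr_measurable.
  rewrite ge0_integralD//; last 3 first.
  - by move=> w _; rewrite lee_fin mulr_ge0// sqr_ge0.
  - by move=> w _; rewrite -EFinM lee_fin mulr_ge0 ?exprn_ge0// mulr_ge0// sqr_ge0.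
  - exact: measurable_funeM.
  rewrite (_ : c = C ^+ 2 * 4 + C ^+ 2 * 2 * `|V|); last by rewrite /c; ring.
  rewrite [leRHS]EFinD; apply: leeD.
    rewrite (_ : (fun=> _) = cst (C ^+ 2 * 4)%:E)// integral_cst//.
    rewrite -[leRHS]mule1; apply: lee_wpmul2l; last exact: probability_le1.
    by rewrite lee_fin mulr_ge0// sqr_ge0.
  rewrite ge0_integralZl_EFin//; last by rewrite mulr_ge0// sqr_ge0.
  rewrite [leRHS]EFinM; apply: lee_wpmul2l; first by rewrite lee_fin mulr_ge0// sqr_ge0.
  by apply: (le_trans (YV N N0 i t tT)); rewrite lee_fin ler_norm.
apply: (@le_trans _ _ ((48 / N%:R)%:E * c%:E)%E).
  by apply: lee_wpmul2l => //; rewrite lee_fin divr_ge0.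
rewrite -EFinM lee_fin.
have N1 : 0 < (N.-1%:R : R) by rewrite ltr0n -subn1 subn_gt0.
rewrite mulrAC; apply: ler_pM.
- by rewrite mulr_ge0.
- by rewrite invr_ge0.
- by rewrite lerDl.
- have N0' : 0 < (N%:R : R) by rewrite ltr0n.
  by rewrite lef_pV2 ?posrE// ler_nat leq_pred.
Qed.
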